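(* Let $m>1$, $D>0$ and $r\ge 0$, and let $b,d$ satisfy the standing assumptions below. Then there exists a constant $c_0=c_0(m,r,b,d)>0$, depending on $m$, $r$ and the structure of $b(\cdot),d(\cdot)$, such that for $c=c_0$ the wave profile equation $$c\phi'(t)=D(\phi^m)''(t)-d(\phi(t))+b(\phi(t-cr)),\qquad t\in\mathbb R,$$ admits a sharp wave solution $\phi$ (a semi-wavefront or wavefront, of non-$C^1$ type or $C^1$ type) with $\phi(t)\equiv0$ for $t\le0$, $\phi(t)>0$ for $t>0$, $$0<\zeta_1\le\liminf_{t\to+\infty}\phi(t)\le\limsup_{t\to+\infty}\phi(t)\le\zeta_2,$$ and $$|\phi(t)-C_1t_+^{\lambda}|\le C_2t_+^{\Lambda}\quad\text{for all } t\in(0,1),$$ where $t_+=\max\{t,0\}$, $\lambda=1/(m-1)$, and $\Lambda>\lambda$, $C_1,C_2>0$ are constants.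
   Context: Standing assumptions: the death rate $d\in C^2([0,+\infty))$ satisfies $d(0)=0$, $d'(s)>0$ and $d''(s)\ge0$ for $s>0$. The birth rate $b\in C^1([0,+\infty);[0,+\infty))$ has exactly one positive local extremum point $s_M$, which is its global maximum point; $b(0)=0$; there is $\kappa>0$ with $b(\kappa)=d(\kappa)$; $b'(0)>d'(0)$; $b'(\kappa)<d'(\kappa)$; and $d(s)<b(s)\le b'(0)s$ for $s\in(0,\kappa)$. Moreover $s_M<\kappa$. Set $M:=b(s_M)=\max b$, $\zeta_2:=d^{-1}(M)$, $\theta:=b(\zeta_2)$, and let $\zeta_1\in(0,s_M)$ be the unique point with $b(\zeta_1)=\theta$. Definitions: a function $0\le\phi\in W^{1,1}_{\rm loc}(\mathbb R)\cap L^\infty(\mathbb R)$ with $\phi^m\in W^{1,1}_{\rm loc}(\mathbb R)$ is a semi-wavefront (of speed $c>0$) if (i) it satisfies the wave profile equation in the sense of distributions; (ii) $\phi(-\infty)=0$ and $0<\liminf_{t\to+\infty}\phi(t)\le\limsup_{t\to+\infty}\phi(t)<+\infty$; (iii) there is a maximal interval $(-\infty,t_0)$, $t_0\in(-\infty,+\infty]$, on which $\phi$ is monotonically increasing, and if $t_0<+\infty$ then $\phi(t_0)>\kappa$. A wavefront is a semi-wavefront with $\phi(+\infty)=\kappa$. A wave solution means a semi-wavefront or wavefront. It is sharp if there is $t_*\in\mathbb R$ with $\phi(t)=0$ for $t\le t_*$ and $\phi(t)>0$ for $t>t_*$. A sharp wave is of non-$C^1$ type if $\phi''\notin L^1_{\rm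 loc}(\mathbb R)$ and of $C^1$ type if $\phi''\in L^1_{\rm loc}(\mathbb R)$.
   Formalization: The constant c_0 is allowed to depend on D as well as on m, r, b, d: rescaling t by √D multiplies the sharp speed by √D, so a c_0 independent of D cannot exist; the non-C^1/C^1 alternative, a tautology, is not stated. *)

(* Defs.v *)
From HB Require Import structures.
From mathcomp Require Import all_boot all_order all_algebra.
From mathcomp Require Import all_classical all_reals all_analysis.
Set Implicit Arguments. Unset Strict Implicit. Unset Printing Implicit Defensive.
Import Order.TTheory GRing.Theory Num.Theory.
Import numFieldNormedType.Exports.
Local Open Scope classical_set_scope.
Local Open Scope ring_scope.

Section Defs.
Context {R : realType}.
Local Notation mu := (@lebesgue_measure R).

Definition C1_nonneg (f f1 : R -> R) : Prop :=
  [/\ {within [set x : R | 0 <= x], continuous f1},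
      (forall x : R, 0 < x -> is_derive x 1 f (f1 x)) &
      (h^-1 * (f h - f 0)) @[h --> (0:R)^'+] --> f1 0].

Definition C2_nonneg (f f1 f2 : R -> R) : Prop :=
  C1_nonneg f f1 /\ C1_nonneg f1 f2.

Definition local_extremum (f : R -> R) (x : R) : Prop :=
  (\forall y \near x, f y <= f x) \/ (\forall y \near x, f x <= f y).

(* W^{1,1}_loc(R) (continuous representative): f is locally absolutely
   continuous, i.e. the primitive of a locally integrable function. *)
Definition W11loc (f : R -> R) : Prop :=
  exists g : R -> R, locally_integrable setT g /\
    forall x y, x <= y ->
      ((f y - f x)%:E = \int[mu]_(t in `[x, y]) (g t)%:E)%E.

Definition test_function (psi : R -> R) : Prop :=
  (forall n x, derivable (derive1n n psi) x 1) /\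
  exists K : R, forall x, K < `|x| -> psi x = 0.

Definition wave_eq_distr (m D r c : R) (b d phi : R -> R) : Prop :=
  forall psi, test_function psi ->
    (\int[mu]_(t in setT)
       ((c * phi t * derive1n 1 psi t
         + D * (phi t `^ m) * derive1n 2 psi t
         - d (phi t) * psi t
         + b (phi (t - c * r)) * psi t)%:E) = 0%:E)%E.

Definition lim_sup_pinfty (phi : R -> R) : \bar R :=
  limf_esup (EFin \o phi) (@pinfty_nbhs R).
Definition lim_inf_pinfty (phi : R -> R) : \bar R :=
  limf_einf (EFin \o phi) (@pinfty_nbhs R).

Definition nondecr_below (phi : R -> R) (t0 : \bar R) : Prop :=
  forall x y, x <= y -> (y%:E < t0)%E -> phi x <= phi y.

Definition semi_wavefront (m D r kappa c : R) (b d phi : R -> R) : Prop :=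
  [/\ [/\ (forall t, 0 <= phi t),
          (exists B, forall t, `|phi t| <= B),
          W11loc phi & W11loc (fun t => phi t `^ m)],
      wave_eq_distr m D r c b d phi,
      [/\ phi t @[t --> -oo] --> 0,
          (0 < lim_inf_pinfty phi)%E,
          (lim_inf_pinfty phi <= lim_sup_pinfty phi)%E &
          (lim_sup_pinfty phi < +oo)%E] &
      exists t0 : \bar R,
        [/\ t0 <> -oo%E, nondecr_below phi t0,
            (forall t1 : R, (t0 < t1%:E)%E -> ~ nondecr_below phi t1%:E) &
            (forall t0r : R, t0 = t0r%:E -> kappa < phi t0r)]].

Definition wavefront (m D r kappa c : R) (b d phi : R -> R) : Prop :=
  semi_wavefront m D r kappa c b d phi /\ phi t @[t --> +oo] --> kappa.

Definition sharp_at (phi : R -> R) (tstar : R) : Prop :=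
  (forall t, t <= tstar -> phi t = 0) /\ (forall t, tstar < t -> 0 < phi t).

End Defs.

(* Main.v *)
Require Import Defs.
From HB Require Import structures.
From mathcomp Require Import all_boot all_order all_algebra.
From mathcomp Require Import all_classical all_reals all_analysis.
From mathcomp Require Import measurable_realfun lra ring.
Set Implicit Arguments. Unset Strict Implicit. Unset Printing Implicit Defensive.
Import Order.TTheory GRing.Theory Num.Theory.
Import numFieldNormedType.Exports.
Local Open Scope classical_set_scope.
Local Open Scope ring_scope.

(** In the variable [x = t / c] the delay is [r], independent of [c]. With the
    pressure [v = phi^(m-1)], [psi = v^(1/(m-1))] and
    [W(x) = int_0^x (d(psi(s)) - b(psi(s - r))) ds], a sharp wave solves
      [v' = g (1 + W / psi)],  [v(0) = 0],  [g = c^2 (m-1) / (m D)],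
    which is a contraction in a weight of the form [x exp(mu x)]: for each [g] there
    is exactly one solution as long as it stays positive, and it depends
    continuously on [g]. The sign of [v'] is that of the flux [psi + W].

    The wave is found by shooting in [g]. For large [g] the solution exceeds
    [zeta2], and then never returns below it; for small [g] it starts to decrease
    below [zeta1]. Both sets of speeds are open, and they are disjoint: at the
    first critical point either [psi <= kappa], and then [psi] never rises above
    this value again, or [psi > kappa], which forces the delayed density above
    [zeta1] and excludes any later interior minimum below [zeta1]. Since
    [(0, +oo)] is connected, some speed belongs to neither set; its solution is
    global, increases as long as it is below [zeta1], hence eventually stays
    between [zeta1] and [zeta2]. *)

(** * Real calculus *)

(** Since the profile vanishes for t <= 0, the equation integrates once with no constant left: D
    (phi^m)' = c phi plus the accumulated net loss. This form holds across the front, where phi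
    itself need not be differentiable, and its singularity is mild: v is of order x, hence psi of
    order x^lam, while W, a primitive of terms of order x^lam, is of order x^(lam + 1); so W / psi
    is O(x). The obstacle is that the delayed term enters through a non-monotone [b]: solutions may
    oscillate and cannot be compared by order, neither with each other nor in g. Hence the
    topological choice of g, and the use of [b] mainly through quasi-concavity: between two
    densities [b] is at least the smaller of its end values. At an interior minimum of v births
    cannot exceed deaths, and this turns each unwanted return into a contradiction. The two levels
    fit this: d(zeta2) = max b lets nothing come back from above zeta2, and b(zeta1) = b(zeta2)
    makes births from densities in [zeta1, zeta2] at least those from densities below zeta1. *)

Ltac nonneg := repeat first [ assumption | by [] | (apply: ltW; assumption)
  | apply: powR_ge0 | apply: expR_ge0 | apply: normr_ge0 | rewrite invr_ge0
  | apply: mulr_ge0 | apply: addr_ge0 ].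

Ltac posit := repeat first [ assumption | by [] | apply: powR_gt0
  | apply: expR_gt0 | rewrite invr_gt0 | apply: mulr_gt0 | apply: addr_gt0 ].

Section Calculus.
Context {R : realType}.
Implicit Types (f g : R -> R) (a b x y : R).

(** Continuity is global but derivatives are asked only inside the interval: the solutions compared
    below are extended by zero to the left of [0] and satisfy their equation only to its right. *)
Lemma derive_ge0_le f f' a b : a <= b -> continuous f ->
  (forall x, a < x < b -> is_derive x 1 f (f' x)) ->
  (forall x, a < x < b -> 0 <= f' x) -> f a <= f b.
Proof.
move=> ab cf df f0.
move: ab; rewrite le_eqVlt => /predU1P[->//|ab].
have dfi x : x \in `]a, b[%R -> is_derive x 1 f (f' x) by rewrite in_itv/= => /df.
have [d dab fE'] := MVT ab dfi (continuous_subspaceT cf).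
rewrite -subr_ge0 fE' mulr_ge0//; last by rewrite subr_ge0 ltW.
by apply: f0; move: dab; rewrite in_itv.
Qed.

Lemma derive_gt0_lt f f' a b : a < b -> continuous f ->
  (forall x, a < x < b -> is_derive x 1 f (f' x)) ->
  (forall x, a < x < b -> 0 < f' x) -> f a < f b.
Proof.
move=> ab cf df f0.
have dfi x : x \in `]a, b[%R -> is_derive x 1 f (f' x) by rewrite in_itv/= => /df.
have [d dab fE'] := MVT ab dfi (continuous_subspaceT cf).
rewrite -subr_gt0 fE' mulr_gt0 ?subr_gt0//.
by apply: f0; move: dab; rewrite in_itv.
Qed.

Lemma derive_le f g f' g' a b : a <= b -> continuous f -> continuous g ->
  (forall x, a < x < b -> is_derive x 1 f (f' x)) ->
  (forall x, a < x < b -> is_derive x 1 g (g' x)) ->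
  (forall x, a < x < b -> f' x <= g' x) -> f a <= g a -> f b <= g b.
Proof.
move=> ab cf cg df dg fg fga.
suff : (g - f) a <= (g - f) b.
  rewrite !fctE => h; lra.
apply: (@derive_ge0_le _ (fun x => g' x - f' x)) => //.
- by move=> x; apply: continuousB; [exact: cg|exact: cf].
- by move=> x xab; have := df x xab; have := dg x xab => ? ?; exact: is_deriveB.
- by move=> x /fg; rewrite subr_ge0.
Qed.

Lemma derive_norm_le f g f' g' a b : a <= b -> continuous f -> continuous g ->
  (forall x, a < x < b -> is_derive x 1 f (f' x)) ->
  (forall x, a < x < b -> is_derive x 1 g (g' x)) ->
  (forall x, a < x < b -> `|f' x| <= g' x) -> `|f a| <= g a -> `|f b| <= g b.
Proof.
move=> ab cf cg df dg fg; rewrite !ler_norml => /andP[h1 h2]; apply/andP; split.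
  rewrite lerNl.
  apply: (@derive_le (- f) g (fun x => - f' x) g' a b) => //.
  - by move=> x; apply: continuousN; exact: cf.
  - by move=> x xab; have := df x xab => ?; exact: is_deriveN.
  - by move=> x /fg; rewrite ler_norml lerNl => /andP[].
  - by rewrite fctE lerNl.
apply: (@derive_le f g f' g' a b) => //.
by move=> x /fg; rewrite ler_norml => /andP[].
Qed.

Lemma derive_lt0_right f (q l e : R) : is_derive q 1 f l -> l < 0 -> 0 < e ->
  exists d, [/\ 0 < d, d <= e & forall y, q < y < q + d -> f y < f q].
Proof.
move=> [df fl] l0 e0.
have : h^-1 *: (f (h *: 1 + q) - f q) @[h --> 0^'] --> l.
  by rewrite -fl; exact: df.
move=> /cvgrPdist_lt /(_ (- l)); rewrite oppr_gt0 => /(_ l0).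
rewrite near_withinE => /nbhs_ballP[d/= d0 H].
exists (Num.min d e); split; first by rewrite lt_min d0.
  by rewrite ge_min lexx orbT.
move=> y /andP[qy yd].
have yqd : y - q < d by move: yd; rewrite -ltrBlDl lt_min => /andP[].
have := H (y - q); rewrite /ball/= sub0r normrN gtr0_norm ?subr_gt0//.
move=> /(_ yqd); rewrite subr_eq0 gt_eqF// => /(_ isT).
rewrite /GRing.scale/= mulr1 subrK => h.
have yq0 : 0 < y - q by rewrite subr_gt0.
have : (y - q)^-1 * (f y - f q) < 0.
  move: h; rewrite distrC ltr_norml => /andP[_]; lra.
by rewrite pmulr_rlt0 ?invr_gt0// subr_lt0.
Qed.

Lemma derive_gt0_right f (q l e : R) : is_derive q 1 f l -> 0 < l -> 0 < e ->
  exists d, [/\ 0 < d, d <= e & forall y, q < y < q + d -> f q < f y].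
Proof.
move=> df l0 e0.
have dNf : is_derive q 1 (- f) (- l) by exact: is_deriveN.
have [|d [d0 de H]] := derive_lt0_right dNf _ e0; first by rewrite oppr_lt0.
by exists d; split=> // y /H; rewrite !fctE ltrN2.
Qed.

Lemma derive_gt0_left f (q l e : R) : is_derive q 1 f l -> 0 < l -> 0 < e ->
  exists d, [/\ 0 < d, d <= e & forall y, q - d < y < q -> f y < f q].
Proof.
move=> [df fl] l0 e0.
have : h^-1 *: (f (h *: 1 + q) - f q) @[h --> 0^'] --> l.
  by rewrite -fl; exact: df.
move=> /cvgrPdist_lt /(_ l l0).
rewrite near_withinE => /nbhs_ballP[d/= d0 H].
exists (Num.min d e); split; first by rewrite lt_min d0.
  by rewrite ge_min lexx orbT.
move=> y /andP[qy yq].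
have yqd : q - y < d by move: qy; rewrite ltrBlDr -ltrBlDl lt_min => /andP[].
have := H (y - q); rewrite /ball/= sub0r normrN distrC gtr0_norm ?subr_gt0//.
move=> /(_ yqd); rewrite subr_eq0 lt_eqF// => /(_ isT).
rewrite /GRing.scale/= mulr1 subrK => h.
have yq0 : y - q < 0 by rewrite subr_lt0.
have : 0 < (y - q)^-1 * (f y - f q).
  move: h; rewrite distrC ltr_norml => /andP[]; lra.
by rewrite nmulr_rgt0 ?invr_lt0// subr_lt0.
Qed.

Lemma first_nonpos f a b : a <= b -> continuous f -> 0 < f a -> f b <= 0 ->
  exists t, [/\ a < t <= b, f t = 0 & forall x, a <= x < t -> 0 < f x].
Proof.
move=> ab cf fa fb.
pose S := [set x | a <= x <= b /\ f x <= 0].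
have Sb : S b by split=> //; rewrite ab lexx.
have Slb : lbound S a by move=> x [/andP[]].
have hS : has_inf S by split; [exists b|exists a].
set t := inf S.
have at_ : a <= t by apply: lb_le_inf => //; exists b.
have tb : t <= b by apply: ge_inf => //; exists a.
have pos x : a <= x < t -> 0 < f x.
  move=> /andP[ax xt]; rewrite ltNge; apply/negP => fx.
  have : t <= x.
    apply: ge_inf; first by exists a.
    by split=> //; rewrite ax (le_trans (ltW xt)).
  by rewrite leNgt xt.
have ft0 : f t <= 0.
  rewrite leNgt; apply/negP => ft.
  have /cvgrPdist_lt /(_ (f t) ft) := cf t.
  move=> /nbhs_ballP[d/= d0 H].
  have [x Sx xd] := inf_adherent d0 hS.
  have tx : t <= x by apply: ge_inf => //; exists a.
  have /H : ball t d x by rewrite /ball/= distrC ger0_norm ?subr_ge0// ltrBlDl.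
  case: Sx => _ fx; rewrite ltr_norml => /andP[_]; lra.
have at1 : a < t.
  by rewrite lt_neqAle at_ andbT; apply/eqP => E; move: ft0; rewrite -E leNgt fa.
exists t; split=> //; first by rewrite at1.
apply/eqP; rewrite eq_le ft0 /= leNgt; apply/negP => ft.
have /cvgrPdist_lt /(_ (- f t)) := cf t; rewrite oppr_gt0 => /(_ ft).
move=> /nbhs_ballP[d/= d0 H].
pose x := Num.max a (t - d / 2).
have xt : x < t by rewrite gt_max at1/= ltrBlDr ltrDl divr_gt0.
have /pos fx : a <= x < t by rewrite le_max lexx.
have : t - d / 2 <= x by rewrite le_max lexx orbT.
move=> tdx.
have /H : ball t d x.
  by rewrite /ball/= gtr0_norm ?subr_gt0//; lra.
rewrite ltr_norml => /andP[]; lra.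
Qed.

Lemma last_nonpos f a b : a <= b -> continuous f -> f a <= 0 -> 0 < f b ->
  exists t, [/\ a <= t < b, f t = 0 & forall x, t < x <= b -> 0 < f x].
Proof.
move=> ab cf fa fb.
have cg : continuous (fun x => f (- x)).
  by move=> x; apply: continuous_comp; [exact: oppr_continuous|exact: cf].
have ba : - b <= - a by rewrite lerN2.
have [||t [/andP[t1 t2] ft H]] := first_nonpos ba cg; [by rewrite opprK..|].
exists (- t); split=> //; first by rewrite lerNr t2 ltrNl.
move=> x /andP[tx xb]; rewrite -(opprK x); apply: H.
by rewrite lerN2 xb ltrNl.
Qed.

(** [f] may touch zero several times before it becomes positive. The point [s] is the infimum of the
    positivity set, so positive values occur arbitrarily close to its right, which [f s = 0] alone
    would not give. *)
Lemma first_pos f a b : a <= b -> continuous f -> f a <= 0 -> 0 < f b ->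
  exists s, [/\ a <= s < b, f s = 0, forall x, a <= x <= s -> f x <= 0 &
    forall d, 0 < d -> exists2 y, s < y < s + d & 0 < f y].
Proof.
move=> ab cf fa fb.
pose S := [set x | a <= x <= b /\ 0 < f x].
have Sb : S b by split=> //; rewrite ab lexx.
have Slb : lbound S a by move=> x [/andP[]].
have hS : has_inf S by split; [exists b|exists a].
set t := inf S.
have at_ : a <= t by apply: lb_le_inf => //; exists b.
have tb : t <= b by apply: ge_inf => //; exists a.
have npos x : a <= x < t -> f x <= 0.
  move=> /andP[ax xt]; rewrite leNgt; apply/negP => fx.
  have : t <= x.
    apply: ge_inf; first by exists a.
    by split=> //; rewrite ax (le_trans (ltW xt)).
  by rewrite leNgt xt.
have ft0 : f t <= 0.
  rewrite leNgt; apply/negP => ft.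
  have at1 : a < t.
    by rewrite lt_neqAle at_ andbT; apply/eqP => E; move: ft; rewrite -E ltNge fa.
  have /cvgrPdist_lt /(_ (f t) ft) := cf t.
  move=> /nbhs_ballP[d/= d0 H].
  pose x := Num.max a (t - d / 2).
  have xt : x < t by rewrite gt_max at1/= ltrBlDr ltrDl divr_gt0.
  have /npos fx : a <= x < t by rewrite le_max lexx.
  have : t - d / 2 <= x by rewrite le_max lexx orbT.
  move=> tdx.
  have /H : ball t d x.
    by rewrite /ball/= gtr0_norm ?subr_gt0//; lra.
  rewrite ltr_norml => /andP[]; lra.
have near_pos d : 0 < d -> exists2 y, t < y < t + d & 0 < f y.
  move=> d0; have [x Sx xd] := inf_adherent d0 hS.
  have tx : t <= x by apply: ge_inf => //; exists a.
  exists x; last by case: Sx.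
  rewrite xd andbT lt_neqAle tx andbT; apply/eqP => E.
  by case: Sx => _; rewrite -E ltNge ft0.
exists t; split=> //.
- rewrite at_ lt_neqAle tb andbT; apply/eqP => E; move: ft0.
  by rewrite E leNgt fb.
- apply/eqP; rewrite eq_le ft0 /= leNgt; apply/negP => ft.
  have /cvgrPdist_lt /(_ (- f t)) := cf t; rewrite oppr_gt0 => /(_ ft).
  move=> /nbhs_ballP[d/= d0 H].
  have [y /andP[ty yd] fy] := near_pos d d0.
  have /H : ball t d y.
    by rewrite /ball/= distrC gtr0_norm ?subr_gt0// ltrBlDl.
  rewrite ltr_norml => /andP[]; lra.
- move=> x /andP[ax]; rewrite le_eqVlt => /predU1P[->//|xt].
  by apply: npos; rewrite ax.
Qed.

Lemma max_itv f a b : a <= b -> continuous f ->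
  exists2 q, a <= q <= b & forall x, a <= x <= b -> f x <= f q.
Proof.
move=> ab cf; have [q qab H] := EVT_max ab (continuous_subspaceT cf).
by move: qab; rewrite in_itv/= => qab; exists q => // x xab; apply: H; rewrite in_itv.
Qed.

Lemma min_itv f a b : a <= b -> continuous f ->
  exists2 q, a <= q <= b & forall x, a <= x <= b -> f q <= f x.
Proof.
move=> ab cf; have [q qab H] := EVT_min ab (continuous_subspaceT cf).
by move: qab; rewrite in_itv/= => qab; exists q => // x xab; apply: H; rewrite in_itv.
Qed.

(** Integrating from [a] but normalising at [0] gives, for [a < 0], a primitive that is
    differentiable also at [0], hence continuous there. *)
Lemma antiderivative f a : continuous f -> exists F,
  F 0 = 0 /\ forall x : R, a < x -> is_derive x 1 F (f x).
Proof.
move=> cf.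
pose F0 x := (\int[lebesgue_measure]_(t in `[a, x]) f t)%R.
have dF x : a < x -> is_derive x 1 F0 (f x).
  move=> x1.
  have [||//|//|dF Fx] := @continuous_FTC1_closed R f a x (x + 1).
  - by rewrite ltrDl.
  - apply: continuous_compact_integrable; first exact: segment_compact.
    exact: continuous_subspaceT.
  - exact: cf.
  by apply: DeriveDef; [exact: dF|rewrite -derive1E].
exists (fun x => F0 x - F0 0); split; first by rewrite subrr.
move=> x x1; have := dF x x1 => ?.
by apply: is_derive_eq; rewrite subr0.
Qed.

Lemma lipschitz_comp_continuous (f p : R -> R) :
  (forall X : R, exists2 L, 0 < L & forall x y, 0 <= x <= X -> 0 <= y <= X ->
    `|f x - f y| <= L * `|x - y|) ->
  continuous p -> (forall x, 0 <= p x) -> continuous (fun x => f (p x)).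
Proof.
move=> Hf cp p0 x; apply/cvgrPdist_lt => e e0.
have [L L0 HL] := Hf (p x + 1).
have /cvgrPdist_lt/(_ (Num.min 1 (e / L))) := cp x.
rewrite lt_min ltr01 divr_gt0// => /(_ isT).
apply: filterS => y; rewrite lt_min => /andP[y1 yL].
have py : p y <= p x + 1 by move: y1; rewrite ltr_norml => /andP[]; lra.
apply: le_lt_trans (HL _ _ _ _) _; rewrite ?p0//=; first by rewrite lerDl.
by rewrite mulrC -ltr_pdivlMr.
Qed.

Lemma max0_continuous : continuous (fun x : R => Num.max x 0).
Proof.
move=> x; exact: (@continuous_max _ R id (fun=> 0) x (fun U h => h)
  (@cst_continuous R R 0 x)).
Qed.

Lemma powR_lipschitz (k K e : R) : 0 < k -> exists2 C, 0 < C &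
  forall x y, k <= x <= K -> k <= y <= K -> `|x `^ e - y `^ e| <= C * `|x - y|.
Proof.
move=> k0.
(* The power z^(e - 1) is monotone in z, so its largest value is at one of the two ends; the [+ 1]
   keeps the constant positive when [e = 0]. *)
pose C := `|e| * Num.max (k `^ (e - 1)) (K `^ (e - 1)) + 1.
have C0 : 0 < C.
  by rewrite ltr_wpDl// mulr_ge0// le_max powR_ge0.
exists C => //.
suff H x y : k <= x <= K -> k <= y <= K -> x <= y ->
    `|y `^ e - x `^ e| <= C * (y - x).
  move=> x y xk yk; case: (leP x y) => xy.
    by rewrite distrC (distrC x) (@ger0_norm _ (y - x)) ?subr_ge0//; exact: H.
  by rewrite (@gtr0_norm _ (x - y)) ?subr_gt0//; apply: H => //; exact: ltW.
move=> /andP[kx xK] /andP[ky yK] xy.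
have dpow z : x <= z <= y -> is_derive z 1 (@powR R ^~ e) (e * z `^ (e - 1)).
  move=> /andP[xz _]; apply: (@is_derive1_powR R e z).
  by rewrite (lt_le_trans k0)// (le_trans kx).
have dpi z : z \in `]x, y[%R -> is_derive z 1 (@powR R ^~ e) (e * z `^ (e - 1)).
  by rewrite in_itv/= => /andP[xz zy]; apply: dpow; rewrite !ltW.
have [|c cxy fE] := MVT_segment xy dpi.
  apply: derivable_within_continuous => z; rewrite in_itv/= => /dpow h.
  exact: ex_derive.
rewrite fE normrM (@ger0_norm _ (y - x)) ?subr_ge0//.
rewrite ler_wpM2r ?subr_ge0// normrM /C ler_wpDr// ler_wpM2l//.
rewrite ger0_norm ?powR_ge0//.
move: cxy; rewrite in_itv/= => /andP[xc cy].
have c0 : 0 < c by rewrite (lt_le_trans k0)// (le_trans kx).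
have [e1|e1] := leP 0 (e - 1).
  rewrite le_max; apply/orP; right; apply: ge0_ler_powR => //.
  - by rewrite nnegrE ltW.
  - by rewrite nnegrE (le_trans (ltW c0))// (le_trans cy).
  - by rewrite (le_trans cy).
rewrite le_max; apply/orP; left.
rewrite -(opprK (e - 1)) !(powRN _ (- _)) lef_pV2 ?posrE ?powR_gt0//.
apply: ge0_ler_powR => //.
- by rewrite oppr_ge0 ltW.
- by rewrite nnegrE ltW.
- by rewrite nnegrE ltW.
- by rewrite (le_trans kx).
Qed.

Lemma powR_pos_continuous (e : R) : 0 < e ->
  continuous (fun x : R => (Num.max x 0) `^ e).
Proof.
move=> e0 x; have [x0|x0|->] := ltgtP x 0.
- apply: (@cvg_trans _ (cst (0:R) y @[y --> x])).
    apply: near_eq_cvg; near=> y.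
    rewrite max_r ?powR0 ?gt_eqF//.
    by apply: ltW; near: y; exact: lt_nbhsl.
  rewrite max_r; last exact: ltW.
  rewrite powR0 ?gt_eqF//. exact: (@cst_continuous R R 0 x).
- rewrite /continuous_at max_l; last exact: ltW.
  apply: (@cvg_trans _ (y `^ e @[y --> x])).
    apply: near_eq_cvg; near=> y.
    rewrite max_l//.
    by apply: ltW; near: y; exact: lt_nbhsr.
  have h := @is_derive1_powR R e x x0.
  suff : {for x, continuous (@powR R ^~ e)} by [].
  apply: differentiable_continuous.
  by apply/derivable1_diffP; exact: ex_derive.
- rewrite /continuous_at maxxx powR0 ?gt_eqF//.
  apply/cvgrPdist_lt => eps eps0; near=> y.
  rewrite sub0r normrN ger0_norm ?powR_ge0//.
  have [y0|y0] := leP y 0; first by rewrite powR0// gt_eqF.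
  rewrite -[ltRHS]powRr1; last exact: ltW.
  rewrite -(mulVf (lt0r_neq0 e0)) powRrM.
  apply: gt0_ltr_powR => //; rewrite ?nnegrE ?powR_ge0 ?ltW//.
  rewrite -(gtr0_norm y0).
  near: y; apply/nbhs_ballP; exists (eps `^ e^-1); first exact: powR_gt0.
  by move=> z; rewrite /ball/= sub0r normrN.
Unshelve. all: by end_near. Qed.

End Calculus.

(** * Picard iteration for the singular delay equation *)

Section Aux.
Context {R : realType}.
Implicit Types (f g : R -> R) (a b x y : R).

(** Nested intervals: the radius 2M / 2^n shrinks at each step by exactly M / 2^n, which absorbs the
    increment of [a]. The limit is the supremum of the lower ends. *)
Lemma geometric_limit (a : nat -> R) (M : R) :
  (forall n, `|a n.+1 - a n| <= M / 2 ^+ n) ->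
  exists l, forall n, `|l - a n| <= 2 * M / 2 ^+ n.
Proof.
move=> H.
pose lo n := a n - 2 * M / 2 ^+ n.
pose hi n := a n + 2 * M / 2 ^+ n.
have half n : 2 * M / 2 ^+ n = M / 2 ^+ n + 2 * M / 2 ^+ n.+1.
  by rewrite exprS invfM; have : (2:R) ^+ n != 0 by []; move=> ?; field.
have loS n : lo n <= lo n.+1.
  rewrite /lo (half n); have := H n; rewrite ler_norml => /andP[]; lra.
have hiS n : hi n.+1 <= hi n.
  rewrite /hi (half n); have := H n; rewrite ler_norml => /andP[]; lra.
have M0 : 0 <= M by have := le_trans (normr_ge0 _) (H 0%N); rewrite expr0 divr1.
have lohi n : lo n <= hi n.
  have : 0 <= 2 * M / 2 ^+ n by rewrite divr_ge0 ?mulr_ge0// exprn_ge0.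
  rewrite /lo /hi; lra.
have lom : {homo lo : n m / (n <= m)%N >-> n <= m}.
  by apply: homo_leq => //; exact: le_trans.
have him : {homo hi : n m / (n <= m)%N >-> m <= n}.
  apply: (@homo_leq _ hi (fun x y => y <= x)) => //.
  by move=> x y z xy yz; exact: le_trans yz xy.
have lohi2 n m : lo n <= hi m.
  apply: (le_trans (lom _ _ (leq_maxl n m))).
  by apply: (le_trans (lohi _)); apply: him; rewrite leq_maxr.
pose S := range lo.
have hS : has_sup S.
  by split; [exists (lo 0%N), 0%N|exists (hi 0%N) => _ [n _ <-]].
exists (sup S) => n.
have l1 : lo n <= sup S by apply: ub_le_sup; [case: hS|exists n].
have l2 : sup S <= hi n by apply: ge_sup; [exists (lo 0%N), 0%N|move=> _ [m _ <-]].
rewrite ler_norml; move: l1 l2; rewrite /lo /hi => l1 l2; apply/andP; split; lra.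
Qed.

Lemma continuous_scale f c : continuous f -> continuous (fun x => c * f x).
Proof.
move=> cf x; apply: (@continuousM R R (fun=> c) f x); last exact: cf.
exact: cst_continuous.
Qed.

Lemma norm_le_linear f f' c x : 0 <= x -> continuous f -> f 0 = 0 ->
  (forall s, 0 < s < x -> is_derive s 1 f (f' s)) ->
  (forall s, 0 < s < x -> `|f' s| <= c) -> `|f x| <= c * x.
Proof.
move=> x0 cf f0 df fc.
apply: (@derive_norm_le _ f (fun s => c * s) f' (fun=> c) 0 x) => //.
- by move=> y; exact: mulrl_continuous.
- move=> y _; apply: is_derive_eq; rewrite /GRing.scale/=; ring.
- by rewrite f0 normr0 mulr0.
Qed.

Lemma continuous_expR_scale (mu : R) : continuous (fun s : R => expR (mu * s)).
Proof.
move=> y; apply: continuous_comp; first exact: mulrl_continuous.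
exact: continuous_expR.
Qed.

Lemma is_derive_expR_scale (mu s : R) :
  is_derive s 1 (fun s : R => expR (mu * s)) (mu * expR (mu * s)).
Proof.
have h : is_derive s 1 (fun s : R => mu * s) mu.
  apply: is_derive_eq; rewrite /GRing.scale/=; ring.
have h2 := @is_derive1_comp R expR (fun s => mu * s) s _ _ (is_derive_expR _) h.
by apply: is_derive_eq; rewrite mulrC.
Qed.

(** Integrating exp(mu s) gains the factor [1 / mu], which is what makes a large [mu] contract. *)
Lemma norm_le_exp f f' c mu x : 0 <= x -> 0 < mu -> 0 <= c ->
  continuous f -> f 0 = 0 ->
  (forall s, 0 < s < x -> is_derive s 1 f (f' s)) ->
  (forall s, 0 < s < x -> `|f' s| <= c * expR (mu * s)) ->
  `|f x| <= c / mu * expR (mu * x).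
Proof.
move=> x0 mu0 c0 cf f0 df fc.
apply: (@derive_norm_le _ f (fun s => c / mu * expR (mu * s)) f'
  (fun s => c * expR (mu * s)) 0 x) => //.
- by apply: continuous_scale; exact: continuous_expR_scale.
- move=> y _; have := is_derive_expR_scale mu y => h.
  apply: is_derive_eq; rewrite /GRing.scale/=.
  by field; exact: lt0r_neq0.
- by rewrite f0 normr0 mulr_ge0 ?expR_ge0// divr_ge0// ltW.
Qed.

(** (1 + mu s) exp(mu s) is the derivative of s exp(mu s), the weight of the contraction; the factor
    s records that pressures agree to first order at the front. *)
Lemma norm_le_linear_exp f f' c mu x : 0 <= x -> 0 < mu -> 0 <= c ->
  continuous f -> f 0 = 0 ->
  (forall s, 0 < s < x -> is_derive s 1 f (f' s)) ->
  (forall s, 0 < s < x -> `|f' s| <= c * (1 + mu * s) * expR (mu * s)) ->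
  `|f x| <= c * (x * expR (mu * x)).
Proof.
move=> x0 mu0 c0 cf f0 df fc.
apply: (@derive_norm_le _ f (fun s => c * (s * expR (mu * s))) f'
  (fun s => c * (1 + mu * s) * expR (mu * s)) 0 x) => //.
- apply: continuous_scale => y.
  apply: (@continuousM R R id (fun s => expR (mu * s)) y) => //.
  exact: continuous_expR_scale.
- move=> y _; have := is_derive_expR_scale mu y => h.
  apply: is_derive_eq; rewrite /GRing.scale/=; ring.
- by rewrite f0 normr0 mul0r mulr0.
Qed.

Lemma clamp_lipschitz (p q a b : R) :
  `|Num.min (Num.max a p) q - Num.min (Num.max b p) q| <= `|a - b|.
Proof.
have := ler_norm (a - b); have := ler_norm (b - a); rewrite (distrC b).
have [A|A] := ltP (Num.max a p) q; have [B|B] := ltP (Num.max b p) q;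
  move: A B; have [h1|h1] := ltP a p; have [h2|h2] := ltP b p;
  by rewrite ler_norml => *; apply/andP; split; lra.
Qed.

End Aux.

(** * The clamped equation and its contraction estimate *)

Section Step.
Context {R : realType}.
Variables (lam r : R) (d b : R -> R).
Hypotheses (lam0 : 0 < lam) (r0 : 0 <= r) (d0 : d 0 = 0) (b0 : b 0 = 0).
Hypothesis lip : forall X : R, exists2 L, 0 < L & forall x y, 0 <= x <= X ->
  0 <= y <= X -> `|d x - d y| <= L * `|x - y| /\ `|b x - b y| <= L * `|x - y|.
Implicit Types (k K g T : R) (u v W : R -> R).

(* Between [k x] and [K x] the quotient [W / psi] is Lipschitz in the pressure
   up to [x = 0]; a priori bounds remove the clamp in [sol_extend]. *)
Definition clamp k K u x : R :=
  Num.min (Num.max (u x) (k * Num.max x 0)) (K * Num.max x 0).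

Definition dens k K u x : R := clamp k K u x `^ lam.

(** One Picard step from the pressure [u] to [v]; a fixed point is a step with [u = v]. The zero
    values on the left half-line are the history seen by the delay. Derivatives are two-sided even
    at [T], so the functions continue past it. *)
Record step k K g T u v W : Prop := Step {
  step_cu : continuous u;
  step_cv : continuous v;
  step_cW : continuous W;
  step_v0 : forall x, x <= 0 -> v x = 0;
  step_W0 : forall x, x <= 0 -> W x = 0;
  step_dv : forall x, 0 < x <= T ->
    is_derive x 1 v (g * (1 + W x / dens k K u x));
  step_dW : forall x, 0 < x <= T ->
    is_derive x 1 W (d (dens k K u x) - b (dens k K u (x - r))) }.

Section Bounds.
Variables (k K : R).
Hypotheses (k0 : 0 < k) (kK : k <= K).
Let K0 : 0 < K. Proof. exact: lt_le_trans kK. Qed.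

Lemma clamp_le0 u x : x <= 0 -> clamp k K u x = 0.
Proof.
by move=> x0; rewrite /clamp (max_r x0) !mulr0 min_r// le_max lexx orbT.
Qed.

Lemma clamp_ge u x : k * Num.max x 0 <= clamp k K u x.
Proof.
rewrite /clamp le_min ler_wpM2r ?andbT//; first by rewrite le_max lexx orbT.
by rewrite le_max lexx orbT.
Qed.

Lemma clamp_le u x : clamp k K u x <= K * Num.max x 0.
Proof. by rewrite ge_min lexx orbT. Qed.

Lemma clamp_ge0 u x : 0 <= clamp k K u x.
Proof.
by apply: le_trans (clamp_ge u x); rewrite mulr_ge0 ?le_max ?lexx ?orbT// ltW.
Qed.

Lemma clamp_gt0 u x : 0 < x -> 0 < clamp k K u x.
Proof.
move=> x0; apply: lt_le_trans (clamp_ge u x).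
by rewrite mulr_gt0// lt_max x0.
Qed.

Lemma clamp_itv u x : 0 < x -> k <= clamp k K u x / x <= K.
Proof.
move=> x0; rewrite ler_pdivlMr// ler_pdivrMr//.
by have := clamp_ge u x; have := clamp_le u x; rewrite max_l ?(ltW x0)// => -> ->.
Qed.

Lemma clamp_continuous u : continuous u -> continuous (clamp k K u).
Proof.
have cm := @max0_continuous R.
have ck c : continuous (fun x : R => c * Num.max x 0).
  exact: continuous_scale cm.
move=> cu x; exact: (continuous_min (continuous_max (cu x) (ck k x)) (ck K x)).
Qed.

Lemma dens_continuous u : continuous u -> continuous (dens k K u).
Proof.
move=> cu x.
have -> : dens k K u = (fun y => (Num.max y 0) `^ lam) \o clamp k K u.
  by apply/funext => y /=; rewrite /dens max_l// clamp_ge0.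
apply: continuous_comp; first exact: clamp_continuous.
exact: powR_pos_continuous.
Qed.

Lemma dens_le0 u x : x <= 0 -> dens k K u x = 0.
Proof. by move=> x0; rewrite /dens clamp_le0// powR0// gt_eqF. Qed.

Lemma dens_ge0 u x : 0 <= dens k K u x. Proof. exact: powR_ge0. Qed.

Lemma dens_gt0 u x : 0 < x -> 0 < dens k K u x.
Proof. by move=> x0; rewrite powR_gt0// clamp_gt0. Qed.

Lemma dens_le u x y : x <= y -> 0 <= y -> dens k K u x <= K `^ lam * y `^ lam.
Proof.
move=> xy y0; rewrite -powRM//; last exact: ltW.
apply: ge0_ler_powR; [exact: ltW|exact: clamp_ge0| |].
  by rewrite nnegrE mulr_ge0// ltW.
apply: (le_trans (clamp_le _ _)); rewrite ler_wpM2l//; first exact: ltW.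
by rewrite ge_max xy.
Qed.

Lemma dens_ge u x : 0 < x -> k `^ lam * x `^ lam <= dens k K u x.
Proof.
move=> x0; rewrite -powRM; [|exact: ltW..].
apply: ge0_ler_powR; [exact: ltW| |exact: clamp_ge0|].
  by rewrite nnegrE mulr_ge0// ltW.
by apply: le_trans (clamp_ge _ _); rewrite max_l// ltW.
Qed.

(** Isolates the singular factor: the quotient [clamp k K u x / x] stays in [[k, K]], where every
    power, negative ones included, is Lipschitz. *)
Lemma dens_powN u x : 0 < x ->
  (dens k K u x)^-1 = (clamp k K u x / x) `^ (- lam) / x `^ lam.
Proof.
move=> x0; rewrite powRN -invfM; congr (_^-1).
rewrite -powRM ?divr_ge0 ?clamp_ge0 ?(ltW x0)//.
by rewrite divfK ?gt_eqF.
Qed.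

(** As [d] and [b] vanish at [0] and are Lipschitz, the rate of [W] is O(x^lam). So [W] is one order
    smaller than the density, which is at least k^lam x^lam; this tames the singular quotient. *)
Lemma step_W_bound T : 0 <= T -> exists2 C, 0 < C &
  forall g u v W, step k K g T u v W ->
  forall x, 0 <= x <= T -> `|W x| <= C * x * x `^ lam.
Proof.
move=> T0; have [L L0 HL] := lip (K `^ lam * T `^ lam).
exists (2 * L * K `^ lam); first by rewrite !mulr_gt0// powR_gt0.
move=> g u v W S x /andP[x0 xT].
rewrite mulrAC; apply: (norm_le_linear x0 (step_cW S)).
- by rewrite (step_W0 S).
- move=> s /andP[s0 sx]; apply: (step_dW S).
  by rewrite s0 (le_trans (ltW sx)).
- move=> s /andP[s0 sx].
  have sT : s <= T by rewrite (le_trans (ltW sx)).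
  have inX y : y <= s -> 0 <= dens k K u y <= K `^ lam * T `^ lam.
    by move=> ys; rewrite dens_ge0 dens_le// (le_trans ys).
  have in0 : 0 <= (0:R) <= K `^ lam * T `^ lam.
    by rewrite lexx mulr_ge0 ?powR_ge0.
  have dx y : y <= s -> dens k K u y <= K `^ lam * x `^ lam.
    by move=> ys; apply: dens_le => //; exact: le_trans ys (ltW sx).
  have sr : s - r <= s by rewrite gerBl.
  have [h1 _] := HL _ _ (inX s (lexx _)) in0.
  have [_ h2] := HL _ _ (inX _ sr) in0.
  rewrite d0 b0 !subr0 in h1 h2.
  apply: (le_trans (ler_normB _ _)).
  rewrite [leRHS](_ : _ = L * (K `^ lam * x `^ lam) + L * (K `^ lam * x `^ lam)); last by ring.
  apply: lerD.
    by apply: (le_trans h1); rewrite ler_pM2l// ger0_norm ?dens_ge0// dx.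
  by apply: (le_trans h2); rewrite ler_pM2l// ger0_norm ?dens_ge0// dx.
Qed.

Lemma step_quot_bound T : 0 <= T -> exists2 C, 0 < C &
  forall g u v W, step k K g T u v W ->
  forall x, 0 < x <= T -> `|W x / dens k K u x| <= C * x.
Proof.
move=> T0; have [C C0 HC] := step_W_bound T0.
exists (C / k `^ lam); first by rewrite divr_gt0// powR_gt0.
move=> g u v W S x /andP[x0 xT].
rewrite normrM normfV (ger0_norm (dens_ge0 _ _)) ler_pdivrMr ?dens_gt0//.
have := HC _ _ _ _ S x; rewrite (ltW x0) xT => /(_ isT) h.
apply: (le_trans h).
have kl : 0 < k `^ lam by exact: powR_gt0.
rewrite [leLHS](_ : _ = C / k `^ lam * x * (k `^ lam * x `^ lam)); last first.
  by field; exact: lt0r_neq0.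
by rewrite ler_wpM2l ?dens_ge//; nonneg.
Qed.

(* The gain [1/2] comes from taking the exponential weight [mu] large. *)
Lemma step_diff T G : 0 < T -> 0 < G -> exists mu C, [/\ 0 < mu, 0 < C &
  forall g1 g2 u1 u2 v1 v2 W1 W2 N,
  0 <= g1 <= G -> 0 <= g2 ->
  step k K g1 T u1 v1 W1 -> step k K g2 T u2 v2 W2 -> 0 <= N ->
  (forall x, 0 < x <= T -> `|u1 x - u2 x| <= N * (x * expR (mu * x))) ->
  forall x, 0 <= x <= T ->
   `|v1 x - v2 x| <= (N / 2 + C * `|g1 - g2|) * (x * expR (mu * x)) /\
   `|W1 x - W2 x| <= C * N].
Proof.
move=> T0 G0.
have [L L0 HL] := lip (K `^ lam * T `^ lam).
have [Cp Cp0 HCp] := @powR_lipschitz R k K lam k0.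
have [Cm Cm0 HCm] := @powR_lipschitz R k K (- lam) k0.
have [CW CW0 HCW] := step_W_bound (ltW T0).
have [Cq Cq0 HCq] := step_quot_bound (ltW T0).
have kl : 0 < k `^ lam by exact: powR_gt0.
pose A := 2 * L * Cp.
pose B := CW * Cm.
have A0 : 0 < A by rewrite !mulr_gt0.
have B0 : 0 < B by rewrite !mulr_gt0.
(* Chosen so that G (A / k^lam) / mu <= 1/2 and G B <= mu / 2: the two terms of the quotient
   estimate then fit under half of the two terms of 1 + mu s. *)
pose mu := 1 + 2 * G * (A / k `^ lam + B).
have AB0 : 0 < A / k `^ lam + B by rewrite addr_gt0// divr_gt0.
have mu1 : 1 <= mu by rewrite lerDl; nonneg.
have mu0 : 0 < mu by rewrite (lt_le_trans ltr01).
pose C := 1 + Cq * T + A * T `^ lam * expR (mu * T).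
have C0 : 0 < C.
  by posit.
exists mu, C; split=> //.
move=> g1 g2 u1 u2 v1 v2 W1 W2 N /andP[g10 g1G] g20 S1 S2 N0 Hu.
have eM s t : s <= t -> expR (mu * s) <= expR (mu * t).
  by move=> st; rewrite ler_expR ler_pM2l.
have Hy s : 0 < s <= T ->
    `|clamp k K u1 s / s - clamp k K u2 s / s| <= N * expR (mu * s).
  move=> /andP[s0 sT]; rewrite -mulrBl normrM normfV (gtr0_norm s0).
  rewrite ler_pdivrMr// (le_trans (clamp_lipschitz _ _ _ _))//.
  by rewrite -mulrA (mulrC (expR _)); apply: Hu; rewrite s0.
have Hdens s : 0 < s <= T -> `|dens k K u1 s - dens k K u2 s| <=
    Cp * N * s `^ lam * expR (mu * s).
  move=> sT; have /andP[s0 _] := sT.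
  have E u : dens k K u s = (clamp k K u s / s) `^ lam * s `^ lam.
    rewrite -powRM ?divr_ge0 ?clamp_ge0 ?(ltW s0)//.
    by rewrite divfK ?gt_eqF.
  rewrite !E -mulrBl normrM (ger0_norm (powR_ge0 _ _)).
  rewrite [leRHS]mulrAC ler_wpM2r ?powR_ge0//.
  apply: (le_trans (HCp _ _ (clamp_itv u1 s0) (clamp_itv u2 s0))).
  by rewrite -mulrA ler_pM2l// Hy.
have HW x : 0 <= x <= T -> `|W1 x - W2 x| <= A * N * x `^ lam / mu * expR (mu * x).
  move=> /andP[x0 xT].
  apply: (@norm_le_exp R (fun x => W1 x - W2 x)
    (fun x => (d (dens k K u1 x) - b (dens k K u1 (x - r)))
            - (d (dens k K u2 x) - b (dens k K u2 (x - r))))) => //.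
  - by nonneg.
  - by move=> y; apply: continuousB; [exact: (step_cW S1)|exact: (step_cW S2)].
  - by rewrite (step_W0 S1)// (step_W0 S2)// subrr.
  - move=> s /andP[s0 sx]; have sT : 0 < s <= T by rewrite s0 (le_trans (ltW sx)).
    have := step_dW S1 sT; have := step_dW S2 sT => ? ?; exact: is_deriveB.
  - move=> s /andP[s0 sx]; have sT : 0 < s <= T by rewrite s0 (le_trans (ltW sx)).
    have inX u y : y <= s -> 0 <= dens k K u y <= K `^ lam * T `^ lam.
      move=> ys; rewrite dens_ge0 dens_le//; last exact: ltW.
      by rewrite (le_trans ys)//; case/andP: sT.
    have sr : s - r <= s by rewrite gerBl.
    have [h1 _] := HL _ _ (inX u1 s (lexx _)) (inX u2 s (lexx _)).
    have [_ h2] := HL _ _ (inX u1 _ sr) (inX u2 _ sr).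
    have bnd y : y <= s -> `|dens k K u1 y - dens k K u2 y| <=
        Cp * N * x `^ lam * expR (mu * s).
      move=> ys; case: (leP y 0) => y0.
        by rewrite !dens_le0// subrr normr0; nonneg.
      apply: (le_trans (Hdens y _)).
        by rewrite y0 (le_trans ys)//; case/andP: sT.
      apply: ler_pM; [by nonneg..| |exact: eM].
      rewrite ler_wpM2l//; first by nonneg.
      apply: ge0_ler_powR; rewrite ?nnegrE//; [exact: ltW..|].
      exact: le_trans ys (ltW sx).
    rewrite [X in `|X|](_ : _ = (d (dens k K u1 s) - d (dens k K u2 s))
      - (b (dens k K u1 (s - r)) - b (dens k K u2 (s - r)))); last by ring.
    apply: (le_trans (ler_normB _ _)).
    rewrite [leRHS](_ : _ = L * (Cp * N * x `^ lam * expR (mu * s))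
      + L * (Cp * N * x `^ lam * expR (mu * s))); last by rewrite /A; ring.
    apply: lerD.
      by apply: (le_trans h1); rewrite ler_pM2l// bnd.
    by apply: (le_trans h2); rewrite ler_pM2l// bnd.
move=> x /andP[x0 xT]; split; last first.
  apply: (le_trans (HW x _)); first by rewrite x0.
  rewrite [leRHS](_ : _ = (1 + Cq * T) * N + A * N * T `^ lam * expR (mu * T)); last first.
    by rewrite /C; ring.
  rewrite ler_wpDl//; first by nonneg.
  apply: ler_pM; [by nonneg..| |exact: eM].
  rewrite -[leRHS]mulr1; apply: ler_pM.
  - by nonneg.
  - by nonneg.
  - rewrite ler_wpM2l//; first by nonneg.
    apply: ge0_ler_powR; rewrite ?nnegrE//; exact: ltW.
  - by rewrite invf_le1.
apply: (@norm_le_linear_exp R (fun x => v1 x - v2 x)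
    (fun x => g1 * (1 + W1 x / dens k K u1 x)
            - g2 * (1 + W2 x / dens k K u2 x))) => //.
- by nonneg.
- by move=> y; apply: continuousB; [exact: (step_cv S1)|exact: (step_cv S2)].
- by rewrite (step_v0 S1)// (step_v0 S2)// subrr.
- move=> s /andP[s0 sx]; have sT : 0 < s <= T by rewrite s0 (le_trans (ltW sx)).
  have := step_dv S1 sT; have := step_dv S2 sT => ? ?; exact: is_deriveB.
move=> s /andP[s0 sx]; have sT : 0 < s <= T by rewrite s0 (le_trans (ltW sx)).
have sT' : s <= T by case/andP: sT.
have sl : 0 < s `^ lam by exact: powR_gt0.
(* The difference of the [W] has gained [1 / mu] by integration; the difference of the inverse
   densities has not, but its factor [W2] is O(s^(lam + 1)) and leaves a factor s. *)
have Hq : `|W1 s / dens k K u1 s - W2 s / dens k K u2 s| <=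
    N * (A / k `^ lam / mu + B * s) * expR (mu * s).
  rewrite [X in `|X|](_ : _ = (W1 s - W2 s) / dens k K u1 s +
     W2 s * ((dens k K u1 s)^-1 - (dens k K u2 s)^-1)); last by ring.
  apply: (le_trans (ler_normD _ _)).
  rewrite [leRHS](_ : _ = N * (A / k `^ lam / mu) * expR (mu * s) +
     N * (B * s) * expR (mu * s)); last by ring.
  apply: lerD.
    rewrite normrM normfV (ger0_norm (dens_ge0 _ _)) ler_pdivrMr ?dens_gt0//.
    apply: (le_trans (HW s _)); first by rewrite (ltW s0).
    rewrite [leLHS](_ : _ = N * (A / k `^ lam / mu) * expR (mu * s) * (k `^ lam * s `^ lam)); last first.
      by field; rewrite !lt0r_neq0.
    rewrite ler_wpM2l ?dens_ge//.
    by nonneg.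
  rewrite !dens_powN// -mulrBl !normrM normfV (gtr0_norm sl).
  have h1 := HCW _ _ _ _ S2 s; rewrite (ltW s0) sT' in h1.
  have h2 := HCm _ _ (clamp_itv u1 s0) (clamp_itv u2 s0).
  apply: (@le_trans _ _ (CW * s * s `^ lam * (Cm * (N * expR (mu * s)) / s `^ lam))).
    apply: ler_pM => //.
    - by rewrite mulr_ge0// invr_ge0 ltW.
    - by apply: h1.
    - rewrite ler_pM2r ?invr_gt0//; apply: (le_trans h2).
      by rewrite ler_pM2l// Hy.
  rewrite le_eqVlt; apply/orP; left; apply/eqP.
  by rewrite /B; field; exact: lt0r_neq0.
have Hq2 : `|1 + W2 s / dens k K u2 s| <= C.
  apply: (le_trans (ler_normD _ _)); rewrite normr1.
  have := HCq _ _ _ _ S2 s sT => h.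
  have : Cq * s <= Cq * T by rewrite ler_pM2l.
  have : 0 < A * T `^ lam * expR (mu * T) by posit.
  rewrite /C; lra.
rewrite [X in `|X|](_ : _ = g1 * (W1 s / dens k K u1 s - W2 s / dens k K u2 s) +
  (g1 - g2) * (1 + W2 s / dens k K u2 s)); last by ring.
apply: (le_trans (ler_normD _ _)); rewrite !normrM.
rewrite mulrDl mulrDl; apply: lerD.
  rewrite (ger0_norm g10).
  apply: (@le_trans _ _ (G * (N * (A / k `^ lam / mu + B * s) * expR (mu * s)))).
    by apply: ler_pM.
  rewrite [leLHS](_ : _ = N * expR (mu * s) * (G * (A / k `^ lam) / mu + G * B * s)); last by ring.
  rewrite [leRHS](_ : _ = N * expR (mu * s) * (1 / 2 + mu / 2 * s)); last by ring.
  rewrite ler_wpM2l//; first by nonneg.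
  have muE : mu = 1 + 2 * (G * (A / k `^ lam)) + 2 * (G * B) by rewrite /mu; ring.
  have GA : 0 <= G * (A / k `^ lam) by nonneg.
  have GB : 0 <= G * B by nonneg.
  apply: lerD; first by rewrite ler_pdivrMr//; lra.
  by rewrite ler_wpM2r//; [exact: ltW|lra].
rewrite [leRHS](_ : _ = `|g1 - g2| * (C * ((1 + mu * s) * expR (mu * s)))); last by ring.
rewrite ler_wpM2l// (le_trans Hq2)// ler_peMr//; first exact: ltW.
have e1 : 1 <= expR (mu * s) by rewrite ltW// expR_gt1 mulr_gt0.
have s1 : 1 <= 1 + mu * s by rewrite lerDl mulr_ge0// ltW.
have := ler_pM ler01 ler01 s1 e1; by rewrite mulr1.
Qed.

Lemma step_exists T g u : continuous u -> exists v W, step k K g T u v W.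
Proof.
move=> cu.
have lipd X : exists2 L, 0 < L & forall x y, 0 <= x <= X ->
      0 <= y <= X -> `|d x - d y| <= L * `|x - y|.
  by have [L L0 HL] := lip X; exists L => // x y hx hy; case: (HL x y hx hy).
have lipb X : exists2 L, 0 < L & forall x y, 0 <= x <= X ->
      0 <= y <= X -> `|b x - b y| <= L * `|x - y|.
  by have [L L0 HL] := lip X; exists L => // x y hx hy; case: (HL x y hx hy).
have cP := dens_continuous cu.
have csub : continuous (fun x : R => x - r).
  by move=> x; apply: (@continuousB R R R id (fun=> r)) => //; exact: cst_continuous.
have cPr : continuous (fun x => dens k K u (x - r)).
  by move=> x; apply: (@continuous_comp _ _ _ (fun x => x - r)); [exact: csub|exact: cP].
have cw : continuous (fun x => d (dens k K u x) - b (dens k K u (x - r))).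
  move=> x; apply: continuousB.
    by apply: (lipschitz_comp_continuous lipd cP) => y; exact: dens_ge0.
  by apply: (lipschitz_comp_continuous lipb cPr) => y; exact: dens_ge0.
have cmax := @max0_continuous R.
(* Precomposing a primitive with the positive part freezes it at zero on the left half-line and
   keeps its derivative on the right one. *)
have patch (F f : R -> R) : F 0 = 0 -> (forall x : R, -1 < x -> is_derive x 1 F (f x)) ->
    [/\ continuous (fun x : R => F (Num.max x 0)),
     forall x : R, x <= 0 -> F (Num.max x 0) = 0 &
     forall x : R, 0 < x -> is_derive x 1 (fun x : R => F (Num.max x 0)) (f x)].
  move=> F0 dF; split.
  - move=> x; apply: (@continuous_comp _ _ _ (fun x : R => Num.max x 0)); first exact: cmax.
    apply: differentiable_continuous; apply/derivable1_diffP.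
    have h : -1 < Num.max x 0 by rewrite lt_max ltrN10 orbT.
    by have := dF _ h => ?; exact: ex_derive.
  - by move=> x x0; rewrite max_r.
  - move=> x x0; apply: (@near_eq_is_derive _ _ _ F).
      near=> y; rewrite max_l//; apply: ltW; near: y; exact: lt_nbhsr.
    by apply: dF; rewrite (lt_trans _ x0)// ltrN10.
have [F [F0 dF]] := antiderivative (-1) cw.
have {F0 dF} [cW W0 dW] := patch _ _ F0 dF.
pose W (x : R) := F (Num.max x 0).
have {}W0 (x : R) : x <= 0 -> W x = 0 := W0 x.
have Wb : exists2 C, 0 < C & forall x, 0 < x <= 1 -> `|W x / dens k K u x| <= C * x.
  have [C C0 HC] := @step_quot_bound 1 ler01.
  exists C => // x x1.
  (* Only [u] and [W] enter the quotient bound, so a step with [g = 0] and zero pressure gives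
     access to it before [v] is built. *)
  pose G0 := (fun=> 0 : R) : R -> R.
  have S : step k K 0 1 u G0 W.
    split=> //.
    - exact: cst_continuous.
    - by move=> y _; apply: is_derive_eq; rewrite mul0r.
    - by move=> y /andP[y0 _]; exact: dW.
  exact: HC S x x1.
have [C C0 HC] := Wb.
pose q x := W x / dens k K u x.
have cq : continuous q.
  move=> x; have [x0|x0] := ltP 0 x.
    apply: continuousM; first exact: cW.
    apply: continuousV; last exact: cP.
    by rewrite gt_eqF// dens_gt0.
  rewrite /continuous_at {2}/q W0// mul0r.
  apply/cvgrPdist_lt => e e0.
  apply/nbhs_ballP; exists (Num.min 1 (e / C)) => /=.
    by rewrite lt_min ltr01 divr_gt0.
  move=> y; rewrite /ball/= lt_min => /andP[y1 yC].
  rewrite sub0r normrN; have [y0|y0] := leP y 0.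
    by rewrite /q W0// mul0r normr0.
  have yx : y <= `|x - y|.
    by rewrite distrC (le_trans _ (ler_norm _))// lerBrDl gerDr.
  apply: le_lt_trans (HC _ _) _.
    by rewrite y0 (le_trans yx)// ltW.
  by rewrite mulrC -ltr_pdivlMr// (le_lt_trans yx).
have cq1 : continuous (fun x => g * (1 + q x)).
  apply: continuous_scale => x.
  exact: (@continuousD R R R (fun=> 1) q x (@cst_continuous R R 1 x) (cq x)).
have [E [E0 dE]] := antiderivative (-1) cq1.
have [cv v0 dv] := patch _ _ E0 dE.
exists (fun x => E (Num.max x 0)), W; split=> //.
- by move=> x /andP[x0 _]; exact: dv.
- by move=> x /andP[x0 _]; exact: dW.
Unshelve. all: by end_near. Qed.

Lemma step_fixpoint T g : 0 < T -> 0 < g -> exists v W, step k K g T v v W.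
Proof.
move=> T0 g0.
have [S HS] : exists S : (R -> R) -> (R -> R) * (R -> R),
    forall u, continuous u -> step k K g T u (S u).1 (S u).2.
  have /choice[S HS] : forall u : R -> R, exists vW : (R -> R) * (R -> R),
      continuous u -> step k K g T u vW.1 vW.2.
    move=> u; have [cu|ncu] := pselect (continuous u); last by exists (u, u).
    by have [v [W H]] := step_exists T g cu; exists (v, W).
  by exists S.
have [mu [C [mu0 C0 Hd]]] := step_diff T0 g0.
have [Cq Cq0 HCq] := step_quot_bound (ltW T0).
pose v n := iter n (fun u => (S u).1) (fun=> 0 : R).
have cv n : continuous (v n).
  by case: n => [|n]; [exact: cst_continuous|elim: n => [|n IH];
    apply: (step_cv (HS _ _)) => //; exact: cst_continuous].
have Sv n : step k K g T (v n) (v n.+1) (S (v n)).2 := HS _ (cv n).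
pose M := g * (1 + Cq * T).
have M0 : 0 < M by posit.
have vder n s : 0 < s <= T -> `|g * (1 + (S (v n)).2 s / dens k K (v n) s)| <= M.
  move=> sT; rewrite normrM (gtr0_norm g0) ler_pM2l//.
  apply: (le_trans (ler_normD _ _)); rewrite normr1 lerD2l.
  apply: (le_trans (HCq _ _ _ _ (Sv n) s sT)).
  by rewrite ler_pM2l//; case/andP: sT.
have e1 x : 0 <= x -> 1 <= expR (mu * x).
  by rewrite le_eqVlt => /predU1P[<-|x0]; [rewrite mulr0 expR0|rewrite ltW// expR_gt1 mulr_gt0].
have gg : 0 <= g <= g by rewrite lexx ltW.
have g00 : 0 <= g by exact: ltW.
have incr n x : 0 <= x <= T -> `|v n.+1 x - v n x| <= M / 2 ^+ n * (x * expR (mu * x)).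
  elim: n x => [|n IH] x /andP[x0 xT].
    rewrite expr0 divr1 subr0; apply: (@le_trans _ _ (M * x)).
      apply: (norm_le_linear x0 (cv 1%N)).
      - by apply: (step_v0 (Sv 0%N)).
      - by move=> s /andP[s0 sx]; apply: (step_dv (Sv 0%N)); rewrite s0 (le_trans (ltW sx)).
      - by move=> s /andP[s0 sx]; apply: vder; rewrite s0 (le_trans (ltW sx)).
    by rewrite ler_pM2l// ler_peMr// e1.
  have [||//|+ _] := Hd g g (v n.+1) (v n) _ _ _ _ (M / 2 ^+ n) gg g00 (Sv n.+1) (Sv n) _ _ x.
  - by nonneg.
  - by move=> y /andP[y0 yT]; apply: IH; rewrite (ltW y0).
  - by rewrite x0.
  by rewrite subrr normr0 mulr0 addr0 exprSr invfM [M * (_ * _)]mulrA.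
(* The iterates converge only on [[0, T]]; projecting the argument onto this interval defines the
   limit everywhere. *)
pose cl x := Num.min (Num.max x 0) T.
have clT x : 0 <= cl x <= T.
  by rewrite ge_min lexx orbT andbT le_min (ltW T0) andbT le_max lexx orbT.
have clE x : 0 <= x <= T -> cl x = x.
  by move=> /andP[x0 xT]; rewrite /cl max_l// min_l.
have /choice[l Hl] x : exists l, forall n,
    `|l - v n (cl x)| <= 2 * (M * (cl x * expR (mu * cl x))) / 2 ^+ n.
  apply: geometric_limit => n; rewrite mulrAC; exact: incr.
have lipv n x y : 0 <= x -> x <= y -> y <= T -> `|v n.+1 y - v n.+1 x| <= M * (y - x).
  move=> x0 xy yT.
  have cB : continuous (fun s => v n.+1 s - v n.+1 x).
    by move=> s; apply: (@continuousB _ _ _ _ (fun=> _)); [exact: cv|exact: cst_continuous].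
  apply: (@derive_norm_le R (fun s => v n.+1 s - v n.+1 x) (fun s => M * (s - x))
    (fun s => g * (1 + (S (v n)).2 s / dens k K (v n) s)) (fun=> M) x y xy cB).
  - apply: continuous_scale => s.
    exact: (@continuousB R R R id (fun=> x) s (fun U h => h) (@cst_continuous R R _ s)).
  - move=> s /andP[xs sy].
    have sT : 0 < s <= T by rewrite (le_lt_trans x0)//= (le_trans (ltW sy)).
    have := step_dv (Sv n) sT => h; apply: is_derive_eq; exact: subr0.
  - move=> s _; apply: is_derive_eq; rewrite /GRing.scale/=; ring.
  - by move=> s /andP[xs sy]; apply: vder; rewrite (le_lt_trans x0)//= (le_trans (ltW sy)).
  - by rewrite !subrr normr0 mulr0.
have clip x y : `|cl x - cl y| <= `|x - y| by exact: clamp_lipschitz.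
have lipv2 n x y : `|v n.+1 (cl x) - v n.+1 (cl y)| <= M * `|x - y|.
  have /andP[x0 xT] := clT x; have /andP[y0 yT] := clT y.
  apply: (@le_trans _ _ (M * `|cl x - cl y|)); last by rewrite ler_pM2l.
  have [xy|/ltW xy] := leP (cl x) (cl y).
    by rewrite distrC (distrC (cl x)) [X in M * X]ger0_norm ?subr_ge0//; exact: lipv.
  by rewrite [X in M * X]ger0_norm ?subr_ge0//; exact: lipv.
have small (B e : R) : 0 < e -> exists n, B / 2 ^+ n <= e.
  move=> e0; exists (Num.bound (B / e)).
  rewrite ler_pdivrMr ?exprn_gt0// mulrC -ler_pdivrMr//.
  exact/ltW/upper_nthrootP.
(* [S] is specified on continuous inputs only. The Lipschitz bound common to all iterates passes to
   the limit and makes [l] an admissible input. *)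
have lipl x y : `|l x - l y| <= M * `|x - y|.
  apply/ler_addgt0Pr => e e0.
  pose B z := 2 * (M * (cl z * expR (mu * cl z))).
  have [n Hn] := small (B x + B y) e e0.
  have B0 z : 0 <= B z by have /andP[? _] := clT z; rewrite /B; nonneg.
  have h1 := Hl x n.+1; have h2 := Hl y n.+1; have h3 := lipv2 n x y.
  rewrite -!/(B _) in h1 h2.
  have h4 : (B x + B y) / 2 ^+ n.+1 <= (B x + B y) / 2 ^+ n.
    rewrite ler_wpM2l ?addr_ge0// lef_pV2 ?posrE ?exprn_gt0//.
    by rewrite exprS ler_peMl ?exprn_ge0 ?ler1n.
  rewrite (_ : l x - l y = (l x - v n.+1 (cl x)) + (v n.+1 (cl x) - v n.+1 (cl y))
    - (l y - v n.+1 (cl y))); last by ring.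
  apply: (le_trans (ler_normB _ _)).
  have := ler_normD (l x - v n.+1 (cl x)) (v n.+1 (cl x) - v n.+1 (cl y)).
  rewrite mulrDl in h4; lra.
have cl_ : continuous l.
  move=> x; apply/cvgrPdist_lt => e e0.
  apply/nbhs_ballP; exists (e / M) => /=; first exact: divr_gt0.
  move=> y; rewrite /ball/= ltr_pdivlMr// mulrC => h.
  exact: le_lt_trans (lipl x y) h.
have Sl := HS l cl_.
have fix_ x : 0 <= x <= T -> (S l).1 x = l x.
  move=> xT; have /andP[x0 x1] := xT.
  apply/eqP; rewrite -subr_eq0 -normr_le0; apply/ler_addgt0Pr => e e0.
  rewrite add0r.
  have [n Hn] := small (2 * M * (x * expR (mu * x))) e e0.
  apply: le_trans Hn.
  have [||//|h1 _] := Hd g g l (v n) _ _ _ _ (2 * M / 2 ^+ n) gg g00 Sl (Sv n) _ _ x.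
  - by nonneg.
  - move=> y /andP[y0 yT]; have := Hl y n; rewrite clE ?(ltW y0)// => h.
    apply: (le_trans h); rewrite le_eqVlt; apply/orP; left; apply/eqP; ring.
  have := Hl x n.+1; rewrite clE// => h2.
  rewrite subrr normr0 mulr0 addr0 in h1.
  rewrite (_ : (S l).1 x - l x = ((S l).1 x - v n.+1 x) - (l x - v n.+1 x)); last by ring.
  apply: (le_trans (ler_normB _ _)).
  apply: (le_trans (lerD h1 h2)).
  rewrite le_eqVlt; apply/orP; left; apply/eqP.
  have : (2:R) ^+ n != 0 by []; rewrite exprS => ?; field; by [].
have densE x : x <= T -> dens k K (S l).1 x = dens k K l x.
  move=> xT; have [x0|x0] := leP x 0; first by rewrite !dens_le0.
  by rewrite /dens /clamp fix_// (ltW x0).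
(* The solution is [(S l).1] and not [l]: the latter is constant beyond [T], so it may lack a
   two-sided derivative there. Both give the same densities up to [T]. *)
exists (S l).1, (S l).2; case: Sl => *; split=> //.
- by move=> x xT; have /andP[_ ?] := xT; rewrite densE//; auto.
- move=> x xT; have /andP[_ x1] := xT; rewrite !densE//; first by auto.
  by rewrite (le_trans _ x1)// gerBl.
Qed.

End Bounds.
End Step.

(** * Solutions: uniqueness, openness, extrema *)

Section Stability.
Context {R : realType}.
Variables (lam r : R) (d b : R -> R).
Hypotheses (lam0 : 0 < lam) (r0 : 0 <= r) (d0 : d 0 = 0) (b0 : b 0 = 0).
Hypothesis lip : forall X : R, exists2 L, 0 < L & forall x y, 0 <= x <= X ->
  0 <= y <= X -> `|d x - d y| <= L * `|x - y| /\ `|b x - b y| <= L * `|x - y|.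
Implicit Types (k K g T : R) (u v W : R -> R).

Local Notation step := (step lam r d b).

Lemma le_of_le_add_half (x a B : R) :
  (forall n, x <= B / 2 ^+ n + a) -> x <= a.
Proof.
move=> H; apply/ler_addgt0Pr => e e0.
apply: (le_trans (H (Num.bound (B / e)))); rewrite addrC lerD2l.
rewrite ler_pdivrMr ?exprn_gt0// mulrC -ler_pdivrMr//.
exact/ltW/upper_nthrootP.
Qed.

(** For two fixed points [step_diff] turns a bound N into N / 2 + C |g1 - g2|; iterating from a
    crude bound leaves 2 C |g1 - g2|. Equal speeds give uniqueness. The factor [x] in the conclusion
    keeps a perturbed solution within a linear bracket down to the front. *)
Lemma step_stability k K T G : 0 < k -> k <= K -> 0 < T -> 0 < G ->
  exists2 C, 0 < C &
  forall g1 g2 v1 v2 W1 W2, 0 <= g1 <= G -> 0 <= g2 <= G ->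
  step k K g1 T v1 v1 W1 -> step k K g2 T v2 v2 W2 ->
  forall x, 0 <= x <= T -> `|v1 x - v2 x| <= C * `|g1 - g2| * x /\
    `|W1 x - W2 x| <= C * `|g1 - g2|.
Proof.
move=> k0 kK T0 G0.
have [mu [C [mu0 C0 Hd]]] := step_diff lam0 r0 d0 b0 lip k0 kK T0 G0.
have [Cq Cq0 HCq] := step_quot_bound lam0 r0 d0 b0 lip k0 kK (ltW T0).
pose M := G * (1 + Cq * T).
have M0 : 0 < M by posit.
have vb g v W : 0 <= g <= G -> step k K g T v v W -> forall x, 0 <= x <= T ->
    `|v x| <= M * x.
  move=> /andP[g0 gG] S x /andP[x0 xT].
  apply: (norm_le_linear x0 (step_cv S)); first exact: (step_v0 S).
    by move=> s /andP[s0 sx]; apply: (step_dv S); rewrite s0 (le_trans (ltW sx)).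
  move=> s /andP[s0 sx]; have sT : 0 < s <= T by rewrite s0 (le_trans (ltW sx)).
  rewrite normrM (ger0_norm g0); apply: ler_pM => //.
  apply: (le_trans (ler_normD _ _)); rewrite normr1 lerD2l.
  apply: (le_trans (HCq _ _ _ _ S s sT)).
  by rewrite ler_pM2l//; case/andP: sT.
have e1 x : 0 <= x -> 1 <= expR (mu * x).
  by rewrite le_eqVlt => /predU1P[<-|x0]; [rewrite mulr0 expR0|rewrite ltW// expR_gt1 mulr_gt0].
pose C' := 2 * C * expR (mu * T) + 2 * C * C.
have C'0 : 0 < C' by posit.
exists C' => // g1 g2 v1 v2 W1 W2 g1G g2G S1 S2.
have [g20 _] := andP g2G.
pose D := `|g1 - g2|.
have D0 : 0 <= D by exact: normr_ge0.
have est n x : 0 <= x <= T ->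
    `|v1 x - v2 x| <= (2 * M / 2 ^+ n + 2 * C * D) * (x * expR (mu * x)).
  elim: n x => [|n IH] x /andP[x0 xT].
    rewrite expr0 divr1; apply: (@le_trans _ _ (2 * M * x)).
      apply: (le_trans (ler_normB _ _)).
      have xT' : 0 <= x <= T by rewrite x0.
      have := vb _ _ _ g1G S1 x xT'; have := vb _ _ _ g2G S2 x xT'; lra.
    apply: ler_pM; [by nonneg|by []| |].
      by rewrite lerDl; nonneg.
    by rewrite ler_peMr// e1.
  have [|||+ _] := Hd g1 g2 _ _ _ _ _ _ (2 * M / 2 ^+ n + 2 * C * D) g1G g20 S1 S2 _ _ x.
  - have : 0 <= 2 * M / 2 ^+ n by rewrite divr_ge0// ?exprn_ge0//; nonneg.
    by move=> ?; rewrite addr_ge0//; nonneg.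
  - by move=> y /andP[y0 yT]; apply: IH; rewrite (ltW y0).
  - by rewrite x0.
  move=> h; apply: (le_trans h); rewrite ler_wpM2r//; first by nonneg.
  rewrite le_eqVlt; apply/orP; left; apply/eqP; rewrite exprS /D.
  have : (2:R) ^+ n != 0 by []; move=> ?; field; by [].
have est2 x : 0 <= x <= T -> `|v1 x - v2 x| <= 2 * C * D * (x * expR (mu * x)).
  move=> xT; apply: (@le_of_le_add_half _ _ (2 * M * (x * expR (mu * x)))) => n.
  apply: (le_trans (est n x xT)).
  rewrite le_eqVlt; apply/orP; left; apply/eqP; ring.
move=> x xT; have /andP[x0 x1] := xT; split.
  apply: (le_trans (est2 x xT)).
  rewrite [leLHS](_ : _ = 2 * C * expR (mu * x) * D * x); last by ring.
  rewrite ler_wpM2r// ler_wpM2r// /C' -[leLHS]addr0; apply: lerD; last by nonneg.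
  by rewrite ler_pM2l ?ler_expR ?ler_pM2l//; posit.
have [|||_ h] := Hd g1 g2 _ _ _ _ _ _ (2 * C * D) g1G g20 S1 S2 _ _ x.
- by nonneg.
- by move=> y /andP[y0 yT]; apply: est2; rewrite (ltW y0).
- by [].
apply: (le_trans h); rewrite [leLHS](_ : _ = 2 * C * C * D); last by ring.
by rewrite ler_wpM2r// /C' -[leLHS]add0r; apply: lerD => //; nonneg.
Qed.

(* The maximum matters only past the end of the interval of existence, where the
   pressure is unconstrained and may be negative. *)
Definition psi v x : R := (Num.max (v x) 0) `^ lam.

(** The equation without clamp. The linear bracket belongs to the notion: it makes [v] positive on
    []0, T]] and identifies the solution with one of a clamped problem, from which uniqueness and
    openness are inherited. *)
Record sol g T v W : Prop := Sol {
  sol_cv : continuous v;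
  sol_cW : continuous W;
  sol_v0 : forall x, x <= 0 -> v x = 0;
  sol_W0 : forall x, x <= 0 -> W x = 0;
  sol_dv : forall x, 0 < x <= T -> is_derive x 1 v (g * (1 + W x / psi v x));
  sol_dW : forall x, 0 < x <= T ->
    is_derive x 1 W (d (psi v x) - b (psi v (x - r)));
  sol_bracket : exists k K, [/\ 0 < k, k <= K &
    forall x, 0 < x <= T -> k * x <= v x <= K * x] }.

Lemma dens_psi k K T v x : 0 < k -> k <= K -> (forall x, x <= 0 -> v x = 0) ->
  (forall x, 0 < x <= T -> k * x <= v x <= K * x) -> x <= T ->
  dens lam k K v x = psi v x.
Proof.
move=> k0 kK v0 H xT; rewrite /psi; have [x0|x0] := leP x 0.
  by rewrite (dens_le0 lam0)// v0// maxxx powR0// gt_eqF.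
rewrite /dens /clamp; have /andP[h1 h2] := H x (introT andP (conj x0 xT)).
rewrite [Num.max x 0]max_l ?(ltW x0)//.
by rewrite (max_l h1) (min_l h2) max_l// (le_trans _ h1)//; nonneg.
Qed.

Lemma sol_step k K g T v W : 0 < k -> k <= K -> sol g T v W ->
  (forall x, 0 < x <= T -> k * x <= v x <= K * x) -> step k K g T v v W.
Proof.
move=> k0 kK [cv cW v0 W0 dv dW _] H.
have E := dens_psi k0 kK v0 H.
split=> // x /[dup] xT /andP[_ x1]; rewrite !E//; first exact: dv.
  exact: dW.
by rewrite (le_trans _ x1)// gerBl.
Qed.

Lemma step_sol k K g T v W : 0 < k -> k <= K -> step k K g T v v W ->
  (forall x, 0 < x <= T -> k * x <= v x <= K * x) -> sol g T v W.
Proof.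
move=> k0 kK [_ cv cW v0 W0 dv dW] H.
have E := dens_psi k0 kK v0 H.
split=> //; last by exists k, K.
  by move=> x /[dup] xT /andP[_ x1]; rewrite -E//; exact: dv.
move=> x /[dup] xT /andP[_ x1]; rewrite -!E//; first exact: dW.
by rewrite (le_trans _ x1)// gerBl.
Qed.

Lemma sol_restrict g T T' v W : T' <= T -> sol g T v W -> sol g T' v W.
Proof.
move=> TT [cv cW v0 W0 dv dW [k [K [k0 kK H]]]].
have le x : 0 < x <= T' -> 0 < x <= T.
  by move=> /andP[-> /le_trans ->].
by split=> //; [move=> x /le; exact: dv|move=> x /le; exact: dW|
  exists k, K; split=> // x /le; exact: H].
Qed.

Lemma sol_unique g T v1 v2 W1 W2 : 0 < g -> 0 < T ->
  sol g T v1 W1 -> sol g T v2 W2 ->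
  forall x, x <= T -> v1 x = v2 x /\ W1 x = W2 x.
Proof.
move=> g0 T0 S1 S2 x xT; have [x0|x0] := leP x 0.
  by rewrite (sol_v0 S1)// (sol_v0 S2)// (sol_W0 S1)// (sol_W0 S2).
have [k1 [K1 [k10 kK1 H1]]] := sol_bracket S1.
have [k2 [K2 [k20 kK2 H2]]] := sol_bracket S2.
(* With a common bracket both are fixed points of the same clamped problem. *)
pose k := Num.min k1 k2; pose K := Num.max K1 K2.
have k0 : 0 < k by rewrite lt_min k10.
have kK : k <= K by rewrite le_max ge_min (le_trans _ kK1)// ge_min lexx.
have brk ki Ki v : k <= ki -> Ki <= K ->
    (forall x, 0 < x <= T -> ki * x <= v x <= Ki * x) ->
    (forall x, 0 < x <= T -> k * x <= v x <= K * x).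
  move=> h1 h2 H y /[dup] yT /andP[y0 _]; have /andP[h3 h4] := H y yT.
  by rewrite (le_trans _ h3) ?(le_trans h4)// ler_pM2r.
have B1 : forall x, 0 < x <= T -> k * x <= v1 x <= K * x.
  by apply: (brk k1 K1); rewrite ?ge_min ?le_max ?lexx ?orbT.
have B2 : forall x, 0 < x <= T -> k * x <= v2 x <= K * x.
  by apply: (brk k2 K2); rewrite ?ge_min ?le_max ?lexx ?orbT.
have [C C0 HC] := step_stability k0 kK T0 g0.
have gg : 0 <= g <= g by rewrite lexx ltW.
have := HC _ _ _ _ _ _ gg gg (sol_step k0 kK S1 B1) (sol_step k0 kK S2 B2) x.
rewrite (ltW x0) xT => /(_ isT); rewrite subrr normr0 mulr0 mul0r !normr_le0 !subr_eq0.
by case=> /eqP -> /eqP ->.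
Qed.

(** The clamped problem for [g'] is solved in a strictly wider bracket. For [g'] close to [g],
    stability keeps its solution inside, so the clamp is inactive and the solution is genuine. *)
Lemma sol_open g T v W e : 0 < g -> 0 < T -> 0 < e -> sol g T v W ->
  exists2 del, 0 < del & forall g', 0 < g' -> `|g - g'| < del ->
  exists v' W', [/\ sol g' T v' W', `|v T - v' T| < e & `|W T - W' T| < e].
Proof.
move=> g0 T0 e0 S; have [k1 [K1 [k10 kK1 H1]]] := sol_bracket S.
pose k := k1 / 2; pose K := 2 * K1.
have K10 : 0 < K1 by exact: lt_le_trans kK1.
have k0 : 0 < k by posit.
have kk : k < k1 by rewrite /k; lra.
have KK : K1 < K by rewrite /K; lra.
have kK : k <= K by lra.
have B : forall x, 0 < x <= T -> k * x <= v x <= K * x.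
  move=> y /[dup] yT /andP[y0 _]; have /andP[h3 h4] := H1 y yT.
  by rewrite (le_trans _ h3) ?(le_trans h4)// ler_pM2r// ltW.
have G0 : 0 < g + 1 by posit.
have [C C0 HC] := step_stability k0 kK T0 G0.
pose del := Num.min 1 (Num.min ((k1 - k) / C) (Num.min ((K - K1) / C)
  (Num.min (e / (C * T)) (e / C)))).
exists del.
  by rewrite !lt_min ltr01 !divr_gt0 ?subr_gt0//; posit.
move=> g' g'0; rewrite !lt_min => /and5P[h1 h2 h3 h4 h5].
have gG : 0 <= g <= g + 1 by rewrite ltW//= lerDl.
have gG' : 0 <= g' <= g + 1.
  by rewrite (ltW g'0)/=; move: h1; rewrite ltr_norml => /andP[]; lra.
have [v' [W' S']] := step_fixpoint lam0 r0 d0 b0 lip k0 kK T0 g'0.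
have {}HC := HC _ _ _ _ _ _ gG gG' (sol_step k0 kK S B) S'.
exists v', W'; split.
- apply: (step_sol k0 kK S') => x /[dup] xT /andP[x0 x1].
  have := HC x; rewrite (ltW x0) x1 => /(_ isT)[h _].
  have /andP[l1 l2] := H1 x xT.
  rewrite ltr_pdivlMr// mulrC in h2; rewrite ltr_pdivlMr// mulrC in h3.
  have h2' : C * `|g - g'| * x < (k1 - k) * x by rewrite ltr_pM2r.
  have h3' : C * `|g - g'| * x < (K - K1) * x by rewrite ltr_pM2r.
  rewrite mulrBl in h2'; rewrite mulrBl in h3'.
  move: h; rewrite ler_norml => /andP[? ?].
  by apply/andP; split; lra.
- have := HC T; rewrite (ltW T0) lexx => /(_ isT)[h _].
  apply: le_lt_trans h _; rewrite ltr_pdivlMr// in h4; last by posit.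
  by rewrite mulrC mulrA -[X in X < _]mulrC [T * C]mulrC.
- have := HC T; rewrite (ltW T0) lexx => /(_ isT)[_ h].
  by apply: le_lt_trans h _; rewrite mulrC -ltr_pdivlMr.
Qed.

Lemma psi_continuous g T v W : sol g T v W -> continuous (psi v).
Proof.
move=> S x; apply: (@continuous_comp _ _ _ v (fun y => (Num.max y 0) `^ lam)).
  exact: sol_cv S x.
exact: powR_pos_continuous.
Qed.

Lemma psi_ge0 v x : 0 <= psi v x. Proof. exact: powR_ge0. Qed.

Lemma psi_le v x y : v x <= v y -> psi v x <= psi v y.
Proof.
move=> xy; apply: ge0_ler_powR; first exact: ltW.
- by rewrite nnegrE le_max lexx orbT.
- by rewrite nnegrE le_max lexx orbT.
- by rewrite ge_max !le_max xy/= lexx orbT.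
Qed.

(** * Monotonicity and extrema of a solution, read off the flux *)

Section Sol.
Variables (g T : R) (v W : R -> R).
Hypotheses (g0 : 0 < g) (S : sol g T v W).
Implicit Types x y : R.

Definition flux x := psi v x + W x.

Lemma sol_gt0 x : 0 < x <= T -> 0 < v x.
Proof.
move=> /[dup] xT /andP[x0 _]; have [k [K [k0 _ H]]] := sol_bracket S.
by have /andP[h _] := H x xT; apply: lt_le_trans h; posit.
Qed.

Lemma sol_ge0 x : x <= T -> 0 <= v x.
Proof.
move=> xT; have [x0|x0] := leP x 0; first by rewrite (sol_v0 S).
by rewrite ltW// sol_gt0// x0.
Qed.

Lemma psiE x : x <= T -> psi v x = v x `^ lam.
Proof. by move=> xT; rewrite /psi max_l// sol_ge0. Qed.

Lemma psi_gt0 x : 0 < x <= T -> 0 < psi v x.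
Proof. by move=> /sol_gt0 h; rewrite powR_gt0// lt_max h. Qed.

Lemma psi_le0 x : x <= 0 -> psi v x = 0.
Proof. by move=> x0; rewrite /psi (sol_v0 S)// maxxx powR0// gt_eqF. Qed.

Lemma psi_ltP x y : x <= T -> y <= T -> (psi v x < psi v y) = (v x < v y).
Proof.
move=> xT yT; apply/idP/idP.
  by apply: contraTT; rewrite -!leNgt; exact: psi_le.
move=> xy; rewrite !psiE//; apply: gt0_ltr_powR => //; rewrite ?nnegrE//.
  exact: sol_ge0.
exact: sol_ge0.
Qed.

Lemma psi_leP x y : x <= T -> y <= T -> (psi v x <= psi v y) = (v x <= v y).
Proof. by move=> xT yT; rewrite !leNgt psi_ltP. Qed.

Lemma flux_continuous : continuous flux.
Proof.
have cp := psi_continuous S; have cW := sol_cW S => x.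
exact: (@continuousD R R R (psi v) W x (cp x) (cW x)).
Qed.

Lemma sol_derive x : 0 < x <= T -> is_derive x 1 v (g * (flux x / psi v x)).
Proof.
move=> xT; have := sol_dv S xT => h; apply: is_derive_eq.
congr (_ * _); rewrite /flux mulrDl divff// gt_eqF// psi_gt0//.
Qed.

Lemma slope_gt0 x : 0 < x <= T -> (0 < g * (flux x / psi v x)) = (0 < flux x).
Proof. by move=> /psi_gt0 h; rewrite pmulr_rgt0// pmulr_lgt0// invr_gt0. Qed.

Lemma slope_ge0 x : 0 < x <= T -> (0 <= g * (flux x / psi v x)) = (0 <= flux x).
Proof. by move=> /psi_gt0 h; rewrite pmulr_rge0// pmulr_lge0// invr_gt0. Qed.

Lemma slope_lt0 x : 0 < x <= T -> (g * (flux x / psi v x) < 0) = (flux x < 0).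
Proof. by move=> /psi_gt0 h; rewrite pmulr_rlt0// pmulr_llt0// invr_gt0. Qed.

Lemma is_derive_psi x : 0 < x <= T -> is_derive x 1 (psi v)
  (lam * v x `^ (lam - 1) * (g * (flux x / psi v x))).
Proof.
move=> xT; have vx := sol_gt0 xT.
have dv := sol_derive xT.
have dp := @is_derive1_powR R lam (v x) vx.
have dc := @is_derive1_comp R (@powR R ^~ lam) v x _ _ dp dv.
apply: (near_eq_is_derive _ dc); near=> y => /=.
rewrite /psi max_l//; apply: ltW; near: y.
have cv := sol_cv S; have /cvgrPdist_lt/(_ _ vx) := cv x.
by apply: filterS => y; rewrite ltr_norml => /andP[_]; lra.
Unshelve. all: by end_near. Qed.

(** At a critical point [psi] has zero slope, so the slope of the flux reduces to that of [W],
    deaths minus delayed births. This is the second-order test used at every extremum. *)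
Lemma is_derive_flux0 x : 0 < x <= T -> flux x = 0 ->
  is_derive x 1 flux (d (psi v x) - b (psi v (x - r))).
Proof.
move=> xT fx; have := is_derive_psi xT; rewrite fx mul0r !mulr0 => h.
have h2 := sol_dW S xT; apply: is_derive_eq; exact: add0r.
Qed.

Lemma sol_le_of_flux x y : 0 <= x -> x <= y -> y <= T ->
  (forall s, x < s < y -> 0 <= flux s) -> v x <= v y.
Proof.
move=> x0 xy yT H.
have inT s : x < s < y -> 0 < s <= T.
  by move=> /andP[xs sy]; rewrite (le_lt_trans x0)//= (le_trans (ltW sy)).
apply: (derive_ge0_le xy (sol_cv S)) => s hs; first exact: sol_derive (inT s hs).
by rewrite slope_ge0; [exact: H|exact: inT].
Qed.

Lemma sol_lt_of_flux x y : 0 <= x -> x < y -> y <= T ->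
  (forall s, x < s < y -> 0 < flux s) -> v x < v y.
Proof.
move=> x0 xy yT H.
have inT s : x < s < y -> 0 < s <= T.
  by move=> /andP[xs sy]; rewrite (le_lt_trans x0)//= (le_trans (ltW sy)).
apply: (derive_gt0_lt xy (sol_cv S)) => s hs; first exact: sol_derive (inT s hs).
by rewrite slope_gt0; [exact: H|exact: inT].
Qed.

Lemma sol_gt_of_flux x y : 0 <= x -> x < y -> y <= T ->
  (forall s, x < s < y -> flux s < 0) -> v y < v x.
Proof.
move=> x0 xy yT H.
have inT s : x < s < y -> 0 < s <= T.
  by move=> /andP[xs sy]; rewrite (le_lt_trans x0)//= (le_trans (ltW sy)).
rewrite -ltrN2.
apply: (@derive_gt0_lt R (- v) (fun s => - (g * (flux s / psi v s))) x y xy).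
- by have cv := sol_cv S => s; apply: continuousN; exact: cv.
- by move=> s hs; have := sol_derive (inT s hs) => ?; exact: is_deriveN.
- by move=> s hs; rewrite oppr_gt0 slope_lt0; [exact: H|exact: inT].
Qed.

(** If births exceeded deaths at [q], the flux would vanish there with negative slope, be negative
    just after, and [v] would drop below its minimum. *)
Lemma sol_interior_min a q c : 0 <= a -> a < q < c -> c <= T ->
  (forall x, a <= x <= c -> v q <= v x) ->
  flux q = 0 /\ b (psi v (q - r)) <= d (psi v q).
Proof.
move=> a0 /andP[aq qc] cT H.
have q0 : 0 < q by exact: le_lt_trans aq.
have qT : 0 < q <= T by rewrite q0 (le_trans (ltW qc)).
have dv := sol_derive qT.
have fq : flux q = 0.
  apply/eqP; rewrite eq_le; apply/andP; split; rewrite leNgt; apply/negP => h.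
    have [||e [e0 ea He]] := @derive_gt0_left R v q _ (q - a) dv.
    - by rewrite slope_gt0.
    - by rewrite subr_gt0.
    have : v (q - e / 2) < v q by apply: He; apply/andP; split; lra.
    by rewrite ltNge H//; apply/andP; split; lra.
  have [||e [e0 ea He]] := @derive_lt0_right R v q _ (c - q) dv.
  - by rewrite slope_lt0.
  - by rewrite subr_gt0.
  have : v (q + e / 2) < v q by apply: He; apply/andP; split; lra.
  by rewrite ltNge H//; apply/andP; split; lra.
split=> //; rewrite leNgt; apply/negP => h.
have [||e [e0 ea He]] := @derive_lt0_right R flux q _ (c - q) (is_derive_flux0 qT fq).
- by rewrite subr_lt0.
- by rewrite subr_gt0.
have : v (q + e / 2) < v q.
  apply: sol_gt_of_flux; [exact: ltW|lra|lra|].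
  by move=> s /andP[s1 s2]; rewrite -fq; apply: He; apply/andP; split; lra.
by rewrite ltNge H//; apply/andP; split; lra.
Qed.

Lemma sol_interior_max a q c : 0 <= a -> a < q < c -> c <= T ->
  (forall x, a <= x <= c -> v x <= v q) ->
  flux q = 0 /\ d (psi v q) <= b (psi v (q - r)).
Proof.
move=> a0 /andP[aq qc] cT H.
have q0 : 0 < q by exact: le_lt_trans aq.
have qT : 0 < q <= T by rewrite q0 (le_trans (ltW qc)).
have dv := sol_derive qT.
have dNv : is_derive q 1 (- v) (- (g * (flux q / psi v q))) by exact: is_deriveN.
have fq : flux q = 0.
  apply/eqP; rewrite eq_le; apply/andP; split; rewrite leNgt; apply/negP => h.
    have [||e [e0 ea He]] := @derive_gt0_right R v q _ (c - q) dv.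
    - by rewrite slope_gt0.
    - by rewrite subr_gt0.
    have : v q < v (q + e / 2) by apply: He; apply/andP; split; lra.
    by rewrite ltNge H//; apply/andP; split; lra.
  have [||e [e0 ea He]] := @derive_gt0_left R (- v) q _ (q - a) dNv.
  - by rewrite oppr_gt0 slope_lt0.
  - by rewrite subr_gt0.
  have : (- v) (q - e / 2) < (- v) q by apply: He; apply/andP; split; lra.
  by rewrite !fctE ltrN2 ltNge H//; apply/andP; split; lra.
split=> //; rewrite leNgt; apply/negP => h.
have [||e [e0 ea He]] := @derive_gt0_right R flux q _ (c - q) (is_derive_flux0 qT fq).
- by rewrite subr_gt0.
- by rewrite subr_gt0.
have : v q < v (q + e / 2).
  apply: sol_lt_of_flux; [exact: ltW|lra|lra|].
  by move=> s /andP[s1 s2]; rewrite -fq; apply: He; apply/andP; split; lra.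
by rewrite ltNge H//; apply/andP; split; lra.
Qed.

(** The flux comes down to zero at [t], so its slope there cannot be positive. *)
Lemma sol_first_critical t : 0 < t <= T -> flux t = 0 ->
  (forall s, 0 < s < t -> 0 < flux s) ->
  d (psi v t) <= b (psi v (t - r)).
Proof.
move=> tT ft H; rewrite leNgt; apply/negP => h.
have /andP[t0 _] := tT.
have [||e [e0 ea He]] := @derive_gt0_left R flux t _ t (is_derive_flux0 tT ft).
- by rewrite subr_gt0.
- by [].
have : flux (t - e / 2) < flux t by apply: He; apply/andP; split; lra.
by rewrite ft ltNge ltW// H//; apply/andP; split; lra.
Qed.

End Sol.
End Stability.

(** * Shooting *)

Section Shooting.
Context {R : realType}.
Variables (lam r : R) (d b : R -> R) (kappa z1 z2 Lb : R).
Hypotheses (lam0 : 0 < lam) (r0 : 0 <= r) (d0 : d 0 = 0) (b0 : b 0 = 0).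
Hypothesis lip : forall X : R, exists2 L, 0 < L & forall x y, 0 <= x <= X ->
  0 <= y <= X -> `|d x - d y| <= L * `|x - y| /\ `|b x - b y| <= L * `|x - y|.
Hypothesis dinc : forall x y, 0 <= x -> x < y -> d x < d y.
(** Quasi-concavity, the form in which the single extremum of [b] is exploited: lower bounds on [b]
    at two densities hold at all densities between them. *)
Hypothesis bqc : forall x z y, 0 <= x -> x <= z -> z <= y ->
  Num.min (b x) (b y) <= b z.
Hypothesis bmax : forall x, 0 <= x -> b x <= d z2.
Hypotheses (z1_gt0 : 0 < z1) (z1k : z1 < kappa) (kz2 : kappa <= z2).
Hypotheses (bz : b z1 = b z2) (bk1 : b z1 <= b kappa).
Hypothesis bz1 : forall x, 0 <= x -> x <= z1 -> b x <= b z1.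
Hypothesis dbk : b kappa = d kappa.
Hypothesis dltb : forall x, 0 < x -> x < kappa -> d x < b x.
Hypotheses (Lb0 : 0 < Lb) (bLb : forall x, 0 <= x -> b x <= Lb * x).
Implicit Types (g T x y : R) (v W : R -> R).

Local Notation sol := (sol lam r d b).
Local Notation psi := (psi lam).
Local Notation flux := (flux lam).

Lemma dmono x y : 0 <= x -> x <= y -> d x <= d y.
Proof.
by move=> x0; rewrite le_eqVlt => /predU1P[->//|xy]; exact/ltW/dinc.
Qed.

Lemma d_ge0 x : 0 <= x -> 0 <= d x.
Proof. by move=> x0; rewrite -d0; exact: dmono. Qed.

Lemma kappa_gt0 : 0 < kappa. Proof. exact: lt_trans z1k. Qed.

Lemma dleb x : 0 < x -> x <= kappa -> d x <= b x.
Proof.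
move=> x0; rewrite le_eqVlt => /predU1P[->|xk]; first by rewrite dbk.
exact/ltW/dltb.
Qed.

(** Up to this time births take at most half of the density away from the flux, for every [g]; all
    solutions therefore start with an increasing phase of this common length. *)
Let xs : R := (2 * Lb)^-1.
Let xs0 : 0 < xs. Proof. by rewrite invr_gt0; posit. Qed.

Lemma psi_mono g T v W x y : sol g T v W -> 0 < g -> 0 <= y ->
  y <= T -> x <= y -> (forall s, 0 < s < y -> 0 <= flux v W s) -> v x <= v y.
Proof.
move=> S g0 y0 yT xy H; have [x0|x0] := leP x 0.
  by rewrite (sol_v0 S x0) (sol_ge0 S).
apply: (sol_le_of_flux g0 S (ltW x0) xy yT) => s /andP[xs_ sy].
by apply: H; rewrite (lt_trans x0).
Qed.

(** On an increasing branch the delayed density is at most the current one, so [W] decreases at rate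
    at most [Lb * psi v x]. *)
Lemma W_lower g T v W x : sol g T v W -> 0 < g -> 0 < x <= T ->
  (forall s, 0 < s < x -> 0 <= flux v W s) -> - (Lb * psi v x * x) <= W x.
Proof.
move=> S g0 /andP[x0 xT] H.
apply: (@derive_le R (fun s => - (Lb * psi v x * s)) W (fun=> - (Lb * psi v x))
   (fun s => d (psi v s) - b (psi v (s - r))) 0 x (ltW x0)).
- move=> s; apply: (@continuousN R R R); exact: mulrl_continuous.
- exact: sol_cW S.
- by move=> s _; apply: is_derive_eq; rewrite /GRing.scale/=; ring.
- by move=> s /andP[s0 sx]; apply: (sol_dW S); rewrite s0 (le_trans (ltW sx)).
- move=> s /andP[s0 sx].
  have h1 := d_ge0 (psi_ge0 lam v s).
  have h2 := bLb (psi_ge0 lam v (s - r)).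
  have h3 : psi v (s - r) <= psi v x.
    apply: (psi_le lam0); apply: (psi_mono S g0 (ltW x0) xT _ H).
    by rewrite (le_trans _ (ltW sx))// gerBl.
  have h4 : Lb * psi v (s - r) <= Lb * psi v x by rewrite ler_pM2l.
  lra.
- by rewrite mulr0 oppr0 (sol_W0 S).
Qed.

(** Near the front the sign follows from W / psi = O(x), with a constant that depends on the
    solution. A first zero of the flux before [xs] is then excluded by [W_lower], which gives W >= -
    psi / 2 there. *)
Lemma start_flux g T v W x : sol g T v W -> 0 < g -> 0 < x <= T -> x <= xs ->
  0 < flux v W x.
Proof.
move=> S g0 /andP[x0 xT] xxs; rewrite ltNge; apply/negP => fx.
have T0 : 0 < T by exact: lt_le_trans xT.
have [k [K [k0 kK H]]] := sol_bracket S.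
have [C C0 HC] := step_quot_bound lam0 r0 d0 b0 lip k0 kK (ltW T0).
have St := sol_step lam0 r0 k0 kK S H.
have near0 s : 0 < s <= T -> C * s < 1 -> 0 < flux v W s.
  move=> sT Cs; have := HC _ _ _ _ St s sT.
  rewrite (dens_psi lam0 k0 kK (sol_v0 S) H); last by case/andP: sT.
  have p0 := psi_gt0 S sT.
  move=> h; have : -1 < W s / psi v s.
    have : `|W s / psi v s| < 1 by exact: le_lt_trans Cs.
    by rewrite ltr_norml => /andP[].
  by rewrite ltr_pdivlMr// /flux; lra.
pose e := Num.min x (2 * C)^-1.
have e0 : 0 < e by rewrite lt_min x0 invr_gt0; posit.
have ex : e <= x by rewrite ge_min lexx.
have fe s : 0 < s -> s <= e -> 0 < flux v W s.
  move=> s0 se; apply: near0; first by rewrite s0 (le_trans se)// (le_trans ex).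
  have : s <= (2 * C)^-1 by rewrite (le_trans se)// ge_min lexx orbT.
  move=> h; have : C * s <= C * (2 * C)^-1 by rewrite ler_pM2l.
  have -> : C * (2 * C)^-1 = 1 / 2 by field; rewrite lt0r_neq0.
  lra.
have [t [/andP[et tx] ft Ht]] := first_nonpos ex (flux_continuous lam0 S) (fe e e0 (lexx _)) fx.
have t0 : 0 < t by exact: lt_trans et.
have tT : 0 < t <= T by rewrite t0 (le_trans tx).
have Ht' s : 0 < s < t -> 0 <= flux v W s.
  move=> /andP[s0 st]; have [se|es] := leP s e; first exact/ltW/fe.
  by apply/ltW/Ht; rewrite (ltW es).
have := W_lower S g0 tT Ht'.
have p0 := psi_gt0 S tT.
have : Lb * psi v t * t <= psi v t / 2.
  rewrite [leLHS](_ : _ = psi v t * (Lb * t)); last by ring.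
  rewrite ler_pM2l//.
  have : Lb * t <= Lb * xs by rewrite ler_pM2l// (le_trans tx).
  have -> : Lb * xs = 2^-1 by rewrite /xs; field; rewrite lt0r_neq0.
  by [].
move: ft; rewrite /flux; lra.
Qed.

Lemma start_lower g T v W x : sol g T v W -> 0 < g -> 0 < x <= T -> x <= xs ->
  g / 2 * x <= v x.
Proof.
move=> S g0 /andP[x0 xT] xxs.
apply: (@derive_le R (fun s => g / 2 * s) v (fun=> g / 2)
   (fun s => g * (1 + W s / psi v s)) 0 x (ltW x0)).
- exact: mulrl_continuous.
- exact: sol_cv S.
- by move=> s _; apply: is_derive_eq; rewrite /GRing.scale/=; ring.
- by move=> s /andP[s0 sx]; apply: (sol_dv S); rewrite s0 (le_trans (ltW sx)).
- move=> s /andP[s0 sx].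
  have sT : 0 < s <= T by rewrite s0 (le_trans (ltW sx)).
  rewrite ler_pM2l//.
  have p0 := psi_gt0 S sT.
  have := W_lower S g0 sT => H.
  have : - (Lb * s) <= W s / psi v s.
    rewrite ler_pdivlMr// mulNr mulrAC; apply: H => y /andP[y0 ys].
    apply/ltW/(start_flux S g0).
      by rewrite y0 (le_trans (ltW ys))//; case/andP: sT.
    by rewrite (le_trans (ltW ys))// (le_trans (ltW sx)).
  have : Lb * s <= Lb * xs by rewrite ler_pM2l// (le_trans (ltW sx)).
  have -> : Lb * xs = 2^-1 by rewrite /xs; field; rewrite lt0r_neq0.
  lra.
- by rewrite mulr0 (sol_v0 S).
Qed.

(** Supplies the upper half of the a priori bracket near the front: births only lower [W], and
    deaths are at most linear in the density while it stays below [z2]. *)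
Lemma start_upper : exists2 Ld, 0 < Ld & forall g T v W, sol g T v W -> 0 < g ->
  (forall x, 0 < x <= T -> psi v x <= z2) ->
  forall x, 0 < x <= T -> x <= xs -> v x <= g * (1 + Ld * xs) * x.
Proof.
have [L L0 HL] := lip z2.
exists L => // g T v W S g0 Hz x /andP[x0 xT] xxs.
(* Quasi-concavity between [0] and [z2], whose end values are [0] and [b z1 >= d z1 >= 0]. *)
have bge0 y : 0 <= y -> 0 <= y <= z2 -> 0 <= b y.
  move=> y0 /andP[_ yz]; have := bqc (lexx 0) y0 yz.
  rewrite b0 -bz min_l//.
  exact: le_trans (d_ge0 (ltW z1_gt0)) (dleb z1_gt0 (ltW z1k)).
have inz y : y <= T -> 0 <= psi v y <= z2.
  move=> yT; rewrite psi_ge0/=; have [y0|y0] := leP y 0.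
    by rewrite (psi_le0 lam0 S)// (le_trans (ltW kappa_gt0)).
  by apply: Hz; rewrite y0.
apply: (@derive_le R v (fun s => g * (1 + L * xs) * s)
   (fun s => g * (1 + W s / psi v s)) (fun=> g * (1 + L * xs)) 0 x (ltW x0)).
- exact: sol_cv S.
- exact: mulrl_continuous.
- by move=> s /andP[s0 sx]; apply: (sol_dv S); rewrite s0 (le_trans (ltW sx)).
- by move=> s _; apply: is_derive_eq; rewrite /GRing.scale/=; ring.
- move=> s /andP[s0 sx].
  have sT : 0 < s <= T by rewrite s0 (le_trans (ltW sx)).
  have sT' : s <= T by case/andP: sT.
  rewrite ler_pM2l// lerD2l.
  have p0 := psi_gt0 S sT.
  rewrite ler_pdivrMr//.
  apply: (@le_trans _ _ (L * psi v s * s)); last first.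
    by rewrite mulrAC ler_wpM2r ?(ltW p0)// ler_pM2l// (le_trans (ltW sx)).
  apply: (@derive_le R W (fun y => L * psi v s * y)
   (fun y => d (psi v y) - b (psi v (y - r))) (fun=> L * psi v s) 0 s (ltW s0)).
  + exact: sol_cW S.
  + exact: mulrl_continuous.
  + by move=> y /andP[y0 ys]; apply: (sol_dW S); rewrite y0 (le_trans (ltW ys)).
  + by move=> y _; apply: is_derive_eq; rewrite /GRing.scale/=; ring.
  + move=> y /andP[y0 ys].
    have yT : y <= T by rewrite (le_trans (ltW ys)).
    have yrT : y - r <= T by rewrite (le_trans _ yT)// gerBl.
    have h1 := bge0 _ (psi_ge0 lam v (y - r)) (inz _ yrT).
    have z20 : 0 <= (0:R) <= z2 by rewrite lexx (le_trans (ltW kappa_gt0)).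
    have [h2 _] := HL _ _ (inz _ yT) z20.
    rewrite d0 !subr0 (ger0_norm (psi_ge0 lam v y)) in h2.
    have h3 : psi v y <= psi v s.
      apply: (psi_le lam0); apply: (psi_mono S g0 (ltW s0) sT' (ltW ys)).
      move=> q /andP[q0 qs]; apply/ltW/(start_flux S g0).
        by rewrite q0 (le_trans (ltW qs)).
      by rewrite (le_trans (ltW qs))// (le_trans (ltW sx)).
    have h4 : L * psi v y <= L * psi v s by rewrite ler_pM2l.
    have := ler_norm (d (psi v y)); lra.
  + by rewrite mulr0 (sol_W0 S).
- by rewrite mulr0 (sol_v0 S).
Qed.

(** Both properties are strict inequalities at a single time of a solution that need not be global;
    this is what makes them open in [g]. *)
Definition overshoots g : Prop := exists T v W, [/\ 0 < T, sol g T v W & z2 < psi v T].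

Definition undershoots g : Prop := exists T v W,
  [/\ 0 < T, sol g T v W, psi v T < z1 & flux v W T < 0].

Let Z2 : R := z2 `^ lam^-1.
Let Z1 : R := z1 `^ lam^-1.

Lemma powR_invK (z : R) : 0 <= z -> (z `^ lam^-1) `^ lam = z.
Proof. by move=> z0; rewrite -powRrM mulVf ?lt0r_neq0// powRr1. Qed.

Lemma psi_lt_level g T v W x z : sol g T v W -> 0 <= z -> x <= T ->
  (psi v x < z) = (v x < z `^ lam^-1).
Proof.
move=> S z0 xT; have vx := sol_ge0 S xT.
rewrite (psiE S)// -{1}(powR_invK z0); apply/idP/idP.
  apply: contraTT; rewrite -!leNgt => h; apply: ge0_ler_powR => //.
  - exact: ltW.
  - by rewrite nnegrE powR_ge0.
by move=> h; apply: gt0_ltr_powR => //; rewrite nnegrE// powR_ge0.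
Qed.

Lemma psi_gt_level g T v W x z : sol g T v W -> 0 <= z -> x <= T ->
  (z < psi v x) = (z `^ lam^-1 < v x).
Proof.
move=> S z0 xT; have vx := sol_ge0 S xT.
rewrite (psiE S)// -{1}(powR_invK z0); apply/idP/idP.
  apply: contraTT; rewrite -!leNgt => h; apply: ge0_ler_powR => //.
  - exact: ltW.
  - by rewrite nnegrE powR_ge0.
by move=> h; apply: gt0_ltr_powR => //; rewrite nnegrE// powR_ge0.
Qed.

Let z2_gt0 : 0 < z2. Proof. exact: lt_le_trans kappa_gt0 kz2. Qed.

Lemma overshoots_open g : 0 < g -> overshoots g -> exists2 e, 0 < e &
  forall g', 0 < g' -> `|g - g'| < e -> overshoots g'.
Proof.
move=> g0 [T [v [W [T0 S zT]]]].
have vT : Z2 < v T by rewrite -(psi_gt_level S)// ltW.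
have [|e e0 He] := sol_open lam0 r0 d0 b0 lip g0 T0 (e := v T - Z2) _ S.
  by rewrite subr_gt0.
exists e => // g' g'0 /(He _ g'0)[v' [W' [S' h _]]].
exists T, v', W'; split=> //.
by rewrite (psi_gt_level S')// ?ltW//; move: h; rewrite ltr_norml => /andP[]; rewrite /Z2; lra.
Qed.

Lemma undershoots_open g : 0 < g -> undershoots g -> exists2 e, 0 < e &
  forall g', 0 < g' -> `|g - g'| < e -> undershoots g'.
Proof.
move=> g0 [T [v [W [T0 S zT fT]]]].
have vT : v T < Z1 by rewrite -(psi_lt_level S)// ltW.
have TT : 0 < T <= T by rewrite T0 lexx.
have v0 := sol_gt0 S TT.
(* [sol_open] controls [v] and [W] but the flux contains a power of [v]; half of the margin of the
   flux goes to this power and half to [W]. *)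
pose p y := (Num.max y 0) `^ lam.
have cp : continuous p by exact: powR_pos_continuous.
have /cvgrPdist_lt/(_ (- flux v W T / 2)) := cp (v T).
rewrite divr_gt0 ?oppr_gt0// => /(_ isT) /nbhs_ballP[a/= a0 Ha].
have [|e e0 He] := sol_open lam0 r0 d0 b0 lip g0 T0
    (e := Num.min (Z1 - v T) (Num.min a (- flux v W T / 2))) _ S.
  by rewrite !lt_min subr_gt0 vT a0 divr_gt0 ?oppr_gt0.
exists e => // g' g'0 /(He _ g'0)[v' [W' [S']]].
rewrite !lt_min => /and3P[h1 h2 _] /and3P[_ _ h3].
exists T, v', W'; split=> //.
  rewrite (psi_lt_level S')// ?ltW//; move: h1; rewrite ltr_norml => /andP[].
  by rewrite /Z1; lra.
have := Ha (v' T) h2; rewrite /p -/(psi v T) -/(psi v' T) => h4.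
move: h3 h4; rewrite !ltr_norml /flux => /andP[? ?] /andP[? ?]; lra.
Qed.

(* Above [z2] the death rate exceeds every birth rate, so a critical point can
   only be a minimum. *)
Lemma stay_above g T v W x y : sol g T v W -> 0 < g -> 0 < x -> x <= y -> y <= T ->
  z2 < psi v x -> z2 < psi v y.
Proof.
move=> S g0 x0 xy yT zx; rewrite ltNge; apply/negP => zy.
have y0 : 0 < y by exact: lt_le_trans xy.
have [q /andP[q0 qy] Hq] := max_itv (ltW y0) (sol_cv S).
have xq : v x <= v q by apply: Hq; rewrite (ltW x0).
have zq : z2 < psi v q by apply: (lt_le_trans zx); exact: psi_le.
have q0' : 0 < q.
  rewrite lt_neqAle q0 andbT; apply/eqP => E; move: zq.
  by rewrite (psi_le0 lam0 S) -?E// ltNge ltW.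
have qy' : q < y.
  rewrite lt_neqAle qy andbT; apply/eqP => E; move: zq.
  by rewrite E ltNge zy.
have qqy : 0 < q < y by rewrite q0'.
have [_] := sol_interior_max g0 S (lexx 0) qqy yT Hq.
have := bmax (psi_ge0 lam v (q - r)).
have := dinc (ltW z2_gt0) zq; lra.
Qed.

(** * Behaviour after a first critical point at or below [kappa] *)

Section Plateau.
Variables (g T : R) (v W : R -> R) (t : R).
Hypotheses (S : sol g T v W) (g0 : 0 < g) (tT : 0 < t <= T).
Hypotheses (ft : flux v W t = 0) (Ht : forall s, 0 < s < t -> 0 < flux v W s).

Let t0 : 0 < t. Proof. by case/andP: tT. Qed.
Let tT' : t <= T. Proof. by case/andP: tT. Qed.

Let up x : x <= t -> v x <= v t.
Proof.
by move=> xt; apply: (psi_mono S g0 (ltW t0) tT' xt) => s /Ht/ltW.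
Qed.

Let upto x y : x <= y -> y <= t -> v x <= v y.
Proof.
move=> xy yt; have [y0|y0] := leP y 0.
  by rewrite (sol_v0 S) ?(le_trans xy)// (sol_v0 S).
apply: (psi_mono S g0 (ltW y0) (le_trans yt tT') xy) => s /andP[s0 sy].
by apply/ltW/Ht; rewrite s0 (lt_le_trans sy).
Qed.

Let crit : d (psi v t) <= b (psi v (t - r)).
Proof. exact: (sol_first_critical S tT ft Ht). Qed.

Hypothesis tk : psi v t <= kappa.

Let pt0 : 0 < psi v t. Proof. by have := psi_gt0 S tT. Qed.

(** During one delay after [t] the delayed density lies between [psi v (t - r)] and [psi v t].
    Births at both ends cover [d (psi v t)], by criticality at [t] and by the position below
    [kappa]. *)
Let delayed_b s : t <= s -> s - r <= t -> d (psi v t) <= b (psi v (s - r)).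
Proof.
move=> ts srt.
have h1 : psi v (t - r) <= psi v (s - r).
  by apply: (psi_le lam0); apply: upto => //; rewrite lerD2r.
have h2 : psi v (s - r) <= psi v t by apply: (psi_le lam0); exact: up.
apply: le_trans (bqc (psi_ge0 lam v _) h1 h2).
by rewrite le_min crit dleb.
Qed.

(** A rise would create an interior minimum [q] below the level of [t]. Its delayed density is
    covered by [delayed_b], or lies between the levels of [q] and [t]; in both cases births exceed
    [d (psi v q)], against the minimum test. *)
Lemma plateau_nonincreasing x y : t <= x -> x <= y -> y <= T ->
  (forall s, t <= s <= y -> psi v s <= psi v t) -> v y <= v x.
Proof.
move=> tx xy yT H; rewrite leNgt; apply/negP => vxy.
have ty : t <= y by exact: le_trans xy.
have [q /andP[tq qy] Hq] := min_itv ty (sol_cv S).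
have vqx : v q <= v x by apply: Hq; rewrite tx.
have vqy : v q < v y by exact: le_lt_trans vxy.
have vyt : v y <= v t by rewrite -(psi_leP lam0 S)// H// ty lexx.
have tq' : t < q.
  rewrite lt_neqAle tq andbT; apply/eqP => E.
  by have := lt_le_trans vqy vyt; rewrite E ltxx.
have qy' : q < y.
  by rewrite lt_neqAle qy andbT; apply/eqP => E; move: vqy; rewrite E ltxx.
have qT : q <= T by exact: le_trans yT.
have q0 : 0 < q by exact: lt_trans tq'.
have tqy : t < q < y by rewrite tq'.
have [_] := sol_interior_min g0 S (ltW t0) tqy yT Hq.
have pq : psi v q < psi v t.
  by rewrite (psi_ltP lam0 S)//; exact: lt_le_trans vyt.
have pq0 : 0 < psi v q by apply: (psi_gt0 S); rewrite q0.
have dq : d (psi v q) < d (psi v t) by exact: dinc (ltW pq0) pq.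
have [qrt|tqr] := leP (q - r) t.
  by have := delayed_b tq qrt; lra.
have h1 : psi v q <= psi v (q - r).
  by apply: (psi_le lam0); apply: Hq; rewrite (ltW tqr)/= (le_trans _ qy)// gerBl.
have h2 : psi v (q - r) <= psi v t.
  by apply: H; rewrite (ltW tqr)/= (le_trans _ qy)// gerBl.
have := bqc (ltW pq0) h1 h2; rewrite ge_min => /orP[h|h].
  have := dltb pq0 (lt_le_trans pq tk); lra.
have := dleb pt0 tk; lra.
Qed.

(* Short-time Gronwall after the last instant [s] with [psi <= psi v t] so far: an
   excess [h] gained within [del] satisfies [h <= A del h] with [A del <= 1/2]. *)
Lemma plateau_le x : t <= x -> x <= T -> psi v x <= psi v t.
Proof.
move=> tx xT; rewrite leNgt; apply/negP => ptx.
pose f s := psi v s - psi v t.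
have cf : continuous f.
  have cp := psi_continuous lam0 S => s.
  exact: (@continuousB R R R (psi v) (fun=> psi v t) s (cp s) (@cst_continuous R R _ s)).
have f0 : f t <= 0 by rewrite /f subrr.
have f1 : 0 < f x by rewrite /f subr_gt0.
have [s [/andP[ts sx] fs Hs near_s]] := first_pos tx cf f0 f1.
have ps : psi v s = psi v t by move/eqP: fs; rewrite subr_eq0 => /eqP.
have sT : s <= T by rewrite (le_trans (ltW sx)).
have s0 : 0 < s by exact: lt_le_trans ts.
have sT0 : 0 < s <= T by rewrite s0.
have le_t y : t <= y <= s -> psi v y <= psi v t.
  by move=> /Hs; rewrite /f subr_le0.
have const y : t <= y <= s -> psi v y = psi v t.
  move=> /[dup] tys /andP[ty ys]; apply/eqP; rewrite eq_le le_t//=.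
  rewrite -ps; apply: (psi_le lam0).
  by apply: plateau_nonincreasing.
(* For [s] beyond [t] the density is constant on [[t, s]], which a positive flux at [s] would
   contradict. *)
have fs0 : flux v W s <= 0.
  move: ts; rewrite le_eqVlt => /predU1P[<-|ts]; first by rewrite ft.
  rewrite leNgt; apply/negP => fs0.
  have [||e [e0 ea He]] := @derive_gt0_left R v s _ (s - t) (sol_derive S sT0).
  - by rewrite (slope_gt0 g0 S).
  - by rewrite subr_gt0.
  have : v (s - e / 2) < v s by apply: He; apply/andP; split; lra.
  have sesT : s - e / 2 <= T by lra.
  rewrite -(psi_ltP lam0 S)// const ?ps ?ltxx//; apply/andP; split; lra.
have [k [K [k0 kK Hb]]] := sol_bracket S.
have K0 : 0 < K by exact: lt_le_trans kK.
have T0 : 0 < T by exact: lt_le_trans sT.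
pose c1 := k * s; have c10 : 0 < c1 by posit.
have vrange y : s <= y -> y <= T -> c1 <= v y <= K * T.
  move=> sy yT; have y0 : 0 < y by exact: lt_le_trans sy.
  have /andP[h1 h2] := Hb y (introT andP (conj y0 yT)).
  by rewrite (le_trans _ h1) ?(le_trans h2)// ler_pM2l.
have [Cp Cp0 HCp] := @powR_lipschitz R c1 (K * T) lam c10.
pose c2 := c1 `^ lam; have c20 : 0 < c2 by posit.
have prange y : s <= y -> y <= T -> c2 <= psi v y <= (K * T) `^ lam.
  move=> sy yT; have /andP[h1 h2] := vrange y sy yT.
  rewrite (psiE S)//; apply/andP; split; apply: ge0_ler_powR;
    rewrite ?nnegrE//; by [exact: ltW|nonneg|exact: (sol_ge0 S)].
have [L L0 HL] := lip ((K * T) `^ lam).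
pose A := Cp * g * (1 + 2 * L) / c2.
have A0 : 0 < A by posit.
(* The entries bound the gain of [W] by [2 * L * h], keep [s + del] below [x], give the final factor
   1/2, and, if [r] is positive, place all delayed arguments before [s]. *)
pose del := Num.min (Num.min 1 (x - s)) (Num.min (2 * A)^-1
  (if r == 0 then 1 else r)).
have del0 : 0 < del.
  rewrite !lt_min ltr01 subr_gt0 sx invr_gt0/=.
  apply/andP; split; first by posit.
  by case: eqP => // /eqP rn0; rewrite lt_neqAle eq_sym rn0.
have del1 : del <= 1 by rewrite !ge_min lexx.
have delx : del <= x - s by rewrite !ge_min lexx orbT.
have delA : del <= (2 * A)^-1 by rewrite !ge_min lexx !orbT.
have delr : r = 0 \/ del <= r.
  by case: (eqVneq r 0) => [->|rn0]; [left|right; rewrite /del (negbTE rn0) !ge_min lexx !orbT].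
have sdT : s + del <= T by lra.
have sds : s <= s + del by lra.
have [y /andP[sy ysd] Hy] := max_itv sds (psi_continuous lam0 S).
pose h := psi v y - psi v s.
have h0 : 0 < h.
  have [z /andP[sz zd] fz] := near_s del del0.
  rewrite /h subr_gt0 ps; apply: lt_le_trans (Hy z _).
    by move: fz; rewrite /f subr_gt0.
  by rewrite (ltW sz) (ltW zd).
have sy' : s < y.
  by rewrite lt_neqAle sy andbT; apply/eqP => E; move: h0; rewrite /h -E subrr ltxx.
have yT : y <= T by exact: le_trans sdT.
have hle z : s <= z <= y -> psi v z <= psi v s + h.
  move=> /andP[sz zy]; rewrite /h addrC subrK; apply: Hy.
  by rewrite sz (le_trans zy).
have W'le z : s < z < y -> d (psi v z) - b (psi v (z - r)) <= 2 * L * h.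
  move=> /andP[sz zy].
  have szy : s <= z <= y by rewrite !ltW.
  have zT : z <= T by rewrite (le_trans (ltW zy)).
  have /andP[pz0 pzX] := prange z (ltW sz) zT.
  have pz : 0 <= psi v z <= (K * T) `^ lam by rewrite psi_ge0.
  have pz1 : 0 < psi v z by exact: lt_le_trans pz0.
  have pzh := hle z szy.
  have Lh : 0 < L * h by posit.
  (* Without delay, births and deaths are compared at the current density, whose excess over [kappa]
     is at most [h], through [b kappa = d kappa]. With delay, births still come from the controlled
     past. *)
  case: delr => [rE|dr].
    rewrite rE subr0; have [pzk|kpz] := leP (psi v z) kappa.
      have := dleb pz1 pzk; lra.
    have kX : 0 <= kappa <= (K * T) `^ lam.
      by rewrite (ltW kappa_gt0) (le_trans (ltW kpz)).
    have [q1 q2] := HL _ _ pz kX.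
    rewrite (gtr0_norm (_ : 0 < psi v z - kappa)) ?subr_gt0// in q1 q2.
    have q3 : L * (psi v z - kappa) <= L * h by rewrite ler_pM2l//; move: tk pzh; rewrite ps; lra.
    move: q1 q2; rewrite !ler_norml => /andP[_ q1] /andP[q2 _].
    move: dbk; lra.
  have zrs : z - r <= s by lra.
  have hb : d (psi v t) <= b (psi v (z - r)).
    have [zrt|tzr] := leP (z - r) t; first by apply: delayed_b => //; lra.
    by rewrite (const (z - r)) ?dleb// (ltW tzr).
  have hd : d (psi v z) <= d (psi v s) + L * h.
    have [pzs|psz] := leP (psi v z) (psi v s).
      by have := dmono (ltW pz1) pzs; lra.
    have psX : 0 <= psi v s <= (K * T) `^ lam.
      by rewrite psi_ge0; case/andP: (prange s (lexx _) sT) => _ ->.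
    have [q1 _] := HL _ _ pz psX.
    rewrite (gtr0_norm (_ : 0 < psi v z - psi v s)) ?subr_gt0// in q1.
    have q3 : L * (psi v z - psi v s) <= L * h by rewrite ler_pM2l//; lra.
    move: q1; rewrite ler_norml => /andP[_ q1]; lra.
  by move: hb hd; rewrite ps; lra.
have inT z : s < z < y -> 0 < z <= T.
  by move=> /andP[sz zy]; rewrite (lt_trans s0)//= (le_trans (ltW zy)).
have Wle z : s <= z <= y -> W z <= W s + 2 * L * h * del.
  move=> /andP[sz zy].
  have h1 : W z - W s <= 2 * L * h * (z - s).
    apply: (@derive_le R (fun q => W q - W s) (fun q => 2 * L * h * (q - s))
      (fun q => d (psi v q) - b (psi v (q - r))) (fun=> 2 * L * h) s z sz).
    - have cW := sol_cW S => q.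
      exact: (@continuousB R R R W (fun=> W s) q (cW q) (@cst_continuous R R _ q)).
    - apply: continuous_scale => q.
      exact: (@continuousB R R R id (fun=> s) q (fun U h => h) (@cst_continuous R R _ q)).
    - move=> q /andP[sq qz]; have /(sol_dW S) hq : 0 < q <= T.
        by apply: inT; rewrite sq (lt_le_trans qz).
      by apply: is_derive_eq; rewrite subr0.
    - by move=> q _; apply: is_derive_eq; rewrite /GRing.scale/=; ring.
    - by move=> q /andP[sq qz]; apply: W'le; rewrite sq (lt_le_trans qz).
    - by rewrite !subrr mulr0.
  have h2 : 2 * L * h * (z - s) <= 2 * L * h * del.
    by rewrite ler_wpM2l//; [nonneg|lra].
  lra.
have fle z : s <= z <= y -> flux v W z <= h * (1 + 2 * L).
  move=> szy; have q1 := Wle z szy; have q2 := hle z szy.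
  have q3 : 2 * L * h * del <= 2 * L * h by rewrite ler_piMr//; nonneg.
  move: fs0; rewrite /flux; lra.
pose B := g * (h * (1 + 2 * L)) / c2.
have B0 : 0 < B by posit.
have vle : v y - v s <= B * del.
  have q1 : v y - v s <= B * (y - s).
    apply: (@derive_le R (fun q => v q - v s) (fun q => B * (q - s))
      (fun q => g * (flux v W q / psi v q)) (fun=> B) s y sy).
    - have cW := sol_cv S => q.
      exact: (@continuousB R R R v (fun=> v s) q (cW q) (@cst_continuous R R _ q)).
    - apply: continuous_scale => q.
      exact: (@continuousB R R R id (fun=> s) q (fun U h => h) (@cst_continuous R R _ q)).
    - move=> q /inT/(sol_derive S) hq; by apply: is_derive_eq; rewrite subr0.
    - by move=> q _; apply: is_derive_eq; rewrite /GRing.scale/=; ring.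
    - move=> q /[dup] sqy /andP[sq qy]; rewrite /B -mulrA ler_pM2l//.
      have qT : q <= T by rewrite (le_trans (ltW qy)).
      have /andP[pq _] := prange q (ltW sq) qT.
      have pq0 : 0 < psi v q by exact: lt_le_trans pq.
      rewrite ler_pdivrMr//.
      apply: (le_trans (fle q _)); first by rewrite !ltW.
      rewrite [leRHS](_ : _ = h * (1 + 2 * L) * (psi v q / c2)); last by ring.
      by rewrite ler_peMr//; [nonneg|rewrite ler_pdivlMr// mul1r].
    - by rewrite !subrr mulr0.
  by apply: (le_trans q1); rewrite ler_pM2l//; lra.
have vsy : v s <= v y by rewrite -(psi_leP lam0 S)// -subr_ge0 ltW.
have : h <= Cp * (B * del).
  rewrite /h !(psiE S)//; apply: (le_trans (ler_norm _)).
  apply: (le_trans (HCp _ _ (vrange y sy yT) (vrange s (lexx _) sT))).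
  by rewrite ler_pM2l// ger0_norm ?subr_ge0.
have -> : Cp * (B * del) = h * (A * del) by rewrite /A /B; ring.
have : A * del <= 2^-1.
  have : A * del <= A * (2 * A)^-1 by rewrite ler_pM2l.
  by have -> : A * (2 * A)^-1 = 2^-1 by field; rewrite lt0r_neq0.
move=> q1; have : h * (A * del) <= h * 2^-1 by rewrite ler_pM2l.
lra.
Qed.

End Plateau.

(** Densities up to [z1] give births of at most [b kappa = d kappa], too few to balance deaths above
    [kappa]. *)
Lemma critical_above_delayed g T v W t : sol g T v W -> 0 < g -> 0 < t <= T ->
  flux v W t = 0 -> (forall s, 0 < s < t -> 0 < flux v W s) -> kappa < psi v t ->
  z1 < psi v (t - r).
Proof.
move=> S g0 tT ft Ht kt.
have crit := sol_first_critical S tT ft Ht.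
rewrite ltNge; apply/negP => h.
have := bz1 (psi_ge0 lam v _) h; have := dinc (ltW kappa_gt0) kt.
move: bk1 dbk; lra.
Qed.

Lemma shoots_disjoint g : 0 < g -> overshoots g -> undershoots g -> False.
Proof.
move=> g0 [T2 [v2 [W2 [T20 S2 z2T]]]] [T1 [v [W [T10 S1 z1T fT]]]].
have z12 : z1 < z2 by exact: lt_le_trans kz2.
have [T21|T12] := leP T2 T1.
  have [E _] := sol_unique lam0 r0 d0 b0 lip g0 T20 S2 (sol_restrict T21 S1) (lexx T2).
  have zT : z2 < psi v T2 by rewrite /psi -E.
  by have := stay_above S1 g0 T20 T21 (lexx _) zT; lra.
have Eq x : x <= T1 -> v x = v2 x /\ W x = W2 x.
  exact: (sol_unique lam0 r0 d0 b0 lip g0 T10 S1 (sol_restrict (ltW T12) S2)).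
have [Ev EW] := Eq T1 (lexx _).
have {}z1T : psi v2 T1 < z1 by rewrite /psi -Ev.
have {}fT : flux v2 W2 T1 < 0 by move: fT; rewrite /flux /psi Ev EW.
move: v2 W2 S2 z2T z1T fT {Eq Ev EW S1 v W} => v W S z2T z1T fT.
have below x : x <= T1 -> psi v x <= z2.
  move=> xT; have [x0|x0] := leP x 0; first by rewrite (psi_le0 lam0 S)// ltW.
  rewrite leNgt; apply/negP => h.
  have := stay_above S g0 x0 xT (ltW T12) h; lra.
pose f x := z2 - psi v x.
have cf : continuous f.
  have cp := psi_continuous lam0 S => s.
  exact: (@continuousB R R R (fun=> z2) (psi v) s (@cst_continuous R R _ s) (cp s)).
(* The first return to [z2] after [T1]: up to [t2] all densities, in particular the delayed ones,
   are at most [z2]. *)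
have [||t2 [/andP[T1t2 t2T] ft2 Ht2]] := first_nonpos (ltW T12) cf.
- by rewrite /f; lra.
- by rewrite /f; lra.
have below2 x : x <= t2 -> psi v x <= z2.
  move=> xt; have [xT|Tx] := leP x T1; first exact: below.
  move: xt; rewrite le_eqVlt => /predU1P[->|xt]; first by move: ft2; rewrite /f; lra.
  by have := Ht2 x; rewrite (ltW Tx) xt => /(_ isT); rewrite /f; lra.
have pt2 : psi v t2 = z2 by move: ft2; rewrite /f; lra.
pose e := Num.min T1 xs / 2.
have e0 : 0 < e by rewrite divr_gt0// lt_min T10.
have eT1 : e <= T1 by have : Num.min T1 xs <= T1 by [rewrite ge_min lexx]; rewrite /e; lra.
have exs : e <= xs by have : Num.min T1 xs <= xs by [rewrite ge_min lexx orbT]; rewrite /e; move: xs0; lra.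
have fsmall s : 0 < s -> s <= e -> 0 < flux v W s.
  move=> s0 se; apply: (start_flux S g0); last by exact: le_trans exs.
  by rewrite s0 (le_trans se)// (le_trans eT1)// ltW.
have [t [/andP[et tT1] ft Ht]] := first_nonpos eT1 (flux_continuous lam0 S)
  (fsmall e e0 (lexx _)) (ltW fT).
have t0 : 0 < t by exact: lt_trans et.
have {}Ht s : 0 < s < t -> 0 < flux v W s.
  move=> /andP[s0 st]; have [se|es] := leP s e; first exact: fsmall.
  by apply: Ht; rewrite (ltW es).
have tT : 0 < t <= T2 by rewrite t0 (le_trans tT1)// ltW.
have [tk|kt] := leP (psi v t) kappa.
  have h := plateau_le S g0 tT ft Ht tk (le_trans tT1 (ltW T12)) (lexx _).
  by move: (lt_le_trans z2T (le_trans h (le_trans tk kz2))); rewrite ltxx.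
have ztr := critical_above_delayed S g0 tT ft Ht kt.
have tt2 : t <= t2 by rewrite (le_trans tT1)// ltW.
have [q /andP[tq qt2] Hq] := min_itv tt2 (sol_cv S).
have vq : v q <= v T1 by apply: Hq; rewrite tT1 ltW.
have pq : psi v q < z1 by apply: le_lt_trans z1T; exact: psi_le.
have tq' : t < q.
  by rewrite lt_neqAle tq andbT; apply/eqP => E; move: pq z1k; rewrite -E; lra.
have qt2' : q < t2.
  by rewrite lt_neqAle qt2 andbT; apply/eqP => E; move: pq z12; rewrite E; lra.
have tqt : t < q < t2 by rewrite tq'.
have [_] := sol_interior_min g0 S (ltW t0) tqt t2T Hq.
have qT : 0 < q <= T2 by rewrite (lt_trans t0)//= (le_trans qt2).
have pq0 := psi_gt0 S qT.
(* Delayed arguments up to [t] lie on the increasing branch after [t - r], where the density exceeds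
   [z1]; later ones compete with the minimiser [q]. *)
have h1 : psi v q <= psi v (q - r).
  have [qrt|tqr] := leP (q - r) t.
    apply: ltW; apply: (lt_le_trans pq); apply: (le_trans (ltW ztr)).
    apply: (psi_le lam0); have [qr0|qr0] := leP (q - r) 0.
      by rewrite (sol_v0 S qr0) (sol_v0 S)// (le_trans _ qr0)// lerD2r.
    apply: (psi_mono S g0 (ltW qr0)); first by rewrite (le_trans qrt)//; case/andP: tT.
      by rewrite lerD2r.
    by move=> s /andP[s0 sq]; apply/ltW/Ht; rewrite s0 (lt_le_trans sq).
  by apply: (psi_le lam0); apply: Hq; rewrite (ltW tqr)/= (le_trans _ qt2)// gerBl.
have h2 : psi v (q - r) <= z2 by apply: below2; rewrite (le_trans _ qt2)// gerBl.
(* The upper end of the range is [z2], and [b z2 = b z1] still dominates [b (psi v q)], hence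
   [d (psi v q)]. *)
have := bqc (ltW pq0) h1 h2; rewrite -bz ge_min => /orP[h|h].
  have := dltb pq0 (lt_trans pq z1k); lra.
have := dltb pq0 (lt_trans pq z1k); have := bz1 (ltW pq0) (ltW pq); lra.
Qed.

Lemma lip_d X : exists2 L, 0 < L & forall x y, 0 <= x <= X -> 0 <= y <= X ->
  `|d x - d y| <= L * `|x - y|.
Proof. by have [L L0 H] := lip X; exists L => // x y hx hy; case: (H x y hx hy). Qed.

Lemma lip_b X : exists2 L, 0 < L & forall x y, 0 <= x <= X -> 0 <= y <= X ->
  `|b x - b y| <= L * `|x - y|.
Proof. by have [L L0 H] := lip X; exists L => // x y hx hy; case: (H x y hx hy). Qed.

Lemma reaction_gap p q : 0 < p -> p <= q -> q < kappa ->
  exists2 del, 0 < del & forall y, p <= y <= q -> del <= b y - d y.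
Proof.
move=> p0 pq qk.
have mx (x : R) : 0 <= Num.max x 0 by rewrite le_max lexx orbT.
have cb := lipschitz_comp_continuous lip_b (@max0_continuous R) mx.
have cd := lipschitz_comp_continuous lip_d (@max0_continuous R) mx.
have cf : continuous (fun y => b (Num.max y 0) - d (Num.max y 0)).
  by move=> y; apply: continuousB; [exact: cb|exact: cd].
have [y0 /andP[py yq] H] := min_itv pq cf.
have y00 : 0 < y0 by exact: lt_le_trans py.
exists (b y0 - d y0).
  by rewrite subr_gt0; apply: dltb => //; exact: le_lt_trans qk.
move=> y /[dup] /H + /andP[py' _].
by rewrite (max_l (ltW y00)) (max_l (le_trans (ltW p0) py')).
Qed.

(* Integrating the equation along an increasing branch, the delay costs at most
   [r * d z1], while [b - d] is collected on the way. *)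
Lemma flux_upper g T v W X y1 y2 del : sol g T v W -> 0 < g -> 0 < X <= T ->
  (forall s, 0 < s < X -> 0 <= flux v W s) -> psi v X <= z1 ->
  - r <= y1 -> y1 <= y2 -> y2 <= X - r ->
  (forall y, y1 < y < y2 -> del <= b (psi v y) - d (psi v y)) ->
  flux v W X <= z1 + r * d z1 - del * (y2 - y1).
Proof.
move=> S g0 /andP[X0 XT] HX pX ry1 y12 y2X Hdel.
have cp := psi_continuous lam0 S.
have cf : continuous (fun y => d (psi v y)).
  by apply: (lipschitz_comp_continuous lip_d cp) => y; exact: psi_ge0.
(* The start below [- r] gives continuity at [- r], so the shifted primitive is defined and
   continuous from time [0] on. *)
have [F [F0 dF]] := antiderivative (- (r + 1)) cf.
pose D y := F (Num.max y (- r)).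
have cD : continuous D.
  move=> y; apply: (@continuous_comp _ _ _ (fun x : R => Num.max x (- r))).
    exact: (@continuous_max _ R id (fun=> - r) y (fun U h => h) (@cst_continuous R R _ y)).
  apply: differentiable_continuous; apply/derivable1_diffP.
  have h : - (r + 1) < Num.max y (- r) by rewrite lt_max; apply/orP; right; lra.
  by have := dF _ h => ?; exact: ex_derive.
have dD (y : R) : - r < y -> is_derive y 1 D (d (psi v y)).
  move=> ry; apply: (@near_eq_is_derive _ _ _ F).
    near=> z; rewrite /D max_l//; apply: ltW; near: z; exact: lt_nbhsr.
  by apply: dF; lra.
have D0 : D 0 = 0 by rewrite /D max_l// oppr_le0.
have Dr : D (- r) = 0.
  have mr0 : - r <= 0 by rewrite oppr_le0.
  have cDD : continuous (fun y => D y - D (- r)).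
    move=> y; exact: (@continuousB R R R D (fun=> D (- r)) y (cD y) (@cst_continuous R R _ y)).
  have := @derive_norm_le R (fun y => D y - D (- r)) (fun=> 0)
    (fun y => d (psi v y)) (fun=> 0) (- r) 0 mr0 cDD.
  rewrite D0 subrr normr0 sub0r normrN normr_le0 => h.
  apply/eqP/h => //.
  - exact: cst_continuous.
  - by move=> y /andP[ry _]; have := dD y ry => hy; apply: is_derive_eq; rewrite subr0.
  - by move=> y /andP[_ y0]; rewrite (psi_le0 lam0 S (ltW y0)) d0 normr0.
(* Trading deaths at [x] for deaths at [x - r] makes both rates depend on the same density, so [H]
   is non-decreasing below [kappa]. The price [D x - D (x - r)] is the deaths over one delay. *)
pose H x := D x - D (x - r) - W x.
have csub : continuous (fun x : R => x - r).
  by move=> x; exact: (@continuousB R R R id (fun=> r) x (fun U h => h) (@cst_continuous R R _ x)).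
have cDr : continuous (fun x => D (x - r)).
  by move=> x; apply: (@continuous_comp _ _ _ (fun x => x - r)); [exact: csub|exact: cD].
have cW := sol_cW S.
have cH : continuous H.
  move=> x; exact: (@continuousB R R R (fun x => D x - D (x - r)) W x
   (@continuousB R R R D (fun x => D (x - r)) x (cD x) (cDr x)) (cW x)).
have dH (x : R) : 0 < x <= T -> is_derive x 1 H (b (psi v (x - r)) - d (psi v (x - r))).
  move=> /[dup] xT /andP[x0 _].
  have h1 := dD x (le_lt_trans (_ : - r <= 0) x0); rewrite oppr_le0 in h1.
  have {}h1 := h1 r0.
  have h2 : is_derive (x - r) 1 D (d (psi v (x - r))) by apply: dD; rewrite ltrDr.
  have h3 : is_derive x 1 (fun x : R => x - r) 1 by apply: is_derive_eq; rewrite subr0.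
  have h4 := @is_derive1_comp R D (fun x => x - r) x _ _ h2 h3.
  have h5 := sol_dW S xT.
  have -> : H = (D - (D \o (fun x : R => x - r))) - W by apply/funext.
  apply: is_derive_eq; ring.
have inT x : 0 < x -> x <= X -> 0 < x <= T.
  by move=> -> /le_trans ->.
have pX' x : x <= X -> psi v x <= z1.
  move=> xX; apply: le_trans pX; apply: (psi_le lam0).
  exact: (psi_mono S g0 (ltW X0) XT xX HX).
have H'0 x : 0 < x < X -> 0 <= b (psi v (x - r)) - d (psi v (x - r)).
  move=> /andP[x0 xX]; have xr : x - r <= X by rewrite (le_trans _ (ltW xX))// gerBl.
  rewrite subr_ge0; have := psi_ge0 lam v (x - r).
  rewrite le_eqVlt => /predU1P[<-|p0]; first by rewrite d0 b0.
  by apply: dleb => //; exact: le_trans (pX' _ xr) (ltW z1k).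
have H1 : H 0 <= H (y1 + r).
  have y1r : 0 <= y1 + r by lra.
  apply: (derive_ge0_le y1r cH) => x /andP[x0 xy]; first by apply: dH; apply: inT => //; lra.
  by apply: H'0; apply/andP; split; lra.
have H3 : H (y2 + r) <= H X.
  have y2r : y2 + r <= X by lra.
  apply: (derive_ge0_le y2r cH) => x /andP[x0 xy]; first by apply: dH; apply: inT => //; lra.
  by apply: H'0; apply/andP; split; lra.
have H2 : H (y1 + r) + del * (y2 - y1) <= H (y2 + r).
  have y12r : y1 + r <= y2 + r by lra.
  have h : del * (y2 + r - (y1 + r)) <= H (y2 + r) - H (y1 + r).
    apply: (@derive_le R (fun x => del * (x - (y1 + r))) (fun x => H x - H (y1 + r))
      (fun=> del) (fun x => b (psi v (x - r)) - d (psi v (x - r))) _ _ y12r).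
    - apply: continuous_scale => x.
      exact: (@continuousB R R R id (fun=> y1 + r) x (fun U h => h) (@cst_continuous R R _ x)).
    - move=> x; exact: (@continuousB R R R H (fun=> H (y1 + r)) x (cH x) (@cst_continuous R R _ x)).
    - by move=> x _; apply: is_derive_eq; rewrite /GRing.scale/=; ring.
    - move=> x /andP[x0 xy]; have hx : is_derive x 1 H (b (psi v (x - r)) - d (psi v (x - r))).
        by apply: dH; apply: inT; lra.
      by apply: is_derive_eq; rewrite subr0.
    - by move=> x /andP[x0 xy]; apply: Hdel; apply/andP; split; lra.
    - by rewrite !subrr mulr0.
  rewrite (_ : y2 + r - (y1 + r) = y2 - y1) in h; last by ring.
  lra.
have H0 : H 0 = 0 by rewrite /H D0 (sub0r r) Dr (sol_W0 S)// !subr0.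
have DX : D X - D (X - r) <= r * d z1.
  have Xr : X - r <= X by rewrite gerBl.
  have h : D X - D (X - r) <= d z1 * (X - (X - r)).
    apply: (@derive_le R (fun x => D x - D (X - r)) (fun x => d z1 * (x - (X - r)))
      (fun x => d (psi v x)) (fun=> d z1) _ _ Xr).
    - move=> x; exact: (@continuousB R R R D (fun=> D (X - r)) x (cD x) (@cst_continuous R R _ x)).
    - apply: continuous_scale => x.
      exact: (@continuousB R R R id (fun=> X - r) x (fun U h => h) (@cst_continuous R R _ x)).
    - move=> x /andP[x0 xy]; have hx : is_derive x 1 D (d (psi v x)) by apply: dD; lra.
      by apply: is_derive_eq; rewrite subr0.
    - by move=> x _; apply: is_derive_eq; rewrite /GRing.scale/=; ring.
    - by move=> x /andP[_ xX]; apply: dmono; [exact: psi_ge0|exact/pX'/ltW].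
    - by rewrite !subrr mulr0.
  by rewrite (_ : X - (X - r) = r) ?[d z1 * r]mulrC// in h; ring.
have HXE : W X = D X - D (X - r) - H X by rewrite /H; ring.
rewrite /flux HXE; lra.
Unshelve. all: by end_near. Qed.

(** * Speeds that do not undershoot *)

Section NoUndershoot.
Variables (g : R).
Hypotheses (g0 : 0 < g) (nu : ~ undershoots g).

Lemma nonneg_flux T v W x : sol g T v W -> 0 < x <= T -> psi v x < z1 ->
  0 <= flux v W x.
Proof.
move=> S /andP[x0 xT] px; rewrite leNgt; apply/negP => fx; apply: nu.
by exists x, v, W; split=> //; exact: sol_restrict S.
Qed.

(** If the density had reached [z1] before [x], then from the last such time on it would be below
    [z1], the flux non-negative and [v] non-decreasing, so it could not be below [z1] at [x]. *)
Lemma increasing_below T v W x y : sol g T v W -> 0 <= y -> y <= x -> x <= T ->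
  psi v x < z1 -> v y <= v x.
Proof.
move=> S y0 yx xT px.
have cp := psi_continuous lam0 S.
pose f s := z1 - psi v s.
have cf : continuous f.
  by move=> s; exact: (@continuousB R R R (fun=> z1) (psi v) s (@cst_continuous R R _ s) (cp s)).
have fx : 0 < f x by rewrite subr_gt0.
have key s : y <= s -> s <= x -> (forall q, s < q <= x -> psi v q < z1) -> v s <= v x.
  move=> ys sx Hs; apply: (sol_le_of_flux g0 S (le_trans y0 ys) sx xT) => q /andP[sq qx].
  apply: (nonneg_flux S); last by apply: Hs; rewrite sq ltW.
  by rewrite (le_lt_trans (le_trans y0 ys) sq)/= (le_trans (ltW qx)).
have [H|] := pselect (forall q, y < q <= x -> psi v q < z1); first exact: key.
move=> /existsNP[q /not_implyP[/andP[yq qx] /negP]]; rewrite -leNgt => zq.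
have fq : f q <= 0 by rewrite subr_le0.
have [s [/andP[qs sx] fs Hs]] := last_nonpos qx cf fq fx.
have : v s <= v x.
  apply: key; [by rewrite (le_trans (ltW yq))|exact: ltW|].
  by move=> p /Hs; rewrite subr_gt0.
move=> /(psi_le lam0); move: fs => /eqP; rewrite subr_eq0 => /eqP <-.
by rewrite leNgt px.
Qed.

Lemma nonneg_flux_below T v W x s : sol g T v W -> 0 < s -> s <= x -> x <= T ->
  psi v x < z1 -> 0 <= flux v W s.
Proof.
move=> S s0 sx xT px; apply: (nonneg_flux S); first by rewrite s0 (le_trans sx).
apply: le_lt_trans (px); apply: (psi_le lam0).
exact: (increasing_below S (ltW s0) sx xT px).
Qed.

(** Feeds the continuation argument: a density below [z1] has only increased since [xs], where the
    start provides [g / 2 * xs]. *)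
Lemma lower_bound_late T v W x : sol g T v W -> xs <= x -> x <= T ->
  Num.min (g / 2 * xs) Z1 <= v x.
Proof.
move=> S xsx xT; rewrite ge_min; have [px|px] := ltP (psi v x) z1.
  have xsT : xs <= T by exact: le_trans xT.
  apply/orP; left; apply: (le_trans (start_lower S g0 (_ : 0 < xs <= T) (lexx _))).
    by rewrite xs0.
  exact: increasing_below S (ltW xs0) xsx xT px.
by apply/orP; right; rewrite leNgt -(psi_lt_level S (ltW z1_gt0) xT) -leNgt.
Qed.

End NoUndershoot.

(** Continuation without restarting: the clamped solution exists on all of [[0, T]]. Until it first
    touches a widened bracket it solves the true equation, and the a priori bounds then place it
    strictly inside; so it never touches. *)
Lemma sol_extend g T l : 0 < g -> ~ overshoots g -> 0 < T -> 0 < l ->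
  (forall T' v W, 0 < T' -> T' <= T -> sol g T' v W ->
    forall x, xs <= x -> x <= T' -> l <= v x) ->
  exists v W, sol g T v W.
Proof.
move=> g0 no T0 l0 Hl.
have below T' v W : T' <= T -> sol g T' v W -> forall x, 0 < x <= T' -> psi v x <= z2.
  move=> T'T S x /andP[x0 xT]; rewrite leNgt; apply/negP => h; apply: no.
  by exists x, v, W; split=> //; exact: sol_restrict S.
have [Ld Ld0 HLd] := start_upper.
(* Up to [xs] the bracket comes from the starting bounds with slopes [g / 2] and
   [g * (1 + Ld * xs)]; afterwards the constant bounds [l] and [Z2] are written as lines through the
   origin. *)
pose k1 := Num.min (g / 2) (l / T).
have k10 : 0 < k1 by rewrite lt_min !divr_gt0.
pose K1 := g * (1 + Ld * xs) + Z2 / xs.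
have Z20 : 0 < Z2 by exact: powR_gt0.
have K1g : g < K1.
  have : 0 < g * (Ld * xs) by posit.
  have : 0 < Z2 / xs by posit.
  rewrite /K1; lra.
have k1g : k1 <= g / 2 by rewrite ge_min lexx.
pose k := k1 / 2; pose K := 2 * K1.
have k0 : 0 < k by posit.
have kK : k <= K by rewrite /k /K; lra.
have apriori T' v W : 0 < T' -> T' <= T -> sol g T' v W -> k1 * T' <= v T' <= K1 * T'.
  move=> T'0 T'T S; have TT : 0 < T' <= T' by rewrite T'0 lexx.
  have [Txs|xsT] := leP T' xs.
    apply/andP; split.
      by apply: le_trans (start_lower S g0 TT Txs); rewrite ler_pM2r.
    apply: (le_trans (HLd _ _ _ _ S g0 (below _ _ _ T'T S) T' TT Txs)).
    by rewrite ler_pM2r// lerDl; nonneg.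
  apply/andP; split.
    apply: (@le_trans _ _ (l / T * T')).
      by rewrite ler_pM2r// ge_min lexx orbT.
    apply: (@le_trans _ _ l); last exact: (Hl _ _ _ T'0 T'T S _ (ltW xsT)).
    by rewrite mulrAC ler_pdivrMr// ler_pM2l.
  apply: (@le_trans _ _ Z2).
    by rewrite leNgt -(psi_gt_level S (ltW z2_gt0) (lexx _)) -leNgt (below _ _ _ T'T S).
  apply: (@le_trans _ _ (Z2 / xs * T')).
    by rewrite mulrAC ler_pdivlMr// ler_pM2l// ltW.
  by rewrite ler_pM2r// lerDr; nonneg.
have [v [W S]] := step_fixpoint lam0 r0 d0 b0 lip k0 kK T0 g0.
exists v, W.
have [C C0 HC] := step_quot_bound lam0 r0 d0 b0 lip k0 kK (ltW T0).
(* Up to [e] the quotient is at most 1/4, so [v] stays within a quarter of g x, strictly inside the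
   slopes [k] and [K]. *)
pose e := Num.min T (4 * C)^-1.
have e0 : 0 < e by rewrite lt_min T0 invr_gt0; posit.
have eT : e <= T by rewrite ge_min lexx.
have small x : 0 < x -> x <= e -> 3 / 4 * g * x <= v x <= 5 / 4 * g * x.
  move=> x0 xe.
  have := @derive_norm_le R (fun s => v s - g * s) (fun s => g / 4 * s)
     (fun s => g * (1 + W s / dens lam k K v s) - g) (fun=> g / 4) 0 x (ltW x0).
  move=> h; have : `|v x - g * x| <= g / 4 * x.
    apply: h.
    - have cv := step_cv S => s.
      exact: (@continuousB R R R v (fun s => g * s) s (cv s) (@mulrl_continuous R g s)).
    - exact: mulrl_continuous.
    - move=> s /andP[s0 sx]; have sT : 0 < s <= T.
        by rewrite s0 (le_trans (ltW sx))// (le_trans xe).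
      have h1 := step_dv S sT.
      have h2 : is_derive s 1 (fun s : R => g * s) g.
        by apply: is_derive_eq; rewrite /GRing.scale/=; ring.
      exact: is_deriveB.
    - by move=> s _; apply: is_derive_eq; rewrite /GRing.scale/=; ring.
    - move=> s /andP[s0 sx]; have sT : 0 < s <= T.
        by rewrite s0 (le_trans (ltW sx))// (le_trans xe).
      rewrite [X in `|X|](_ : _ = g * (W s / dens lam k K v s)); last by ring.
      rewrite normrM (gtr0_norm g0) ler_pM2l//.
      apply: (le_trans (HC _ _ _ _ S s sT)).
      apply: (@le_trans _ _ (C * (4 * C)^-1)).
        by rewrite ler_pM2l// (le_trans (ltW sx))// (le_trans xe)// ge_min lexx orbT.
      rewrite le_eqVlt; apply/orP; left; apply/eqP; field; exact: lt0r_neq0.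
    - by rewrite (step_v0 S)// !mulr0 subrr normr0.
  by rewrite ler_norml => /andP[? ?]; apply/andP; split; lra.
(* The distance to the nearer edge of the bracket, whose first zero is the first touching time. *)
pose f x := Num.min (v x - k * x) (K * x - v x).
have cf : continuous f.
  have cv := step_cv S => x.
  exact: (continuous_min
    (@continuousB R R R v (fun s => k * s) x (cv x) (@mulrl_continuous R k x))
    (@continuousB R R R (fun s => K * s) v x (@mulrl_continuous R K x) (cv x))).
have fE x : 0 < f x -> k * x <= v x <= K * x.
  by rewrite lt_min !subr_gt0 => /andP[h1 h2]; rewrite !ltW.
have fsmall x : 0 < x -> x <= e -> 0 < f x.
  move=> x0 xe; have /andP[h1 h2] := small x x0 xe.
  have h3 : k * x <= g / 4 * x by rewrite ler_pM2r// /k; lra.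
  have h4 : 2 * g * x <= K * x by rewrite ler_pM2r// /K; lra.
  have h5 : 0 < g * x by posit.
  rewrite lt_min !subr_gt0; apply/andP; split; lra.
have fpos x : 0 < x -> x <= T -> 0 < f x.
  move=> x0 xT; rewrite ltNge; apply/negP => fx.
  have ex : e <= x.
    by rewrite leNgt; apply/negP => xe; have := fsmall x x0 (ltW xe); rewrite ltNge fx.
  have [t [/andP[et tx] ft Ht]] := first_nonpos ex cf (fsmall e e0 (lexx _)) fx.
  have t0 : 0 < t by exact: lt_trans et.
  have tT : t <= T by exact: le_trans xT.
  have brk s : 0 < s <= t -> k * s <= v s <= K * s.
    move=> /andP[s0]; rewrite le_eqVlt => /predU1P[->|st].
      have : 0 <= f t by rewrite ft.
      by rewrite le_min !subr_ge0.
    apply: fE; have [se|es] := leP s e; first exact: fsmall.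
    by apply: Ht; rewrite (ltW es).
  have S' : sol g t v W.
    apply: (step_sol lam0 r0 k0 kK _ brk).
    by case: S => a1 a2 a3 a4 a5 a6 a7; split=> // y /andP[y0 yt];
      [apply: a6|apply: a7]; rewrite y0 (le_trans yt).
  have /andP[h1 h2] := apriori _ _ _ t0 tT S'.
  have h3 : k * t < k1 * t by rewrite ltr_pM2r// /k; lra.
  have h4 : K1 * t < K * t by rewrite ltr_pM2r// /K; lra.
  have : 0 < f t by rewrite lt_min !subr_gt0; apply/andP; split; lra.
  by rewrite ft ltxx.
apply: (step_sol lam0 r0 k0 kK S) => x /andP[x0 xT].
exact/fE/fpos.
Qed.

Lemma overshoots_exists : exists2 g, 0 < g & overshoots g.
Proof.
have Z20 : 0 < Z2 by exact: powR_gt0.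
(* With this value [start_lower] alone yields v(xs) >= 2 Z2; a solution that does not overshoot
   would extend to [xs] and contradict it. *)
pose g := 4 * (Z2 / xs).
have g0 : 0 < g by posit.
exists g => //; apply: contrapT => no.
have l0 : 0 < g / 2 * xs by posit.
have [v [W S]] : exists v W, sol g xs v W.
  apply: (sol_extend g0 no xs0 l0) => T' v W T'0 T'xs S x xsx xT.
  have xE : x = xs by apply/eqP; rewrite eq_le xsx (le_trans xT).
  rewrite xE in xT *; apply: (start_lower S g0) => //.
  by rewrite xs0.
apply: no; exists xs, v, W; split=> //.
rewrite (psi_gt_level S (ltW z2_gt0) (lexx _)) -/Z2.
have xsxs : 0 < xs <= xs by rewrite xs0 lexx.
apply: lt_le_trans (start_lower S g0 xsxs (lexx _)).
rewrite /g (_ : _ * xs = 2 * Z2); first lra.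
by field; exact: lt0r_neq0.
Qed.

(** The cap that [flux_upper] puts on the flux below [z1] when nothing is collected. *)
Let K1 : R := z1 + r * d z1.
Let K10 : 0 < K1.
Proof. by rewrite ltr_wpDr// mulr_ge0// d_ge0// ltW. Qed.

(* With [g] small the density climbs slowly from [z1/2] to [3 z1/4], collecting
   more of [b - d] than the flux can bear. *)
Lemma undershoots_exists : exists2 g, 0 < g & undershoots g.
Proof.
have za : 0 < z1 / 2 by posit.
have zab : z1 / 2 <= 3 / 4 * z1 by move: z1_gt0; lra.
have zbk : 3 / 4 * z1 < kappa by move: z1_gt0 z1k; lra.
have zb1 : 3 / 4 * z1 < z1 by move: z1_gt0; lra.
have zb0 : 0 < 3 / 4 * z1 by posit.
have [del del0 Hdel] := reaction_gap za zab zbk.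
pose Va := (z1 / 2) `^ lam^-1; pose Vb := (3 / 4 * z1) `^ lam^-1.
have Vab : Va < Vb.
  apply: gt0_ltr_powR; rewrite ?invr_gt0 ?nnegrE//; [exact: ltW|exact: ltW|].
  by move: z1_gt0; lra.
(* The climb must last one delay plus the time [K1 / del + 1] that exhausts the cap [K1]. As v' is
   at most [g * (2 * K1 / z1)] there, the [g] below makes it last at least [A]. *)
pose A := r + K1 / del + 1.
have K1d : 0 < K1 / del by exact: divr_gt0.
have A0 : 0 < A by rewrite /A; move: r0 K1d; lra.
pose g := (Vb - Va) * z1 / (2 * K1 * A).
have g0 : 0 < g.
  by rewrite divr_gt0 ?mulr_gt0 ?subr_gt0.
exists g => //; apply: contrapT => nu.
have low T v W x : sol g T v W -> 0 < x <= T -> psi v x < 3 / 4 * z1.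
  move=> S /andP[x0 xT]; rewrite ltNge; apply/negP => px.
  have cp := psi_continuous lam0 S.
  have lev z : 0 < z -> continuous (fun s => z - psi v s).
    by move=> _ s; exact: (@continuousB R R R (fun=> z) (psi v) s (@cst_continuous R R _ s) (cp s)).
  have p0 : psi v 0 = 0 by rewrite (psi_le0 lam0 S).
  have f0 z : 0 < z -> 0 < z - psi v 0 by rewrite p0 subr0.
  have fx : 3 / 4 * z1 - psi v x <= 0 by rewrite subr_le0.
  have [X [/andP[X0 Xx] fX HX]] := first_nonpos (ltW x0) (lev _ zb0) (f0 _ zb0) fx.
  have pX : psi v X = 3 / 4 * z1 by move/eqP: fX; rewrite subr_eq0 => /eqP.
  have fX' : z1 / 2 - psi v X <= 0 by rewrite pX subr_le0.
  have [y [/andP[y0 yX] fy Hy]] := first_nonpos (ltW X0) (lev _ za) (f0 _ za) fX'.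
  have py : psi v y = z1 / 2 by move/eqP: fy; rewrite subr_eq0 => /eqP.
  have XT : X <= T by exact: le_trans xT.
  have pXz : psi v X < z1 by rewrite pX.
  have XT0 : 0 < X <= T by rewrite X0.
  have fl s : 0 < s -> s <= X -> 0 <= flux v W s.
    by move=> s0 sX; apply: (nonneg_flux_below g0 nu S s0 sX XT pXz).
  have mono s q : 0 <= s -> s <= q -> q <= X -> v s <= v q.
    move=> s0 sq qX; apply: (sol_le_of_flux g0 S s0 sq (le_trans qX XT)) => p /andP[sp pq].
    by apply: fl; [exact: le_lt_trans sp|exact: le_trans (ltW pq) qX].
  have pup s : y <= s -> s <= X -> z1 / 2 <= psi v s <= 3 / 4 * z1.
    move=> ys sX; rewrite -pX -{1}py; apply/andP; split; apply: (psi_le lam0).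
      by apply: mono => //; exact: ltW.
    by apply: mono => //; exact: le_trans (ltW y0) ys.
  have flK s : 0 < s -> s <= X -> flux v W s <= K1.
    move=> s0 sX; have sT : 0 < s <= T by rewrite s0 (le_trans sX).
    have h1 : psi v s <= z1.
      apply: (le_trans _ (ltW pXz)); apply: (psi_le lam0); apply: mono => //; exact: ltW.
    have h2 q : 0 < q < s -> 0 <= flux v W q.
      by move=> /andP[q0 qs]; apply: fl => //; exact: le_trans (ltW qs) sX.
    have h3 : - r <= s - r by rewrite lerDr ltW.
    have := flux_upper S g0 sT h2 h1 h3 (lexx _) (lexx _) (del := 0) _.
    rewrite mul0r subr0; apply => q /andP[q1 q2].
    by have := lt_trans q1 q2; rewrite ltxx.
  have vy : v y = Va.
    rewrite /Va -py (psiE S (le_trans yX XT)) -powRrM mulfV ?lt0r_neq0//.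
    by rewrite powRr1//; apply: (sol_ge0 S); exact: le_trans XT.
  have vX : v X = Vb.
    rewrite /Vb -pX (psiE S XT) -powRrM mulfV ?lt0r_neq0//.
    by rewrite powRr1//; exact: (sol_ge0 S).
  have time : Vb - Va <= g * (2 * K1 / z1) * (X - y).
    rewrite -vX -vy.
    apply: (@derive_le R (fun s => v s - v y) (fun s => g * (2 * K1 / z1) * (s - y))
      (fun s => g * (flux v W s / psi v s)) (fun=> g * (2 * K1 / z1)) y X yX).
    - have cv := sol_cv S => s.
      exact: (@continuousB R R R v (fun=> v y) s (cv s) (@cst_continuous R R _ s)).
    - apply: continuous_scale => s.
      exact: (@continuousB R R R id (fun=> y) s (fun U h => h) (@cst_continuous R R _ s)).
    - move=> s /andP[ys sX]; have hs := sol_derive S (_ : 0 < s <= T).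
      have sT : 0 < s <= T by rewrite (lt_trans y0)//= (le_trans (ltW sX)).
      have {}hs := hs sT; by apply: is_derive_eq; rewrite subr0.
    - by move=> s _; apply: is_derive_eq; rewrite /GRing.scale/=; ring.
    - move=> s /andP[ys sX]; rewrite ler_pM2l//.
      have /andP[h1 _] := pup s (ltW ys) (ltW sX).
      have ps0 : 0 < psi v s by exact: lt_le_trans h1.
      rewrite ler_pdivrMr//.
      apply: (le_trans (flK s (lt_trans y0 ys) (ltW sX))).
      apply: (@le_trans _ _ (2 * K1 / z1 * (z1 / 2))).
        rewrite le_eqVlt; apply/orP; left; apply/eqP; field; exact: lt0r_neq0.
      by rewrite ler_wpM2l//; nonneg.
    - by rewrite !subrr mulr0.
  have AXy : A <= X - y.
    have gA : g * (2 * K1 / z1) * A = Vb - Va.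
      by rewrite /g; field; rewrite !lt0r_neq0.
    by move: time; rewrite -gA ler_pM2l//; posit.
  have y1 : - r <= y by rewrite (le_trans _ (ltW y0))// oppr_le0.
  have y2 : y <= X - r by move: AXy; rewrite /A; lra.
  have h2 q : 0 < q < X -> 0 <= flux v W q.
    by move=> /andP[q0 qs]; apply: fl => //; exact: ltW.
  have := flux_upper S g0 XT0 h2 (ltW pXz) y1 y2 (lexx _) (del := del) _.
  have : 0 <= flux v W X by apply: fl.
  move=> h3 h4.
  have : flux v W X <= K1 - del * (X - r - y).
    apply: h4 => q /andP[yq qX]; apply: Hdel; apply: pup; first exact: ltW.
    by rewrite (le_trans (ltW qX))// gerBl.
  have : del * (K1 / del + 1) <= del * (X - r - y).
    by rewrite ler_pM2l//; move: AXy; rewrite /A; lra.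
  have -> : del * (K1 / del + 1) = K1 + del by field; exact: lt0r_neq0.
  lra.
have no : ~ overshoots g.
  move=> [T [v [W [T0 S zT]]]].
  have := low T v W T S; rewrite T0 lexx => /(_ isT) h.
  have := lt_trans zT h; move: z1k kz2 zb1; lra.
have l0 : 0 < Num.min (g / 2 * xs) Z1.
  rewrite lt_min; apply/andP; split; first by posit.
  exact: powR_gt0.
have pp : 0 < (g / 2 * xs) `^ lam by apply: powR_gt0; posit.
(* The density never reaches 3 z1 / 4. Either the starting bound at [xs] already violates this, or
   the density is confined between two levels where [b - d >= del2], and a long enough stay makes
   the flux negative. *)
have [big|small] := ltP (3 / 4 * z1) ((g / 2 * xs) `^ lam).
  have [v [W S]] : exists v W, sol g xs v W.
    apply: (sol_extend g0 no xs0 l0) => T' v W _ _ S x xsx xT.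
    exact: (lower_bound_late g0 nu S xsx xT).
  have xsxs : 0 < xs <= xs by rewrite xs0 lexx.
  have := low _ _ _ _ S xsxs; rewrite (psiE S (lexx _)).
  apply/negP; rewrite -leNgt; apply: (le_trans (ltW big)).
  apply: ge0_ler_powR; [exact: ltW|by rewrite nnegrE; nonneg| |].
    by rewrite nnegrE (sol_ge0 S).
  exact: (start_lower S g0 xsxs).
have [del2 del20 Hdel2] := reaction_gap pp small zbk.
pose T := xs + r + (K1 / del2 + 1).
have K1d2 : 0 < K1 / del2 by exact: divr_gt0.
have T0 : 0 < T by rewrite /T; move: xs0 r0; lra.
have xsT : xs <= T by rewrite /T; move: r0; lra.
have [v [W S]] : exists v W, sol g T v W.
  apply: (sol_extend g0 no T0 l0) => T' v W _ _ S x xsx xT.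
  exact: (lower_bound_late g0 nu S xsx xT).
have TT : 0 < T <= T by rewrite T0 lexx.
have pT : psi v T < z1 by apply: lt_trans (low _ _ _ _ S TT) zb1.
have fl s : 0 < s -> s <= T -> 0 <= flux v W s.
  by move=> s0 sT; exact: (nonneg_flux_below g0 nu S s0 sT (lexx _) pT).
have h2 q : 0 < q < T -> 0 <= flux v W q.
  by move=> /andP[q0 qs]; apply: fl => //; exact: ltW.
have y1 : - r <= xs by rewrite (le_trans _ (ltW xs0))// oppr_le0.
have y2 : xs <= T - r by rewrite /T; lra.
have := flux_upper S g0 TT h2 (ltW pT) y1 y2 (lexx _) (del := del2) _.
have h3 := fl T T0 (lexx _).
move=> h4; have : flux v W T <= K1 - del2 * (T - r - xs).
  apply: h4 => q /andP[xq qT]; apply: Hdel2.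
  have qT' : q <= T by rewrite (le_trans (ltW qT))// gerBl.
  have q0 : 0 < q by exact: lt_trans xq.
  apply/andP; split; last first.
    by apply/ltW/(low _ _ _ _ S); rewrite q0.
  rewrite (psiE S qT'); apply: ge0_ler_powR; [exact: ltW|by rewrite nnegrE; nonneg| |].
    by rewrite nnegrE (sol_ge0 S).
  apply: (le_trans (start_lower S g0 (_ : 0 < xs <= T) (lexx _))); first by rewrite xs0.
  apply: (increasing_below g0 nu S (ltW xs0) (ltW xq) qT').
  by apply: lt_trans (low _ _ _ _ S _) zb1; rewrite q0.
have -> : del2 * (T - r - xs) = K1 + del2 by rewrite /T; field; exact: lt0r_neq0.
lra.
Qed.

(** At the supremum of the points of [P], openness of [P] would push past it and openness of [Q]
    would reach back to a point of [P]. *)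
Lemma open_split (P Q : R -> Prop) x y : 0 < x -> x < y -> P x -> Q y ->
  (forall s, 0 < s -> P s -> Q s -> False) ->
  (forall s, 0 < s -> P s -> exists2 e, 0 < e & forall s', 0 < s' -> `|s - s'| < e -> P s') ->
  (forall s, 0 < s -> Q s -> exists2 e, 0 < e & forall s', 0 < s' -> `|s - s'| < e -> Q s') ->
  exists2 s, 0 < s & ~ P s /\ ~ Q s.
Proof.
move=> x0 xy Px Qy PQ Po Qo.
pose A := [set z | x <= z <= y /\ P z].
have Ax : A x by split=> //; rewrite lexx ltW.
have uA : ubound A y by move=> z [/andP[]].
have sA : has_sup A by split; [exists x|exists y].
pose s := sup A.
have xs' : x <= s by apply: ub_le_sup => //; exists y.
have sy : s <= y by apply: ge_sup => //; exists x.
have s0 : 0 < s by exact: lt_le_trans xs'.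
exists s => //; split.
  move=> Ps; have sy' : s < y.
    rewrite lt_neqAle sy andbT; apply/eqP => E; apply: (PQ y) => //.
      exact: lt_trans xy.
    by rewrite -E.
  have [e e0 He] := Po s s0 Ps.
  pose z := Num.min y (s + e / 2).
  have sz : s < z by rewrite lt_min sy' ltrDl divr_gt0.
  have zy : z <= y by rewrite ge_min lexx.
  have : z <= s.
    apply: ub_le_sup; first by exists y.
    split; first by rewrite zy (le_trans xs' (ltW sz)).
    apply: He; first exact: lt_trans sz.
    rewrite distrC gtr0_norm ?subr_gt0//.
    have : z <= s + e / 2 by rewrite ge_min lexx orbT.
    lra.
  by rewrite leNgt sz.
move=> Qs; have [e e0 He] := Qo s s0 Qs.
have [z Az sz] := sup_adherent e0 sA.
have zs : z <= s by apply: ub_le_sup => //; exists y.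
case: Az => /andP[xz _] Pz.
have z0 : 0 < z by exact: lt_le_trans xz.
apply: (PQ z z0 Pz); apply: He => //.
by rewrite ger0_norm ?subr_ge0//; move: sz; rewrite -/s; lra.
Qed.

Lemma critical_speed_exists : exists2 g, 0 < g & ~ overshoots g /\ ~ undershoots g.
Proof.
have [ga ga0 Ha] := overshoots_exists.
have [gb gb0 Hb] := undershoots_exists.
have dj g (g0 : 0 < g) := shoots_disjoint g0.
have [ab|ba|E] := ltgtP ga gb.
- exact: (open_split ga0 ab Ha Hb dj overshoots_open undershoots_open).
- have [|g g0 [h1 h2]] := open_split gb0 ba Hb Ha _ undershoots_open overshoots_open.
    by move=> s s0 us os; exact: (dj s s0 os us).
  by exists g.
- by exfalso; apply: (dj ga ga0 Ha); rewrite E.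
Qed.

Lemma global_sol g : 0 < g -> ~ overshoots g -> ~ undershoots g ->
  exists v W, forall T, 0 < T -> sol g T v W.
Proof.
move=> g0 no nu.
have l0 : 0 < Num.min (g / 2 * xs) Z1.
  rewrite lt_min; apply/andP; split; first by posit.
  exact: powR_gt0.
have /choice[S HS] T : exists vW : (R -> R) * (R -> R), 0 < T -> sol g T vW.1 vW.2.
  have [T0|T0] := ltP 0 T; last by exists (id, id).
  have [v [W S]] : exists v W, sol g T v W.
    apply: (sol_extend g0 no T0 l0) => T' v W _ _ S x xsx xT.
    exact: (lower_bound_late g0 nu S xsx xT).
  by exists (v, W).
(* The horizon lies strictly beyond [x], so near [x] a single local solution represents [v] and [W],
   and continuity and derivatives transfer. *)
pose v x := (S (`|x| + 1)).1 x; pose W x := (S (`|x| + 1)).2 x.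
have pos (x : R) : 0 < `|x| + 1 by exact: ltr_wpDl.
have agree T x : 0 < T -> x <= T -> v x = (S T).1 x /\ W x = (S T).2 x.
  move=> T0 xT; pose T' := Num.min T (`|x| + 1).
  have T'0 : 0 < T' by rewrite lt_min T0 pos.
  have S1 : sol g T' (S T).1 (S T).2.
    by apply: sol_restrict (HS T T0); rewrite ge_min lexx.
  have S2 : sol g T' (S (`|x| + 1)).1 (S (`|x| + 1)).2.
    by apply: sol_restrict (HS _ (pos x)); rewrite ge_min lexx orbT.
  have xT' : x <= T' by rewrite le_min xT ler_wpDr// ler_norm.
  exact: (sol_unique lam0 r0 d0 b0 lip g0 T'0 S2 S1 xT').
have near_agree x : \forall y \near x, (S (`|x| + 1)).1 y = v y /\ (S (`|x| + 1)).2 y = W y.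
  near=> y; have yx : y <= `|x| + 1.
    apply: ltW; near: y; apply: lt_nbhsl.
    by rewrite (le_lt_trans (ler_norm x))// ltrDl.
  by have [-> ->] := agree _ _ (pos x) yx.
exists v, W => T T0.
have psiv x T' : 0 < T' -> x <= T' -> psi v x = psi (S T').1 x.
  by move=> T'0 xT; rewrite /psi (agree _ _ T'0 xT).1.
split.
- move=> x; have cv := sol_cv (HS _ (pos x)).
  apply: (@cvg_trans _ ((S (`|x| + 1)).1 y @[y --> x])).
    by apply: near_eq_cvg; apply: filterS (near_agree x) => y [].
  exact: cv.
- move=> x; have cv := sol_cW (HS _ (pos x)).
  apply: (@cvg_trans _ ((S (`|x| + 1)).2 y @[y --> x])).
    by apply: near_eq_cvg; apply: filterS (near_agree x) => y [].
  exact: cv.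
- by move=> x x0; exact: sol_v0 (HS _ (pos x)) x x0.
- by move=> x x0; exact: sol_W0 (HS _ (pos x)) x x0.
- move=> x /andP[x0 _]; have xx : 0 < x <= `|x| + 1.
    by rewrite x0 ler_wpDr// ler_norm.
  have xx' : x <= `|x| + 1 by case/andP: xx.
  rewrite (psiv _ _ (pos x) xx').
  apply: (near_eq_is_derive _ (sol_dv (HS _ (pos x)) xx)).
  by apply: filterS (near_agree x) => y [].
- move=> x /andP[x0 _]; have xx : 0 < x <= `|x| + 1.
    by rewrite x0 ler_wpDr// ler_norm.
  have xx' : x <= `|x| + 1 by case/andP: xx.
  have xr' : x - r <= `|x| + 1 by rewrite (le_trans _ xx')// gerBl.
  rewrite (psiv _ _ (pos x) xx') (psiv _ _ (pos x) xr').
  apply: (near_eq_is_derive _ (sol_dW (HS _ (pos x)) xx)).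
  by apply: filterS (near_agree x) => y [].
- have [k [K [k0 kK H]]] := sol_bracket (HS _ T0).
  exists k, K; split=> // x /[dup] xT /andP[_ xT'].
  by rewrite (agree _ _ T0 xT').1; exact: H.
Unshelve. all: by end_near. Qed.

(** * The global solution at a critical speed *)

Section Global.
Variables (g : R) (v W : R -> R).
Hypotheses (g0 : 0 < g) (no : ~ overshoots g) (nu : ~ undershoots g).
Hypothesis S : forall T, 0 < T -> sol g T v W.

Lemma global_le x : psi v x <= z2.
Proof.
have [x0|x0] := leP x 0.
  by rewrite (psi_le0 lam0 (S ltr01) x0) ltW.
by rewrite leNgt; apply/negP => h; apply: no; exists x, v, W; split=> //; exact: S.
Qed.

Lemma global_flux_below x s : 0 < s -> s <= x -> psi v x < z1 -> 0 <= flux v W s.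
Proof.
move=> s0 sx; have x0 : 0 < x by exact: lt_le_trans sx.
exact: (nonneg_flux_below g0 nu (S x0) s0 sx (lexx x)).
Qed.

Lemma global_increasing_below x y : 0 <= y -> y <= x -> psi v x < z1 -> v y <= v x.
Proof.
move=> y0 yx px; have [x0|x0] := leP x 0.
  by rewrite (_ : y = x)//; apply/eqP; rewrite eq_le yx (le_trans x0).
exact: (increasing_below g0 nu (S x0) y0 yx (lexx x) px).
Qed.

Lemma global_psi_gt0 x : 0 < x -> 0 < psi v x.
Proof. by move=> x0; have := psi_gt0 (S x0) (x := x); rewrite x0 lexx; apply. Qed.

(** Once reached, [z1] is never lost, by [global_increasing_below]. If it were never reached, the
    density would increase within a range where [b - d] has a positive minimum, and [flux_upper]
    would make the flux negative. *)
Lemma global_eventually : exists2 X, 0 < X & forall x, X <= x -> z1 <= psi v x.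
Proof.
have [[X X0 pX]|H] := pselect (exists2 X, 0 < X & z1 <= psi v X).
  exists X => // x Xx; rewrite leNgt; apply/negP => px.
  have := psi_le lam0 (global_increasing_below (ltW X0) Xx px).
  by move=> h; have := le_lt_trans (le_trans pX h) px; rewrite ltxx.
have {}H x : 0 < x -> psi v x < z1.
  by move=> x0; rewrite ltNge; apply/negP => px; apply: H; exists x.
exfalso.
have p0 := global_psi_gt0 xs0.
have [del del0 Hdel] := reaction_gap p0 (ltW (H _ xs0)) z1k.
pose T := xs + r + (K1 / del + 1).
have K1d : 0 < K1 / del by exact: divr_gt0.
have T0 : 0 < T by rewrite /T; move: xs0 r0 K1d; lra.
have TT : 0 < T <= T by rewrite T0 lexx.
have fl s : 0 < s -> 0 <= flux v W s.
  by move=> s0; exact: (global_flux_below s0 (lexx s) (H s s0)).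
have h2 q : 0 < q < T -> 0 <= flux v W q by move=> /andP[q0 _]; exact: fl.
have y1 : - r <= xs by rewrite (le_trans _ (ltW xs0))// oppr_le0.
have y2 : xs <= T - r by rewrite /T; move: K1d; lra.
have h4 := flux_upper (S T0) g0 TT h2 (ltW (H T T0)) y1 y2 (lexx _) (del := del).
have : flux v W T <= K1 - del * (T - r - xs).
  apply: h4 => q /andP[xq qT]; apply: Hdel.
  have q0 : 0 < q by exact: lt_trans xq.
  rewrite (ltW (H q q0)) andbT; apply: (psi_le lam0).
  exact: global_increasing_below (ltW xs0) (ltW xq) (H q q0).
have -> : del * (T - r - xs) = K1 + del by rewrite /T; field; exact: lt0r_neq0.
have := fl T T0; lra.
Qed.

(* Staying strictly below [kappa] while non-increasing would drive the flux,
   and with it the solution, to minus infinity. *)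
Lemma global_plateau t : 0 < t -> flux v W t = 0 ->
  (forall s, 0 < s < t -> 0 < flux v W s) -> psi v t <= kappa ->
  forall x, t <= x -> psi v x = kappa.
Proof.
move=> t0 ft Ht tk.
have tT x : t <= x -> 0 < t <= x by rewrite t0.
have le_t x : t <= x -> psi v x <= psi v t.
  move=> tx; have x0 : 0 < x by exact: lt_le_trans tx.
  exact: (plateau_le (S x0) g0 (tT x tx) ft Ht tk tx (lexx x)).
have noninc x y : t <= x -> x <= y -> v y <= v x.
  move=> tx xy; have ty := le_trans tx xy.
  have y0 : 0 < y by exact: lt_le_trans ty.
  apply: (plateau_nonincreasing (S y0) g0 (tT y ty) ft Ht tk tx xy (lexx y)).
  by move=> s /andP[ts _]; exact: le_t.
move=> x5 tx5; apply/eqP; rewrite eq_le (le_trans (le_t _ tx5))//=.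
rewrite leNgt; apply/negP => x5k.
have [X X0 HX] := global_eventually.
have noninc' x y : t <= x -> x <= y -> psi v y <= psi v x.
  by move=> tx xy; apply: (psi_le lam0); exact: noninc.
(* Beyond [x6] the density lies between [z1] and [psi v x5 < kappa], where [b - d >= del]; waiting
   one more delay brings the delayed density into this range. *)
pose x6 := Num.max x5 X.
have x56 : x5 <= x6 by rewrite le_max lexx.
have zx5 : z1 <= psi v x5.
  by apply: (le_trans (HX x6 _)); [rewrite le_max lexx orbT|exact: noninc'].
have [del del0 Hdel] := reaction_gap z1_gt0 zx5 x5k.
pose x7 := x6 + r.
have x67 : x6 <= x7 by rewrite lerDl.
have x60 : 0 < x6 by rewrite lt_max X0 orbT.
have x70 : 0 < x7 by exact: lt_le_trans x67.
have W' x : x7 < x -> d (psi v x) - b (psi v (x - r)) <= - del.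
  move=> x7x.
  have x6r : x6 <= x - r by rewrite lerBrDr ltW.
  have x5r : x5 <= x - r by exact: le_trans x6r.
  have xrx : x - r <= x by rewrite gerBl.
  have h1 : psi v x <= psi v (x - r) by apply: noninc' => //; exact: le_trans x5r.
  have h2 : psi v (x - r) <= psi v x5 by exact: noninc'.
  have h3 : z1 <= psi v x.
    by apply: HX; rewrite (le_trans _ (ltW x7x))// (le_trans _ x67)// le_max lexx orbT.
  have := Hdel (psi v x) _; rewrite h3 (le_trans h1 h2) => /(_ isT) h4.
  have := Hdel (psi v x5) _; rewrite zx5 lexx => /(_ isT) h5.
  have h6 := dmono (psi_ge0 lam v x) (le_trans h1 h2).
  (* The delayed density lies between [psi v x] and [psi v x5]; at either end births exceed
     [d (psi v x)] by [del]. *)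
  have := bqc (psi_ge0 lam v x) h1 h2; rewrite ge_min => /orP[|]; lra.
have Wle x : x7 <= x -> W x <= W x7 - del * (x - x7).
  move=> x7x; have x0 : 0 < x by exact: lt_le_trans x7x.
  have : W x - W x7 <= - del * (x - x7); last lra.
  apply: (@derive_le R (fun s => W s - W x7) (fun s => - del * (s - x7))
      (fun s => d (psi v s) - b (psi v (s - r))) (fun=> - del) _ _ x7x).
  - have cW := sol_cW (S ltr01) => s.
    exact: (@continuousB R R R W (fun=> W x7) s (cW s) (@cst_continuous R R _ s)).
  - apply: continuous_scale => s.
    exact: (@continuousB R R R id (fun=> x7) s (fun U h => h) (@cst_continuous R R _ s)).
  - move=> s /andP[x7s sx]; have hs := sol_dW (S x0) (x := s).
    have {}hs : is_derive s 1 W (d (psi v s) - b (psi v (s - r))).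
      by apply: hs; rewrite (lt_trans x70)//= ltW.
    by apply: is_derive_eq; rewrite subr0.
  - by move=> s _; apply: is_derive_eq; rewrite /GRing.scale/=; ring.
  - by move=> s /andP[x7s _]; exact: W'.
  - by rewrite !subrr mulr0.
(* Long enough for [W] to fall to [- 2 z2]; since the density is at most [z2], the flux is then at
   most [- z2]. *)
pose x8 := x7 + (`|W x7| + 2 * z2) / del.
have x78 : x7 <= x8 by rewrite lerDl divr_ge0 ?addr_ge0//; nonneg.
have x80 : 0 < x8 by exact: lt_le_trans x78.
have fl x : x8 <= x -> flux v W x <= - z2.
  move=> x8x; have x7x := le_trans x78 x8x.
  have h1 := Wle x x7x.
  have h2 : del * (x8 - x7) <= del * (x - x7) by rewrite ler_pM2l// lerD2r.
  have h3 : del * (x8 - x7) = `|W x7| + 2 * z2.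
    by rewrite /x8; field; exact: lt0r_neq0.
  have := ler_norm (W x7); have := global_le x; rewrite /flux; lra.
(* From [x8] on flux / psi <= -1, so v loses at least g per unit of time and would reach - g at
   [x9], against positivity. *)
pose x9 := x8 + v x8 / g + 1.
have v80 : 0 <= v x8 by exact: (sol_ge0 (S x80) (lexx _)).
have vg : 0 <= v x8 / g by nonneg.
have x89 : x8 <= x9 by rewrite /x9; lra.
have x90 : 0 < x9 by exact: lt_le_trans x89.
have : v x9 - v x8 <= - g * (x9 - x8).
  apply: (@derive_le R (fun s => v s - v x8) (fun s => - g * (s - x8))
      (fun s => g * (flux v W s / psi v s)) (fun=> - g) _ _ x89).
  - have cv := sol_cv (S ltr01) => s.
    exact: (@continuousB R R R v (fun=> v x8) s (cv s) (@cst_continuous R R _ s)).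
  - apply: continuous_scale => s.
    exact: (@continuousB R R R id (fun=> x8) s (fun U h => h) (@cst_continuous R R _ s)).
  - move=> s /andP[x8s sx]; have hs := sol_derive (S x90) (x := s).
    have {}hs : is_derive s 1 v (g * (flux v W s / psi v s)).
      by apply: hs; rewrite (lt_trans x80)//= ltW.
    by apply: is_derive_eq; rewrite subr0.
  - by move=> s _; apply: is_derive_eq; rewrite /GRing.scale/=; ring.
  - move=> s /andP[x8s _]; have ps := global_psi_gt0 (lt_trans x80 x8s).
    rewrite -[leRHS]mulrN1 ler_pM2l// ler_pdivrMr// mulN1r.
    have := fl s (ltW x8s); have := global_le s; lra.
  - by rewrite !subrr mulr0.
have -> : - g * (x9 - x8) = - v x8 - g by rewrite /x9; field; exact: lt0r_neq0.
have := sol_gt0 (S x90) (x := x9); rewrite x90 lexx => /(_ isT).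
move: g0; lra.
Qed.

(** Prepares the monotonicity clause of a semi-wavefront. With no critical point the density
    increases for ever; a first one at or below [kappa] is followed by the constant [kappa];
    otherwise the first critical point is the [t] of the second alternative. *)
Lemma global_monotone_start : (forall x y, x <= y -> psi v x <= psi v y) \/
  exists2 t, kappa < psi v t & forall x y, x <= y -> y <= t -> psi v x <= psi v y.
Proof.
have fsmall s : 0 < s -> s <= xs -> 0 < flux v W s.
  by move=> s0 sx; apply: (start_flux (S xs0) g0) => //; rewrite s0.
have mono t x y : (forall s, 0 < s < t -> 0 < flux v W s) -> x <= y -> y <= t ->
    psi v x <= psi v y.
  move=> H xy yt; have [y0|y0] := leP y 0.
    by rewrite !(psi_le0 lam0 (S ltr01)) ?(le_trans xy).
  apply: (psi_le lam0); apply: (psi_mono (S y0) g0 (ltW y0) (lexx y) xy).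
  by move=> s /andP[s0 sy]; apply/ltW/H; rewrite s0 (lt_le_trans sy).
have [H|] := pselect (forall s, 0 < s -> 0 < flux v W s).
  by left=> x y xy; apply: (mono y) => // s /andP[/H].
move=> /existsNP[x /not_implyP[x0 /negP]]; rewrite -leNgt => fx.
have xsx : xs <= x.
  by rewrite leNgt; apply/negP => xxs; have := fsmall x x0 (ltW xxs); rewrite ltNge fx.
have [t [/andP[st tx] ft Ht]] := first_nonpos xsx (flux_continuous lam0 (S ltr01))
  (fsmall xs xs0 (lexx _)) fx.
have t0 : 0 < t by exact: lt_trans st.
have {}Ht s : 0 < s < t -> 0 < flux v W s.
  move=> /andP[s0 st']; have [se|es] := leP s xs; first exact: fsmall.
  by apply: Ht; rewrite (ltW es).
have [tk|kt] := leP (psi v t) kappa; last first.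
  by right; exists t => // y z; exact: (mono t y z Ht).
left=> y z yz; have P := global_plateau t0 ft Ht tk.
have [zt|tz] := leP z t; first exact: (mono t y z Ht yz zt).
have [yt|ty] := leP y t; last by rewrite (P y (ltW ty)) (P z (ltW tz)).
by rewrite (P z (ltW tz)) -(P t (lexx t)); exact: (mono t y t Ht yt (lexx t)).
Qed.

End Global.

Lemma critical_profile : exists g v W,
  [/\ 0 < g /\ (exists2 e, 0 < e & forall x, 0 < x <= e -> 0 < flux v W x),
  forall T, 0 < T -> sol g T v W,
  forall x, psi v x <= z2,
  exists2 X, 0 < X & forall x, X <= x -> z1 <= psi v x &
  (forall x y, x <= y -> psi v x <= psi v y) \/
  exists2 t, kappa < psi v t & forall x y, x <= y -> y <= t -> psi v x <= psi v y].
Proof.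
have [g g0 [no nu]] := critical_speed_exists.
have [v [W S]] := global_sol g0 no nu.
exists g, v, W; split=> //.
- split=> //; exists xs => // x /[dup] xx /andP[_ xxs].
  exact: (start_flux (S _ xs0) g0 xx xxs).
- exact: (global_le no S).
- exact: (global_eventually g0 nu S).
- exact: (global_monotone_start g0 no nu S).
Qed.

End Shooting.

(** * Weak derivatives and integrals *)

Section RealAnalysis.
Context {R : realType}.
Local Notation mu := (@lebesgue_measure R).
Implicit Types (f g p : R -> R) (x y t : R).

Lemma is_derive_continuous f l x : is_derive x 1 f l -> {for x, continuous f}.
Proof.
move=> h; apply: differentiable_continuous; apply/derivable1_diffP.
exact: ex_derive.
Qed.

Lemma integral_is_derive f p x y : x < y ->
  (forall t, x <= t <= y -> is_derive t 1 f (p t)) ->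
  (forall t, x <= t <= y -> {for t, continuous p}) ->
  (\int[mu]_(t in `[x, y]) (p t)%:E = (f y)%:E - (f x)%:E)%E.
Proof.
move=> xy df cp; apply: continuous_FTC2 => //.
- by apply: continuous_in_subspaceT => t; rewrite inE/= in_itv/= => /cp.
- split.
  + move=> t; rewrite in_itv/= => /andP[xt ty].
    have h : is_derive t 1 f (p t) by apply: df; rewrite !ltW.
    exact: ex_derive.
  + apply: cvg_at_right_filter; apply: (@is_derive_continuous f (p x)).
    by apply: df; rewrite lexx ltW.
  + apply: cvg_at_left_filter; apply: (@is_derive_continuous f (p y)).
    by apply: df; rewrite lexx ltW.
- move=> t; rewrite in_itv/= => /andP[xt ty].
  have h : is_derive t 1 f (p t) by apply: df; rewrite !ltW.
  by rewrite derive1E derive_val.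
Qed.

Lemma continuous_locally_integrable p : continuous p -> locally_integrable setT p.
Proof.
move=> cp; split; [|exact: openT|].
  exact: continuous_measurable_fun.
move=> K _ cK.
have := @continuous_compact_integrable R p K cK (continuous_subspaceT cp).
by move=> /integrableP[].
Qed.

Lemma W11loc_C1 f p : continuous p -> (forall t, is_derive t 1 f (p t)) ->
  W11loc f.
Proof.
move=> cp df; exists p; split; first exact: continuous_locally_integrable.
move=> x y; rewrite le_eqVlt => /predU1P[->|xy].
  by rewrite set_itv1 integral_set1 subrr.
by rewrite EFinB; symmetry; apply: (integral_is_derive xy) => t _; exact: cp.
Qed.

(* Integrability of [p] near [0] comes from its sign, by monotone convergence. *)
Lemma W11loc_half_line f p e : 0 < e -> continuous f ->
  (forall t, t <= 0 -> f t = 0) ->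
  (forall t, 0 < t -> is_derive t 1 f (p t)) ->
  (forall t, 0 < t -> {for t, continuous p}) ->
  (forall t, 0 < t <= e -> 0 <= p t) -> W11loc f.
Proof.
move=> e0 cf f0 df cp p0.
(* [p] is arbitrary on the left half-line and may blow up at [0]; the density to integrate is its
   extension by zero. *)
pose q t := if 0 < t then p t else 0.
have q_pos t : 0 < t -> q t = p t by rewrite /q => ->.
have q_neg t : t <= 0 -> q t = 0 by rewrite /q ltNge => ->.
have mq : measurable_fun setT q.
  have mp : measurable_fun (`]0, +oo[%classic : set R) p.
    apply: open_continuous_measurable_fun; first exact: interval_open.
    by move=> t; rewrite inE/= in_itv/= andbT => /cp.
  have mI : measurable (`]0, +oo[%classic : set R) by exact: measurable_itv.
  have -> : q = p \_ (`]0, +oo[%classic : set R).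
    apply/funext => t; rewrite patchE; case: ifPn.
      by rewrite inE/= in_itv/= andbT => /q_pos.
    by rewrite notin_setE/= in_itv/= andbT => /negP; rewrite -leNgt => /q_neg.
  by apply/(measurable_restrict _ mI measurableT); rewrite setTI.
have mqE (A : set R) : measurable_fun A (EFin \o q).
  by apply/measurable_EFinP; exact: measurable_funS measurableT (@subsetT _ _) mq.
have ftc x y : 0 < x -> x < y ->
    (\int[mu]_(t in `[x, y]) (q t)%:E = (f y)%:E - (f x)%:E)%E.
  move=> x0 xy.
  have df' t : x <= t <= y -> is_derive t 1 f (p t).
    by move=> /andP[xt _]; apply: df; exact: lt_le_trans xt.
  have cp' t : x <= t <= y -> {for t, continuous p}.
    by move=> /andP[xt _]; apply: cp; exact: lt_le_trans xt.
  rewrite -(integral_is_derive xy df' cp').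
  apply: eq_integral => t; rewrite inE/= in_itv/= => /andP[xt _].
  by rewrite q_pos// (lt_le_trans x0).
have near0 : (\int[mu]_(t in `]0%R, e]) (q t)%:E = (f e)%:E)%E.
  pose F n := `[e / n.+1%:R, e]%classic : set R.
  have UF : \bigcup_n F n = `]0, e]%classic.
    apply/seteqP; split => t.
      move=> [n _]; rewrite /F/= !in_itv/= => /andP[h ->]; rewrite andbT.
      by apply: lt_le_trans h; rewrite divr_gt0.
    rewrite /= in_itv/= => /andP[t0 te].
    exists (Num.bound (e / t)) => //; rewrite /F/= in_itv/= te andbT.
    rewrite ler_pdivrMr// mulrC -ler_pdivrMr//.
    have := archi_boundP (divr_ge0 (ltW e0) (ltW t0)) => /ltW h.
    by rewrite (le_trans h)// ler_nat.
  have c1 : (\int[mu]_(x in F n) (q x)%:E)%E @[n --> \oo] -->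
      (\int[mu]_(x in `]0%R, e]) (q x)%:E)%E.
    rewrite -UF; apply: ge0_nondecreasing_set_cvg_integral.
    - move=> n m nm; apply/subsetPset => t; rewrite /F/= !in_itv/= => /andP[h ->].
      rewrite andbT; apply: le_trans h; rewrite ler_pM2l// lef_pV2 ?posrE//.
      by rewrite ler_nat ltnS.
    - by move=> n; exact: measurable_itv.
    - by move=> n; exact: mqE.
    - move=> n t; rewrite /F/= in_itv/= => /andP[h te].
      have t0 : 0 < t by apply: lt_le_trans h; rewrite divr_gt0.
      by rewrite lee_fin q_pos// p0// t0.
  have c2 : (\int[mu]_(x in F n) (q x)%:E)%E @[n --> \oo] --> (f e)%:E.
    have h0 : e / n.+2%:R @[n --> \oo] --> (0:R).
      rewrite -[X in _ --> X](mulr0 e); apply: cvgM; first exact: cvg_cst.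
      have := @cvg_harmonic R; rewrite -(cvg_shiftS (@harmonic R)); exact.
    have h : (f e - f (e / n.+2%:R))%:E @[n --> \oo] --> (f e)%:E.
      apply: cvg_EFin; first by near=> n.
      rewrite -[X in _ --> X]subr0 -(f0 0 (lexx _)).
      apply: cvgB; first exact: cvg_cst.
      exact: (cvg_comp (fun n : nat => e / n.+2%:R) f h0 (cf 0)).
    (* The shift by one discards [F 0], the single point [e], where the formula on a proper interval
       does not apply. *)
    rewrite -cvg_shiftS/=; apply: cvg_trans h; apply: near_eq_cvg.
    near=> n; rewrite /F ftc ?EFinB ?divr_gt0//.
    by rewrite ltr_pdivrMr// ltr_pMr// ltr1n.
  exact: cvg_unique c1 c2.
have half y : 0 < y -> (\int[mu]_(t in `]0%R, y]) (q t)%:E = (f y)%:E)%E.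
  move=> y0.
  have split2 a c : 0 < a -> a < c -> (\int[mu]_(t in `]0%R, c]) (q t)%:E =
      \int[mu]_(t in `]0%R, a]) (q t)%:E + ((f c)%:E - (f a)%:E))%E.
    move=> a0 ac; rewrite -(ftc _ _ a0 ac) -integral_itv_obnd_cbnd; last exact: mqE.
    rewrite -integral_setU.
    - rewrite -itv_bndbnd_setU// bnd_simp; exact: ltW.
    - exact: measurable_itv.
    - exact: measurable_itv.
    - exact: mqE.
    - apply/disj_setPS => t []/=; rewrite !in_itv/= => /andP[_ ta] /andP[at_ _].
      by move: (lt_le_trans at_ ta); rewrite ltxx.
  have [ye|ey|->//] := ltgtP y e.
    have := split2 y e y0 ye; rewrite near0.
    (* Cancelling in the extended reals needs a finite integral; by the sign of [p] it is at most
       the one over []0, e]]. *)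
    move=> E; have fin : (\int[mu]_(t in `]0%R, y]) (q t)%:E \is a fin_num)%E.
      rewrite fin_numElt; apply/andP; split.
        rewrite (lt_le_trans (ltNyr 0))//; apply: integral_ge0 => t /=.
        rewrite in_itv/= => /andP[t0 ty].
        by rewrite lee_fin q_pos// p0// t0/= (le_trans ty)// ltW.
      apply: (@le_lt_trans _ _ (\int[mu]_(t in `]0%R, e]) (q t)%:E)%E); last first.
        by rewrite near0 ltry.
      apply: ge0_subset_integral => //.
      - exact: mqE.
      - move=> t /=; rewrite in_itv/= => /andP[t0 te].
        by rewrite lee_fin q_pos// p0// t0.
      - by apply: subset_itvl; rewrite bnd_simp ltW.
    move: E; rewrite -(fineK fin) -EFinB -EFinD => -[E].
    by congr EFin; lra.
  rewrite (split2 e y e0 ey) near0 -EFinB -EFinD; congr EFin; ring.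
exists q; split; last first.
  move=> x y; rewrite le_eqVlt => /predU1P[->|xy].
    by rewrite set_itv1 integral_set1 subrr.
  have [x0|x0] := ltP 0 x; first by rewrite ftc.
  have [y0|y0] := ltP 0 y; last first.
    rewrite !f0 ?(ltW xy)// subrr integral0_eq// => t /=.
    by rewrite in_itv/= => /andP[_ ty]; rewrite q_neg// (le_trans ty).
  rewrite (f0 x x0) subr0 -(half y y0).
  rewrite (@itv_bndbnd_setU _ _ (BLeft x) (BRight 0) (BRight y)) ?bnd_simp//; last exact: ltW.
  rewrite integral_setU.
  - rewrite [X in (_ = X + _)%E]integral0_eq ?add0e// => t /=.
    by rewrite in_itv/= => /andP[_ ty]; rewrite q_neg.
  - exact: measurable_itv.
  - exact: measurable_itv.
  - exact: mqE.
  - apply/disj_setPS => t []/=; rewrite !in_itv/= => /andP[_ ta] /andP[at_ _].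
    by move: (lt_le_trans at_ ta); rewrite ltxx.
split=> //; first exact: openT.
move=> K _ cK.
have [M [_ HM]] := compact_bounded cK.
pose N := Num.max e (`|M| + 1).
have N0 : 0 < N by rewrite lt_max e0.
have KN : K `<=` `[- N, N].
  move=> t Kt; rewrite /= in_itv/= -ler_norml.
  apply: (le_trans (HM (`|M| + 1) _ t Kt)); last by rewrite le_max lexx orbT.
  by rewrite (le_lt_trans (ler_norm M))// ltrDl.
have mK : measurable K by exact: compact_measurable.
have maq : forall A : set R, measurable_fun A (fun t => `|q t|%:E).
  move=> A; apply/measurable_EFinP.
  by apply: measurableT_comp => //; exact: measurable_funS measurableT (@subsetT _ _) mq.
have qe0 (D : set R) t : D t -> (0 <= `|q t|%:E)%E by rewrite lee_fin.
apply: (@le_lt_trans _ _ (\int[mu]_(t in `[(- N)%R, N]) `|q t|%:E)%E).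
  apply: ge0_subset_integral => //; first exact: maq.
have mN0 : - N <= 0 by rewrite oppr_le0 ltW.
have disj (a c d : R) (b1 : bool) : [disjoint [set` Interval (BSide b1 a) (BRight c)] & (`]c, d]%classic : set R)].
  apply/disj_setPS => t []/=; rewrite !in_itv/= => /andP[_ ta] /andP[at_ _].
  by move: (lt_le_trans at_ ta); rewrite ltxx.
rewrite (@itv_bndbnd_setU _ _ (BLeft (- N)) (BRight 0) (BRight N)) ?bnd_simp//; last exact: ltW.
rewrite (integral_setU mu (measurable_itv _) (measurable_itv _) (maq _) (disj _ _ _ _)).
rewrite integral0_eq ?add0e; last first.
  by move=> t /=; rewrite in_itv/= => /andP[_ ty]; rewrite q_neg// normr0.
have eN : e <= N by rewrite le_max lexx.
rewrite (@itv_bndbnd_setU _ _ (BRight 0) (BRight e) (BRight N)) ?bnd_simp//; last exact: ltW.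
rewrite (integral_setU mu (measurable_itv _) (measurable_itv _) (maq _) (disj _ _ _ _)).
apply: lte_add_pinfty.
  apply: (@le_lt_trans _ _ (\int[mu]_(t in `]0%R, e]) (q t)%:E)%E); last by rewrite near0 ltry.
  rewrite le_eqVlt; apply/orP; left; apply/eqP; apply: eq_integral => t.
  rewrite inE/= in_itv/= => /andP[t0 te]; rewrite ger0_norm//.
  by rewrite q_pos// p0// t0.
apply: (@le_lt_trans _ _ (\int[mu]_(t in `[e, N]) `|q t|%:E)%E).
  apply: ge0_subset_integral => //; first exact: maq.
  by apply: subset_itvr; rewrite bnd_simp.
have : mu.-integrable `[e, N] (EFin \o q).
  apply: continuous_compact_integrable; first exact: segment_compact.
  apply: continuous_in_subspaceT => t; rewrite inE/= in_itv/= => /andP[et _].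
  have t0 : 0 < t by exact: lt_le_trans et.
  apply: (@cvg_trans _ (p s @[s --> t])).
    by apply: near_eq_cvg; near=> s; rewrite q_pos//; near: s; exact: lt_nbhsr.
  by rewrite q_pos//; exact: cp.
by move=> /integrableP[].
Unshelve. all: by end_near. Qed.

(** The right difference quotient at [0] is bounded by the size of [w] nearby, which tends to
    [w 0 = 0]. This makes phi^m of class C^1 across the front even where phi is not. *)
Lemma is_derive_glue f w : continuous f -> continuous w ->
  (forall t, t <= 0 -> f t = 0) -> (forall t, t <= 0 -> w t = 0) ->
  (forall t, 0 < t -> is_derive t 1 f (w t)) ->
  forall t, is_derive t 1 f (w t).
Proof.
move=> cf cw f0 w0 df t; have [t0|t0|->] := ltgtP t 0; last 2 first.
- exact: df.
- rewrite w0//.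
  have h : h^-1 *: (f (h *: 1 + 0) - f 0) @[h --> 0^'] --> 0.
    apply/cvgrPdist_le => e e0; rewrite near_withinE.
    have /cvgrPdist_lt/(_ e e0)/nbhs_ballP[del/= del0 H] := cw 0.
    apply/nbhs_ballP; exists del => //= h; rewrite /ball/= sub0r normrN => hd hn0.
    rewrite sub0r normrN /GRing.scale/= mulr1 addr0 (f0 0)// subr0.
    have [hle|hgt] := leP h 0; first by rewrite f0// mulr0 normr0 ltW.
    rewrite normrM normfV (gtr0_norm hgt) mulrC ler_pdivrMr//.
    rewrite (gtr0_norm hgt) in hd.
    apply: (@norm_le_linear R f w e h (ltW hgt) cf (f0 0 (lexx _))).
      by move=> s /andP[s0 _]; exact: df.
    move=> s /andP[s0 sh]; have := H s.
    rewrite /ball/= (w0 0 (lexx _)) !sub0r !normrN (gtr0_norm s0) => H'.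
    by apply/ltW/H'; exact: lt_trans hd.
  apply: DeriveDef; first by apply: cvgP; exact: h.
  exact: cvg_lim h.
- rewrite w0; last exact: ltW.
  apply: (@near_eq_is_derive _ _ _ (cst (0:R))).
  near=> s; rewrite f0//; apply: ltW; near: s; exact: lt_nbhsl.
Unshelve. all: by end_near. Qed.

Lemma integral_derivative_compact_support f p K : continuous p ->
  (forall t, is_derive t 1 f (p t)) -> (forall t, K < `|t| -> f t = 0) ->
  (\int[mu]_(t in setT) (p t)%:E = 0)%E.
Proof.
move=> cp df f0.
pose N := `|K| + 1.
have KN : K < N by rewrite (le_lt_trans (ler_norm K))// ltrDl.
have N0 : 0 < N by rewrite ltr_wpDl.
have p0 t : N < `|t| -> p t = 0.
  move=> Nt; have /@derive_val <- := df t.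
  have d0 : is_derive t 1 (cst (0:R) : R -> R) (0:R) by exact: (@is_derive_cst R R R 0 t 1).
  apply: (@derive_val _ _ _ _ _ _ _ (near_eq_is_derive _ d0)).
  have : continuous (fun s : R => `|s|) by exact: norm_continuous.
  move=> /(_ t)/cvgrPdist_lt/(_ (`|t| - N)); rewrite subr_gt0 => /(_ Nt).
  apply: filterS => s; rewrite ltr_norml => /andP[_ hs].
  by rewrite f0//; lra.
have -> : (\int[mu]_(t in setT) (p t)%:E = \int[mu]_(t in `[(- N)%R, N]) (p t)%:E)%E.
  rewrite [RHS]integral_mkcond; apply: eq_integral => t _.
  rewrite patchE; case: ifPn => //.
  rewrite notin_setE/= in_itv/= -ler_norml => /negP; rewrite -ltNge => /p0 ->//.
have NN : - N < N by lra.
rewrite (integral_is_derive NN (f := f)).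
- by rewrite !f0 ?normrN ?gtr0_norm// subee.
- by move=> t _; exact: cp.
Qed.

End RealAnalysis.

(** * From the standing assumptions to the shooting hypotheses *)

Section HalfLine.
Context {R : realType}.
Implicit Types (f : R -> R) (x y t : R).

Lemma C1_nonneg_lipschitz f (f1 : R -> R) : C1_nonneg f f1 ->
  forall X : R, exists2 L, 0 < L & forall x y, 0 <= x <= X -> 0 <= y <= X ->
  `|f x - f y| <= L * `|x - y|.
Proof.
move=> [cf1 df f0] X; have [X0|X0] := ltP X 0.
  by exists 1 => // x y /andP[x0 xX]; have := le_lt_trans (le_trans x0 xX) X0; rewrite ltxx.
have cX : {within `[0, X], continuous f1}.
  apply: continuous_subspaceW cf1 => x /=; by rewrite in_itv/= => /andP[].
have [zM _ HM] := EVT_max X0 cX.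
have [zm _ Hm] := EVT_min X0 cX.
pose B := `|f1 zM| + `|f1 zm|.
have HB x : 0 <= x <= X -> `|f1 x| <= B.
  move=> xX; have h1 := HM x; have h2 := Hm x; rewrite in_itv/= in h1 h2.
  have {}h1 := h1 xX; have {}h2 := h2 xX.
  have := ler_norm (f1 zM); have := ler_norm (- f1 zm); rewrite normrN => h3 h4.
  have := normr_ge0 (f1 zM); have := normr_ge0 (f1 zm) => h5 h6.
  by rewrite ler_norml /B; apply/andP; split; lra.
have B0 : 0 <= B by rewrite addr_ge0.
have pos x y : 0 < x -> x <= y -> y <= X -> `|f y - f x| <= B * (y - x).
  move=> x0 xy yX.
  have dfi z : z \in `]x, y[%R -> is_derive z 1 f (f1 z).
    by rewrite in_itv/= => /andP[xz _]; apply: df; exact: lt_trans xz.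
  have [|z zxy ->] := MVT_segment xy dfi.
    apply: derivable_within_continuous => z; rewrite in_itv/= => /andP[xz _].
    have h : is_derive z 1 f (f1 z) by apply: df; exact: lt_le_trans xz.
    exact: ex_derive.
  rewrite normrM (@ger0_norm _ (y - x)) ?subr_ge0// ler_wpM2r ?subr_ge0//.
  apply: HB; move: zxy; rewrite in_itv/= => /andP[xz zy].
  by rewrite (le_trans (ltW x0))//= (le_trans zy).
pose L := B + `|f1 0| + 1.
have L0 : 0 < L by rewrite ltr_wpDl// addr_ge0.
have BL : B <= L by rewrite /L -addrA lerDl addr_ge0.
(* At [0] only the right difference quotient is known. It bounds the increment up to a small [h],
   and the mean value bound takes over from [h] to [y]. *)
have zero y : 0 < y -> y <= X -> `|f y - f 0| <= L * y.
  move=> y0 yX.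
  have := f0 => /cvgrPdist_lt/(_ 1 ltr01); rewrite near_withinE => /nbhs_ballP[e/= e0 He].
  pose h := Num.min y (e / 2).
  have h0 : 0 < h by rewrite lt_min y0 divr_gt0.
  have hy : h <= y by rewrite ge_min lexx.
  have he : h < e.
    have : h <= e / 2 by rewrite ge_min lexx orbT.
    lra.
  have := He h; rewrite /ball/= sub0r normrN gtr0_norm// => /(_ he h0) hq.
  have {}hq : `|f h - f 0| <= (`|f1 0| + 1) * h.
    have hE : f h - f 0 = h^-1 * (f h - f 0) * h by field; exact: lt0r_neq0.
    rewrite hE normrM (gtr0_norm h0) ler_pM2r//.
    have := ler_normB (f1 0) (f1 0 - h^-1 * (f h - f 0)); rewrite opprB addrC subrK.
    move: hq; lra.
  have q2 := pos h y h0 hy yX.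
  have -> : f y - f 0 = (f y - f h) + (f h - f 0) by ring.
  apply: (le_trans (ler_normD _ _)).
  have q3 : (`|f1 0| + 1) * h <= (`|f1 0| + 1) * y by rewrite ler_wpM2l// addr_ge0.
  have q4 : B * (y - h) <= B * y by rewrite ler_wpM2l//; lra.
  have -> : L * y = B * y + (`|f1 0| + 1) * y by rewrite /L; ring.
  lra.
suff key x y : 0 <= x -> x <= y -> y <= X -> `|f y - f x| <= L * (y - x).
  exists L => // x y /andP[x0 xX] /andP[y0 yX]; have [xy|/ltW xy] := leP x y.
    by rewrite distrC (distrC x) (@ger0_norm _ (y - x)) ?subr_ge0//; exact: key.
  by rewrite (@ger0_norm _ (x - y)) ?subr_ge0//; exact: key.
rewrite le_eqVlt => /predU1P[<-|x0] xy yX.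
  move: xy; rewrite le_eqVlt => /predU1P[<-|y0]; first by rewrite !subrr normr0 mulr0.
  by rewrite subr0; exact: zero.
by apply: (le_trans (pos x y x0 xy yX)); rewrite ler_wpM2r// subr_ge0.
Qed.

Lemma max0_derive f (l : R) x : 0 < x -> is_derive x 1 f l ->
  is_derive x 1 (fun z : R => f (Num.max z 0)) l.
Proof.
move=> x0 df; apply: (near_eq_is_derive _ df).
near=> z; rewrite max_l//; apply: ltW; near: z; exact: lt_nbhsr.
Unshelve. all: by end_near. Qed.

Lemma C1_nonneg_max0_continuous f (f1 : R -> R) : C1_nonneg f f1 ->
  continuous (fun z : R => f (Num.max z 0)).
Proof.
move=> Cf; apply: (lipschitz_comp_continuous (C1_nonneg_lipschitz Cf) (@max0_continuous R)).
by move=> x; rewrite le_max lexx orbT.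
Qed.

Lemma C1_nonneg_increasing f (f1 : R -> R) : C1_nonneg f f1 -> (forall s, 0 < s -> 0 < f1 s) ->
  forall x y, 0 <= x -> x < y -> f x < f y.
Proof.
move=> Cf f1_gt0 x y x0 xy; have := Cf => -[_ df _].
have := @derive_gt0_lt R (fun z => f (Num.max z 0)) f1 x y xy
  (C1_nonneg_max0_continuous Cf).
rewrite !max_l ?(le_trans x0 (ltW xy))//; apply=> z /andP[xz _].
- by apply: max0_derive; [|apply: df]; exact: le_lt_trans xz.
- by apply: f1_gt0; exact: le_lt_trans xz.
Qed.

(** A violation at [z] would give a minimum interior to [[x, y]], a local extremum, which can only
    be [sM]; but the value there is the global maximum. *)
Lemma unimodal_quasiconcave f (f1 : R -> R) sM : C1_nonneg f f1 ->
  (forall s, 0 < s -> local_extremum f s -> s = sM) ->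
  (forall s, 0 <= s -> f s <= f sM) ->
  forall x z y, 0 <= x -> x <= z -> z <= y -> Num.min (f x) (f y) <= f z.
Proof.
move=> Cf ext fM x z y x0 xz zy; rewrite leNgt lt_min; apply/negP => /andP[h1 h2].
have xy : x <= y by exact: le_trans zy.
have [q /andP[xq qy] Hq] := min_itv xy (C1_nonneg_max0_continuous Cf).
have q0 : 0 <= q by exact: le_trans xq.
have {}Hq s : x <= s <= y -> f q <= f s.
  by move=> /[dup] /Hq + /andP[xs _]; rewrite !max_l// (le_trans x0).
have qz : f q <= f z by apply: Hq; rewrite xz.
have xq' : x < q.
  by rewrite lt_neqAle xq andbT; apply/eqP => E; move: qz; rewrite -E leNgt h1.
have qy' : q < y.
  by rewrite lt_neqAle qy andbT; apply/eqP => E; move: qz; rewrite E leNgt h2.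
have qM : q = sM.
  apply: ext; first exact: le_lt_trans xq'.
  right; near=> s; apply: Hq; apply/andP; split; apply: ltW; near: s.
    exact: lt_nbhsr.
  exact: lt_nbhsl.
by have := fM x x0; rewrite -qM leNgt (le_lt_trans qz).
Unshelve. all: by end_near. Qed.

(** The end [t0] is the supremum of the times up to which [f] is non-decreasing. It is at least [t],
    and continuity carries the bound [f t > kappa] to [t0]. *)
Lemma maximal_monotone_interval f kappa : continuous f ->
  (forall x y, x <= y -> f x <= f y) \/
    (exists2 t, kappa < f t & forall x y, x <= y -> y <= t -> f x <= f y) ->
  exists t0 : \bar R,
    [/\ t0 <> -oo%E, nondecr_below f t0,
        (forall t1 : R, (t0 < t1%:E)%E -> ~ nondecr_below f t1%:E) &
        (forall t0r : R, t0 = t0r%:E -> kappa < f t0r)].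
Proof.
move=> cf alt.
have [H|] := pselect (forall x y, x <= y -> f x <= f y).
  by exists +oo%E; split=> // x y xy _; exact: H.
case: alt => [//|[t kt Ht]].
move=> /existsNP[x /existsNP[y /not_implyP[xy /negP]]]; rewrite -ltNge => fyx.
pose A := [set z | forall x y : R, x <= y -> y <= z -> f x <= f y].
have At : A t by move=> *; exact: Ht.
have uA : ubound A y.
  move=> z Az; rewrite leNgt; apply/negP => yz.
  by have := Az x y xy (ltW yz); rewrite leNgt fyx.
have sA : has_sup A by split; [exists t|exists y].
have below z : z < sup A -> A z.
  move=> zs; have [|w Aw zw] := @sup_adherent _ _ (sup A - z) _ sA.
    by rewrite subr_gt0.
  rewrite subKr in zw => p q pq qz; apply: Aw => //.
  exact: le_trans (ltW zw).
have ts : t <= sup A by apply: ub_le_sup => //; exists y.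
exists (sup A)%:E; split=> //.
- by move=> p q pq; rewrite lte_fin => /below; apply.
- move=> t1; rewrite lte_fin => st1 nd.
  have : A ((sup A + t1) / 2).
    by move=> p q pq qs; apply: nd => //; rewrite lte_fin; lra.
  move=> h; have : (sup A + t1) / 2 <= sup A by apply: ub_le_sup => //; exists y.
  lra.
- move=> t0r [<-]; apply: (lt_le_trans kt).
  move: ts; rewrite le_eqVlt => /predU1P[->//|ts].
  rewrite leNgt; apply/negP => fs.
  have /cvgrPdist_lt/(_ (f t - f (sup A))) := cf (sup A).
  rewrite subr_gt0 => /(_ fs)/nbhs_ballP[e/= e0 He].
  pose z := Num.max t (sup A - e / 2).
  have zs : z < sup A by rewrite gt_max ts/= ltrBlDr ltrDl divr_gt0.
  have tz : t <= z by rewrite le_max lexx.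
  have sz : sup A - e / 2 <= z by rewrite le_max lexx orbT.
  have := He z; rewrite /ball/= gtr0_norm ?subr_gt0// => /(_ _).
  have -> : sup A - z < e by lra.
  move=> /(_ isT); rewrite ltr_norml => /andP[h1 h2].
  have := below z zs t z tz (lexx z); lra.
Qed.

Lemma lim_sup_pinfty_le f (B X : R) : (forall t, X <= t -> f t <= B) ->
  (lim_sup_pinfty f <= B%:E)%E.
Proof.
move=> H; rewrite /lim_sup_pinfty limf_esupE.
apply: (@le_trans _ _ (ereal_sup ((EFin \o f) @` [set t | X <= t]))).
  apply: ereal_inf_lbound; exists [set t | X <= t] => //.
  by exists X; split; [exact: num_real|move=> t h; exact: ltW].
by apply: ge_ereal_sup => _ [t Xt <-]; rewrite lee_fin; exact: H.
Qed.

Lemma lim_inf_pinfty_ge f (B X : R) : (forall t, X <= t -> B <= f t) ->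
  (B%:E <= lim_inf_pinfty f)%E.
Proof.
move=> H; rewrite /lim_inf_pinfty limf_einfE.
apply: (@le_trans _ _ (ereal_inf ((EFin \o f) @` [set t | X <= t]))).
  by apply: le_ereal_inf_tmp => _ [t Xt <-]; rewrite lee_fin; exact: H.
apply: ereal_sup_ubound; exists [set t | X <= t] => //.
by exists X; split; [exact: num_real|move=> t h; exact: ltW].
Qed.

Lemma lim_inf_sup_pinfty f : (lim_inf_pinfty f <= lim_sup_pinfty f)%E.
Proof.
rewrite /lim_inf_pinfty /lim_sup_pinfty limf_einfE limf_esupE.
apply: ge_ereal_sup => _ [A FA <-]; apply: le_ereal_inf_tmp => _ [B FB <-].
have FAB : (@pinfty_nbhs R) (A `&` B) by exact: filterI.
have [t [At Bt]] := filter_ex FAB.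
apply: (@le_trans _ _ (f t)%:E).
  by apply: ereal_inf_lbound; exists t.
by apply: ereal_sup_ubound; exists t.
Qed.

End HalfLine.

(** * The wave *)

Section Wave.
Context {R : realType}.
Variables (m D r : R) (d b : R -> R) (g c : R) (v W : R -> R).
Hypotheses (m1 : 1 < m) (D0 : 0 < D) (r0 : 0 <= r) (d0 : d 0 = 0) (b0 : b 0 = 0).
Hypothesis lip : forall X : R, exists2 L, 0 < L & forall x y, 0 <= x <= X ->
  0 <= y <= X -> `|d x - d y| <= L * `|x - y| /\ `|b x - b y| <= L * `|x - y|.
Let lam := (m - 1)^-1.
Hypotheses (g0 : 0 < g) (c0 : 0 < c) (cg : c ^+ 2 = g * m * D * lam).
Hypothesis S : forall T, 0 < T -> sol lam r d b g T v W.
Implicit Types t x : R.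

Let m0 : 0 < m. Proof. exact: lt_trans m1. Qed.
Let lam0 : 0 < lam. Proof. by rewrite invr_gt0 subr_gt0. Qed.
Let lamm : lam * (m - 1) = 1.
Proof. by rewrite /lam mulVf// gt_eqF// subr_gt0. Qed.

Definition wave t := psi lam v (t / c).
(** In the original time variable [c * wave t + net_loss t] is D (phi^m)', the wave equation
    integrated once from the zero state. *)
Definition net_loss t := c * W (t / c).
Definition net_loss_rate t := d (wave t) - b (wave (t - c * r)).

Let scale_continuous : continuous (fun t : R => t / c).
Proof. by move=> t; exact: mulrr_continuous. Qed.

Let scale_derive t : is_derive t 1 (fun t : R => t / c) c^-1.
Proof. by apply: is_derive_eq; rewrite /GRing.scale/=; ring. Qed.

Lemma wave_continuous : continuous wave.
Proof.
have cp := psi_continuous lam0 (S ltr01) => t.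
apply: (@continuous_comp _ _ _ (fun t : R => t / c)); first exact: scale_continuous.
exact: cp.
Qed.

Lemma wave_ge0 t : 0 <= wave t. Proof. exact: psi_ge0. Qed.

Lemma wave_le0 t : t <= 0 -> wave t = 0.
Proof.
by move=> t0; rewrite /wave (psi_le0 lam0 (S ltr01))// pmulr_lle0// invr_gt0.
Qed.

Lemma wave_gt0 t : 0 < t -> 0 < wave t.
Proof.
move=> t0; have x0 : 0 < t / c by exact: divr_gt0.
by have := psi_gt0 (S x0) (x := t / c); rewrite x0 lexx; apply.
Qed.

Lemma net_loss_continuous : continuous net_loss.
Proof.
have cW := sol_cW (S ltr01).
apply: continuous_scale => t.
apply: (@continuous_comp _ _ _ (fun t : R => t / c)); first exact: scale_continuous.
exact: cW.
Qed.

Lemma net_loss_rate_continuous : continuous net_loss_rate.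
Proof.
have cw := wave_continuous.
have cwr : continuous (fun t => wave (t - c * r)).
  move=> t; apply: (@continuous_comp _ _ _ (fun t => t - c * r)); last exact: cw.
  exact: (@continuousB R R R id (fun=> c * r) t (fun U h => h) (@cst_continuous R R _ t)).
have ld X : exists2 L, 0 < L & forall x y, 0 <= x <= X -> 0 <= y <= X ->
    `|d x - d y| <= L * `|x - y|.
  by have [L L0 H] := lip X; exists L => // x y hx hy; case: (H x y hx hy).
have lb X : exists2 L, 0 < L & forall x y, 0 <= x <= X -> 0 <= y <= X ->
    `|b x - b y| <= L * `|x - y|.
  by have [L L0 H] := lip X; exists L => // x y hx hy; case: (H x y hx hy).
have cd := lipschitz_comp_continuous ld cw wave_ge0.
have cb := lipschitz_comp_continuous lb cwr (fun t => wave_ge0 (t - c * r)).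
by move=> t; apply: continuousB; [exact: cd|exact: cb].
Qed.

Lemma net_loss_derive t : is_derive t 1 net_loss (net_loss_rate t).
Proof.
apply: is_derive_glue; first exact: net_loss_continuous.
- exact: net_loss_rate_continuous.
- move=> s s0; rewrite /net_loss (sol_W0 (S ltr01)) ?mulr0//.
  by rewrite pmulr_lle0// invr_gt0.
- move=> s s0; rewrite /net_loss_rate !wave_le0// ?d0 ?b0 ?subrr//.
  by rewrite (le_trans _ s0)// gerBl mulr_ge0// ltW.
- move=> s s0; have x0 : 0 < s / c by exact: divr_gt0.
  have xx : 0 < s / c <= s / c by rewrite x0 lexx.
  have h := @is_derive1_comp R W (fun t : R => t / c) s _ _
    (sol_dW (S x0) xx) (scale_derive s).
  rewrite (_ : net_loss = c *: (W \o (fun t : R => t / c))); last by apply/funext.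
  apply: is_derive_eq; rewrite /GRing.scale/= /net_loss_rate /wave.
  rewrite (_ : (s - c * r) / c = s / c - r); last by field; exact: lt0r_neq0.
  by field; exact: lt0r_neq0.
Qed.

Lemma momentum_continuous : continuous (fun t => (c * wave t + net_loss t) / D).
Proof.
have cc := continuous_scale (c := c) wave_continuous.
have cr := net_loss_continuous => t.
apply: (@continuousM R R (fun t => c * wave t + net_loss t) (fun=> D^-1) t).
  exact: (@continuousD R R R (fun t => c * wave t) net_loss t (cc t) (cr t)).
exact: cst_continuous.
Qed.

Lemma wave_powR_continuous : continuous (fun t => wave t `^ m).
Proof.
have cw := wave_continuous => t.
have -> : (fun t => wave t `^ m) = (fun y => (Num.max y 0) `^ m) \o wave.
  by apply/funext => y /=; rewrite max_l// wave_ge0.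
apply: continuous_comp; first exact: cw.
exact: powR_pos_continuous.
Qed.

(* [d(psi^m)/dx = m lam g (psi + W)]: the exponents match because [lam (m-1) = 1]. *)
Lemma wave_powR_derive t :
  is_derive t 1 (fun t => wave t `^ m) ((c * wave t + net_loss t) / D).
Proof.
apply: (@is_derive_glue R (fun t => wave t `^ m)
  (fun t => (c * wave t + net_loss t) / D)); first exact: wave_powR_continuous.
- exact: momentum_continuous.
- by move=> s s0; rewrite wave_le0// powR0// gt_eqF.
- move=> s s0; rewrite wave_le0// /net_loss (sol_W0 (S ltr01)) ?mulr0 ?addr0 ?mul0r//.
  by rewrite pmulr_lle0// invr_gt0.
move=> s s0; set x := s / c.
have x0 : 0 < x by exact: divr_gt0.
have xx : 0 < x <= x by rewrite x0 lexx.
have v0 := sol_gt0 (S x0) xx.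
have p0 := psi_gt0 (S x0) xx.
have h1 := @is_derive1_comp R (psi lam v) (fun t : R => t / c) s _ _
    (is_derive_psi (S x0) xx) (scale_derive s).
have h2 := @is_derive1_powR R m (psi lam v x) p0.
have h3 := @is_derive1_comp R (@powR R ^~ m) (psi lam v \o (fun t : R => t / c)) s _ _ h2 h1.
rewrite (_ : (fun t => wave t `^ m) = (@powR R ^~ m) \o (psi lam v \o (fun t : R => t / c)));
  last by apply/funext.
apply: is_derive_eq; rewrite -/x /wave /net_loss -/x.
have E1 : psi lam v x `^ (m - 1) = v x.
  by rewrite (psiE (S x0) (lexx x)) -powRrM lamm powRr1// ltW.
have E2 : psi lam v x = v x * v x `^ (lam - 1).
  by rewrite (psiE (S x0) (lexx x)) mulr_powRB1// ltW.
set F := flux lam v W x / psi lam v x.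
have -> : m * (psi lam v \o (fun t : R => t / c)) s `^ (m - 1) *
    (lam * v x `^ (lam - 1) * (g * F) * c^-1) =
    m * lam * g * (v x * v x `^ (lam - 1) * F) / c.
  by rewrite /= -/x E1; ring.
rewrite -E2 /F.
have -> : psi lam v x * (flux lam v W x / psi lam v x) = psi lam v x + W x.
  by rewrite mulrCA mulfV ?gt_eqF// mulr1.
have cD : c * c / D = g * m * lam.
  by rewrite -expr2 cg; field; exact: lt0r_neq0.
rewrite [RHS](_ : _ = (c * c / D) * (psi lam v x + W x) / c).
  by rewrite cD; ring.
by field; rewrite !lt0r_neq0.
Qed.

(** The slope of the wave is unbounded at the front when [lam < 1], that is [m > 2]. Positivity of
    the flux there gives it a sign, which suffices for integrability. *)
Lemma wave_W11loc : (exists2 e, 0 < e & forall x, 0 < x <= e -> 0 < flux lam v W x) ->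
  W11loc wave.
Proof.
move=> [e e0 He].
pose p t := lam * v (t / c) `^ (lam - 1) *
  (g * (flux lam v W (t / c) / psi lam v (t / c))) * c^-1.
have xpos t : 0 < t -> 0 < t / c by move=> t0; exact: divr_gt0.
have dw t : 0 < t -> is_derive t 1 wave (p t).
  move=> /xpos x0; have xx : 0 < t / c <= t / c by rewrite x0 lexx.
  exact: (@is_derive1_comp R (psi lam v) (fun t : R => t / c) t _ _
    (is_derive_psi (S x0) xx) (scale_derive t)).
apply: (@W11loc_half_line R wave p (c * e)).
- exact: mulr_gt0.
- exact: wave_continuous.
- exact: wave_le0.
- move=> t t0; have x0 := xpos t t0.
  have xx : 0 < t / c <= t / c by rewrite x0 lexx.
  have v0 := sol_gt0 (S x0) xx.
  have p0 := psi_gt0 (S x0) xx.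
  have cv := sol_cv (S ltr01); have cp := psi_continuous lam0 (S ltr01).
  have cf := flux_continuous lam0 (S ltr01).
  have c1 : {for t / c, continuous (fun x => v x `^ (lam - 1))}.
    apply: (@continuous_comp _ _ _ v (@powR R ^~ (lam - 1))); first exact: cv.
    exact: is_derive_continuous (@is_derive1_powR R (lam - 1) (v (t / c)) v0).
  have c2 : {for t / c, continuous (fun x => flux lam v W x / psi lam v x)}.
    apply: (@continuousM R R (flux lam v W) (fun x => (psi lam v x)^-1)); first exact: cf.
    by apply: continuousV; [rewrite gt_eqF|exact: cp].
  apply: (@continuous_comp _ _ _ (fun t : R => t / c) (fun x => lam * v x `^ (lam - 1) *
    (g * (flux lam v W x / psi lam v x)) * c^-1)); first exact: scale_continuous.
  have cst (k : R) : {for t / c, continuous (fun=> k : R)} by exact: cst_continuous.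
  exact: (continuousM (continuousM (continuousM (cst lam) c1)
    (continuousM (cst g) c2)) (cst c^-1)).
- move=> t /andP[t0 te]; have x0 := xpos t t0.
  have xe : t / c <= e by rewrite ler_pdivrMr// mulrC.
  have fx : 0 < flux lam v W (t / c) by apply: He; rewrite x0.
  have p0 := psi_ge0 lam v (t / c).
  by rewrite /p; nonneg.
Qed.

Lemma wave_powR_W11loc : W11loc (fun t => wave t `^ m).
Proof.
apply: (@W11loc_C1 R _ (fun t => (c * wave t + net_loss t) / D)).
  exact: momentum_continuous.
exact: wave_powR_derive.
Qed.

(* The integrand is the derivative of [D phi^m psi' - net_loss psi]. *)
Lemma wave_weak_solution : wave_eq_distr m D r c b d wave.
Proof.
move=> test [dtest [K HK]].
have d1 n t : is_derive t 1 (derive1n n test) (derive1n n.+1 test t).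
  by apply: DeriveDef; [exact: dtest|rewrite derive1nS derive1E].
have ct n : continuous (derive1n n test).
  by move=> t; exact: is_derive_continuous (d1 n t).
have dt0 n : forall t, K < `|t| -> derive1n n test t = 0.
  elim: n => [|n IH] t Kt; first exact: HK.
  have /@derive_val <- := d1 n t.
  have e0 : is_derive t 1 (cst (0:R) : R -> R) (0:R) by exact: (@is_derive_cst R R R 0 t 1).
  apply: (@derive_val _ _ _ _ _ _ _ (near_eq_is_derive _ e0)).
  have : continuous (fun s : R => `|s|) by exact: norm_continuous.
  move=> /(_ t)/cvgrPdist_lt/(_ (`|t| - K)); rewrite subr_gt0 => /(_ Kt).
  apply: filterS => s; rewrite ltr_norml => /andP[_ hs].
  by rewrite IH//; lra.
pose U t := wave t `^ m.
pose J t := (c * wave t + net_loss t) / D.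
pose H t := D * (U t * derive1n 1 test t) - net_loss t * test t.
pose h t := D * (J t * derive1n 1 test t + U t * derive1n 2 test t) -
  (net_loss_rate t * test t + net_loss t * derive1n 1 test t).
have cw := wave_continuous; have cr := net_loss_continuous.
have crr := net_loss_rate_continuous; have cU := wave_powR_continuous.
have cJ : continuous J := momentum_continuous.
have ch : continuous h.
  move=> t; have cD : {for t, continuous (fun=> D : R)} by exact: cst_continuous.
  exact: (continuousB
    (continuousM cD (continuousD (continuousM (cJ t) (ct 1%N t)) (continuousM (cU t) (ct 2%N t))))
    (continuousD (continuousM (crr t) (ct 0%N t)) (continuousM (cr t) (ct 1%N t)))).
have dH t : is_derive t 1 H (h t).
  have q1 := wave_powR_derive t; have q2 := net_loss_derive t.
  have q3 := d1 0%N t; have q4 := d1 1%N t.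
  rewrite (_ : H = (D *: ((fun t => wave t `^ m) * derive1n 1 test)) - net_loss * derive1n 0 test);
    last by apply/funext.
  apply: is_derive_eq; rewrite /h /J /U /GRing.scale/=; ring.
have H0 t : K < `|t| -> H t = 0.
  by move=> Kt; rewrite /H (dt0 1%N)// HK// !mulr0 subrr.
rewrite -[RHS](integral_derivative_compact_support ch dH H0).
apply: eq_integral => t _; congr EFin; rewrite /h /J /U /net_loss_rate.
by field; exact: lt0r_neq0.
Qed.

(** Since W / psi = O(x), v = g x + O(x^2); dividing by x and taking the power [lam] gives psi =
    g^lam x^lam + O(x^(lam + 1)). The horizon [c^-1] corresponds to t < 1. *)
Lemma wave_asymptotics : exists Lam C1 C2 : R,
  [/\ (m - 1)^-1 < Lam, 0 < C1, 0 < C2 & forall t, 0 < t < 1 ->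
    `|wave t - C1 * t `^ ((m - 1)^-1)| <= C2 * t `^ Lam].
Proof.
have T0 : 0 < c^-1 by rewrite invr_gt0.
have [k [K [k0 kK Hb]]] := sol_bracket (S T0).
have St := sol_step lam0 r0 k0 kK (S T0) Hb.
have [C C0 HC] := step_quot_bound lam0 r0 d0 b0 lip k0 kK (ltW T0).
(* The bracket is widened to contain [g], so that one Lipschitz constant covers both v / x and its
   limit [g]. *)
pose k' := Num.min k g; pose K' := Num.max K g.
have k'0 : 0 < k' by rewrite lt_min k0.
have [Cp Cp0 HCp] := @powR_lipschitz R k' K' lam k'0.
pose C2 := Cp * (g * C) * c^-1 `^ lam * c^-1.
exists (lam + 1), ((g / c) `^ lam), C2; split.
- by rewrite -/lam ltrDl.
- by apply: powR_gt0; exact: divr_gt0.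
- by rewrite /C2; posit.
move=> t /andP[t0 t1]; rewrite -/lam; set x := t / c.
have x0 : 0 < x by exact: divr_gt0.
have xT : x <= c^-1 by rewrite /x ler_piMl// ltW.
have xx : 0 < x <= c^-1 by rewrite x0.
have vx : `|v x - g * x| <= g * C * x * x.
  have dg (s : R) : is_derive s 1 (fun s : R => g * s) g.
    by apply: is_derive_eq; rewrite /GRing.scale/=; ring.
  apply: (@norm_le_linear R (fun s => v s - g * s)
    (fun s => g * (1 + W s / psi lam v s) - g) _ x (ltW x0)).
  - have cv := sol_cv (S T0) => s.
    exact: (@continuousB R R R v (fun s => g * s) s (cv s) (@mulrl_continuous R g s)).
  - by rewrite (sol_v0 (S T0))// mulr0 subrr.
  - move=> s /andP[s0 sx]; have sT : 0 < s <= c^-1 by rewrite s0 (le_trans (ltW sx)).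
    have h1 := sol_dv (S T0) sT; have h2 := dg s; exact: is_deriveB.
  - move=> s /andP[s0 sx]; have sT : 0 < s <= c^-1 by rewrite s0 (le_trans (ltW sx)).
    rewrite [X in `|X|](_ : _ = g * (W s / psi lam v s)); last by ring.
    rewrite normrM (gtr0_norm g0) -mulrA ler_pM2l//.
    have := HC _ _ _ _ St s sT.
    rewrite (dens_psi lam0 k0 kK (sol_v0 (S T0)) Hb); last by case/andP: sT.
    move=> h; apply: (le_trans h); rewrite ler_pM2l//; exact: ltW.
have /andP[b1 b2] := Hb x xx.
have yr : k' <= v x / x <= K'.
  rewrite ler_pdivlMr// ler_pdivrMr//; apply/andP; split.
    by apply: le_trans b1; rewrite ler_pM2r// ge_min lexx.
  by apply: (le_trans b2); rewrite ler_pM2r// le_max lexx.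
have gr : k' <= g <= K' by rewrite ge_min le_max lexx !orbT.
have := HCp _ _ yr gr.
have -> : `|v x / x - g| = `|v x - g * x| / x.
  rewrite (_ : v x / x - g = (v x - g * x) / x).
    by rewrite normrM normfV (gtr0_norm x0).
  by field; exact: lt0r_neq0.
move=> h.
have h2 : `|(v x / x) `^ lam - g `^ lam| <= Cp * (g * C * x).
  apply: (le_trans h); rewrite ler_pM2l// ler_pdivrMr//.
have wE : wave t = (v x / x) `^ lam * x `^ lam.
  have vx0 : 0 <= v x by exact: (sol_ge0 (S x0) (lexx x)).
  rewrite /wave -/x (psiE (S x0) (lexx x)) -powRM.
  - by rewrite divfK// gt_eqF.
  - by apply: mulr_ge0 => //; rewrite invr_ge0 ltW.
  - exact: ltW.
have xl : x `^ lam = t `^ lam * c^-1 `^ lam by rewrite /x powRM ?invr_ge0 ?(ltW t0) ?(ltW c0).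
have CE : (g / c) `^ lam * t `^ lam = g `^ lam * x `^ lam.
  by rewrite xl powRM ?invr_ge0 ?(ltW g0) ?(ltW c0)//; ring.
rewrite CE wE -mulrBl normrM (ger0_norm (powR_ge0 _ _)).
apply: (@le_trans _ _ (Cp * (g * C * x) * x `^ lam)).
  by rewrite ler_wpM2r// powR_ge0.
rewrite powRD ?(gt_eqF t0) ?implybT// powRr1 ?(ltW t0)// xl /C2 /x.
by rewrite le_eqVlt; apply/orP; left; apply/eqP; ring.
Qed.

End Wave.

Theorem theorem2p3 (R : realType) (m D r : R)
    (b b1 d d1 d2 : R -> R) (sM kappa zeta1 zeta2 : R) :
  1 < m -> 0 < D -> 0 <= r ->
  (* standing assumptions on d *)
  C2_nonneg d d1 d2 -> d 0 = 0 ->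
  (forall s, 0 < s -> 0 < d1 s) ->
  (forall s, 0 < s -> 0 <= d2 s) ->
  (* standing assumptions on b *)
  C1_nonneg b b1 -> (forall s, 0 <= s -> 0 <= b s) ->
  0 < sM -> local_extremum b sM ->
  (forall s, 0 < s -> local_extremum b s -> s = sM) ->
  (forall s, 0 <= s -> b s <= b sM) ->
  b 0 = 0 ->
  0 < kappa -> b kappa = d kappa ->
  d1 0 < b1 0 -> b1 kappa < d1 kappa ->
  (forall s, 0 < s < kappa -> d s < b s /\ b s <= b1 0 * s) ->
  sM < kappa ->
  (* zeta2 = d^{-1}(M), M = b(sM); zeta1 in (0,sM) with b(zeta1) = b(zeta2) *)
  0 <= zeta2 -> d zeta2 = b sM ->
  0 < zeta1 < sM -> b zeta1 = b zeta2 ->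
  exists c0 : R, 0 < c0 /\
  exists phi : R -> R,
    [/\ semi_wavefront m D r kappa c0 b d phi,
        sharp_at phi 0,
        (zeta1%:E <= lim_inf_pinfty phi)%E,
        (lim_sup_pinfty phi <= zeta2%:E)%E &
        exists Lam C1 C2 : R,
          [/\ (m - 1)^-1 < Lam, 0 < C1, 0 < C2 &
              forall t : R, 0 < t < 1 ->
                `|phi t - C1 * t `^ ((m - 1)^-1)| <= C2 * t `^ Lam]].
Proof.
move=> m1 D0 r0 [Cd _] d0 d1_gt0 _ Cb b_ge0 sM0 _ bext bM b0 k0 bk _ _ bd sMk
  z20 dz2 /andP[z10 z1sM] bz.
have lam0 : 0 < (m - 1)^-1 by rewrite invr_gt0 subr_gt0.
have lip X : exists2 L, 0 < L & forall x y, 0 <= x <= X -> 0 <= y <= X ->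
    `|d x - d y| <= L * `|x - y| /\ `|b x - b y| <= L * `|x - y|.
  have [Ld Ld0 HLd] := C1_nonneg_lipschitz Cd X.
  have [Lb Lb0 HLb] := C1_nonneg_lipschitz Cb X.
  exists (Ld + Lb); first exact: addr_gt0.
  move=> x y xX yX; split.
    by apply: (le_trans (HLd x y xX yX)); rewrite ler_wpM2r// lerDl ltW.
  by apply: (le_trans (HLb x y xX yX)); rewrite ler_wpM2r// lerDr ltW.
have dinc := C1_nonneg_increasing Cd d1_gt0.
have bqc := unimodal_quasiconcave Cb bext bM.
have bmax x : 0 <= x -> b x <= d zeta2 by rewrite dz2; exact: bM.
have z1k : zeta1 < kappa by exact: lt_trans sMk.
have kz2 : kappa <= zeta2.
  rewrite leNgt; apply/negP => /(dinc _ _ z20).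
  by rewrite dz2 -bk ltNge bM// ltW.
(* Quasi-concavity on [sM, zeta2], which contains [kappa]; the next bound uses it on [x, sM]. *)
have bk1 : b zeta1 <= b kappa.
  have := bqc sM kappa zeta2 (ltW sM0) (ltW sMk) kz2.
  by rewrite min_r -?bz// bz bM.
have bz1 x : 0 <= x -> x <= zeta1 -> b x <= b zeta1.
  move=> x0 xz; have := bqc x zeta1 sM x0 xz (ltW z1sM).
  by rewrite min_l// bM.
have dltb x : 0 < x -> x < kappa -> d x < b x.
  by move=> x0 xk; have [] := bd x; rewrite ?x0.
have [L L0 HL] := lip kappa.
(* The Lipschitz constant serves up to [kappa]; beyond it the maximum of [b] lies below the line of
   slope [b sM / kappa]. *)
pose Lb := L + b sM / kappa.
have bMk : 0 <= b sM / kappa by rewrite divr_ge0 ?b_ge0// ltW.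
have Lb0 : 0 < Lb by rewrite ltr_wpDr.
have bLb x : 0 <= x -> b x <= Lb * x.
  move=> x0; rewrite mulrDl; have [xk|kx] := leP x kappa.
    have x_ : 0 <= x <= kappa by rewrite x0.
    have o_ : 0 <= (0:R) <= kappa by rewrite lexx ltW.
    have [_] := HL x 0 x_ o_; rewrite b0 !subr0 (ger0_norm x0) => h.
    apply: (le_trans (ler_norm _)); apply: (le_trans h).
    by rewrite lerDl mulr_ge0.
  rewrite ler_wpDl//; first by rewrite mulr_ge0// ltW.
  apply: (le_trans (bM x x0)); rewrite mulrAC ler_pdivlMr//.
  by rewrite ler_wpM2l ?b_ge0// ltW.
have [g [v [W [[g0 Hfl] S Hz2 [X X0 HX] Hmono]]]] :=
  critical_profile lam0 r0 d0 b0 lip dinc bqc bmax z10 z1k kz2 bz bk1 bz1 bk dltb Lb0 bLb.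
(* The relation between speed and shooting parameter, solved for [c]. The value [g] was found from
   [m], [r], [b] and [d] alone. *)
pose c := Num.sqrt (g * m * D * (m - 1)^-1).
have m0 : 0 < m by exact: lt_trans m1.
have a0 : 0 < g * m * D * (m - 1)^-1 by rewrite !mulr_gt0.
have c0 : 0 < c by rewrite sqrtr_gt0.
have cg : c ^+ 2 = g * m * D * (m - 1)^-1 by rewrite sqr_sqrtr// ltW.
pose phi := wave m c v.
have phile : forall t, phi t <= zeta2 by move=> t; exact: Hz2.
have phige t : c * X <= t -> zeta1 <= phi t.
  by move=> h; apply: HX; rewrite ler_pdivlMr// mulrC.
have cphi : continuous phi by exact: (wave_continuous m1 S).
have phi0 t : t <= 0 -> phi t = 0 by exact: (wave_le0 m1 c0 S).
have sup2 : (lim_sup_pinfty phi <= zeta2%:E)%E.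
  by apply: (@lim_sup_pinfty_le _ _ _ 0) => t _.
have inf1 : (zeta1%:E <= lim_inf_pinfty phi)%E by exact: lim_inf_pinfty_ge phige.
exists c; split=> //; exists phi; split=> //.
- split.
  + split.
    * exact: wave_ge0.
    * by exists zeta2 => t; rewrite ger0_norm ?wave_ge0.
    * exact: (wave_W11loc m1 g0 c0 S Hfl).
    * exact: (wave_powR_W11loc m1 D0 c0 cg S).
  + exact: (wave_weak_solution m1 D0 r0 d0 b0 lip c0 cg S).
  + split.
    * apply/cvgrPdist_lt => e e0; near=> t.
      by rewrite phi0 ?subrr ?normr0//; near: t; exact: nbhs_ninfty_le.
    * by apply: lt_le_trans inf1; rewrite lte_fin.
    * exact: lim_inf_sup_pinfty.
    * by apply: le_lt_trans sup2 _; exact: ltry.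
  + apply: maximal_monotone_interval => //; case: Hmono => [H|[t kt Ht]].
      by left=> x y xy; apply: H; rewrite ler_pM2r// invr_gt0.
    right; exists (c * t); first by rewrite /phi /wave (mulrC c) mulfK ?gt_eqF.
    move=> x y xy yt; apply: Ht; first by rewrite ler_pM2r// invr_gt0.
    by rewrite ler_pdivrMr// mulrC.
- split; first exact: phi0.
  by move=> t t0; exact: (wave_gt0 c0 S).
- exact: (wave_asymptotics m1 r0 d0 b0 lip g0 c0 S).
Unshelve. all: by end_near. Qed.
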